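(* Let $A$ be a $\mathbb{Z}$-graded algebra with graded subalgebras $A^0, A^{\le 0}, A^{\ge 0}\subset A$ satisfying assumptions (1)–(3) listed in the context. Let $D=D^b(A\text{-mod})$, and let $D_{\infty/2}\subset D$ be the full triangulated subcategory of $D$ generated by $A^{\ge 0}$-injective (equivalently, $A^{\ge 0}$-projective) $A$-modules. Then for $X,Y\in D$ and every $i\in\mathbb{Z}$ there is a natural isomorphism $$\mathrm{Hom}_{D_{D_{\infty/2}}}(X,Y[i])\;\cong\;\mathrm{Ext}^{\infty/2+i}(X,Y),$$ where the left-hand side denotes morphisms from $X$ to $Y[i]$ in $D$ through the subcategory $D_{\infty/2}$, and the right-hand side denotes semi-infinite Ext.
   Context: All algebras are associative and unital over a field. Standing assumptions. $A$ is a $\mathbb{Z}$-graded algebra, with fixed graded subalgebras $A^0$, $A^{\le 0}$, $A^{\ge 0}\subset A$ such that: (1) $A^{\le 0}$ and $A^{\ge 0}$ are graded by, respectively, $\mathbb{Z}^{\le 0}$ and $\mathbb{Z}^{\ge 0}$, and $A^0=A^{\le 0}\cap A^{\ge 0}$ is the component of degree $0$ in $A^{\ge 0}$ and in $A^{\le 0}$; (2) the multiplication maps $A^{\ge 0}\otimes_{A^0}A^{\le 0}\to A$ and $A^{\le 0}\otimes_{A^0}A^{\ge 0}\to A$ are isomorphisms; (3) $A$ is finite dimensional, $A^0$ is semisimple, and $A^{\ge 0}$ is self-injective (i.e. the free $A^{\ge 0}$-module is injective). ''Module'' means finite dimensional graded module; $A\text{-mod}$ is the category of finite dimensional graded $A$-modules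 with degree-preserving morphisms. An $A$-module is called $A^{\ge 0}$-injective (resp. $A^{\ge 0}$-projective, $A^{\le 0}$-injective) if its restriction to $A^{\ge 0}$ (resp. $A^{\ge 0}$, $A^{\le 0}$) is injective (resp. projective, injective) as a module over that subalgebra. By self-injectivity, $A^{\ge 0}$-injective is the same as $A^{\ge 0}$-projective. Weights. A bounded below complex of graded modules is convex if for any $n\in\mathbb{Z}$ the sum (over all terms of the complex) of the weight spaces of degree more than $n$ is finite dimensional; it is concave if for any $n\in\mathbb{Z}$ the sum of the weight spaces of degree less than $n$ is finite dimensional. Semi-infinite Ext. For $X,Y\in D$ let $J_\searrow^X$ be a convex bounded below complex of $A^{\ge 0}$-injective $A$-modules quasiisomorphic to $X$, and let $J_\nearrow^Y$ be a concave bounded below complex of $A^{\le 0}$-injective $A$-modules quasiisomorphic to $Y$ (such complexes exist). One defines $$\mathrm{Ext}^{\infty/2+i}(X,Y)=H^i\big(\mathrm{Hom}^\bullet(J_\searrow^X,J_\nearrow^Y)\big),$$ where $\mathrm{Hom}^\bullet$ is the complex of homomorphisms formed in the category of graded $A$-modules. The theorem is asserted for any choice of such resolutions; in particular the result is independent of the choice. Morphisms through a subcategory. Let $\mathcal{A}$ be a triangulated category and $\mathcal{B}\subset\mathcal{A}$ a (strictly) full triangulated subcategory. For $X,Y\in\mathcal{A}$, $\mathrm{Hom}_{\mathcal{A}_{\mathcal{B}}}(X,Y)$ is the set $\pi_0$ of connected components of the category whose objects are diagrams $X\xrightarrow{f}Z\xrightarrow{g}Y$ in $\mathcal{A}$ with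 $Z\in\mathcal{B}$, a morphism from $(Z,f,g)$ to $(Z',f',g')$ being a morphism $h:Z\to Z'$ with $h f=f'$ and $g'h=g$; that is, diagrams modulo the equivalence relation generated by the existence of a morphism. It is an abelian group under $(X\xrightarrow{f}Z\xrightarrow{g}Y)+(X\xrightarrow{f'}Z'\xrightarrow{g'}Y)=(X\xrightarrow{(f,f')}Z\oplus Z'\xrightarrow{(g,g')}Y)$. Here $\mathcal{A}=D$ and $\mathcal{B}=D_{\infty/2}$, the smallest strictly full triangulated subcategory containing all $A^{\ge 0}$-injective $A$-modules. *)

(* Defs.v *)
(* All modules are left modules. *)
From Stdlib Require Import Relation_Operators.
From HB Require Import structures.
From mathcomp Require Import all_boot all_order all_algebra falgebra.

Set Implicit Arguments.
Unset Strict Implicit.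
Unset Printing Implicit Defensive.

Import Order.TTheory GRing.Theory Num.Theory.
Local Open Scope ring_scope.

Section Gradings.
Variables (k : fieldType) (V : vectType k).
Implicit Types (wt : int -> {vspace V}) (s : seq int).

Definition is_grading wt : Prop :=
  exists s, [/\ uniq s, forall n, n \notin s -> wt n = 0%VS,
                (\sum_(n <- s) wt n)%VS = fullv
              & directv (\sum_(n <- s) wt n)].

Lemma sumv_ext wt s s' :
  uniq s -> uniq s' -> {subset s <= s'} ->
  (forall n, n \notin s -> wt n = 0%VS) ->
  (\sum_(n <- s') wt n = \sum_(n <- s) wt n)%VS
  /\ (\sum_(n <- s') \dim (wt n) = \sum_(n <- s) \dim (wt n))%N.
Proof.
move=> us us' ss' w0.
have ps : perm_eq [seq n <- s' | n \in s] s.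
  apply: uniq_perm; rewrite ?filter_uniq // => n; rewrite mem_filter.
  by case: (boolP (n \in s)) => //= /ss' ->.
rewrite -!(perm_big _ ps) /= !big_filter; split.
  rewrite (bigID (mem s)) /= [X in (_ + X)%VS]big1 ?addv0 // => n /w0 ->.
rewrite (bigID (mem s)) /= [X in (_ + X)%N]big1 ?addn0 // => n /w0 ->.
by rewrite dimv0.
Qed.

Lemma gradingP wt s :
  uniq s -> (forall n, n \notin s -> wt n = 0%VS) ->
  (fullv <= \sum_(n <- s) wt n)%VS ->
  (\sum_(n <- s) \dim (wt n) <= \dim {: V})%N -> is_grading wt.
Proof.
move=> us w0 fs ds; exists s.
have E : (\sum_(n <- s) wt n)%VS = fullv.
  by apply/eqP; rewrite eqEsubv subvf fs.
by split=> //; rewrite directvEgeq /= E.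
Qed.

Lemma gradingE wt s : uniq s -> (forall n, n \notin s -> wt n = 0%VS) ->
  is_grading wt -> (\sum_(n <- s) wt n)%VS = fullv
    /\ (\sum_(n <- s) \dim (wt n))%N = \dim {: V}.
Proof.
move=> us w0 [s0 [us0 w00 f0 d0]].
pose t := undup (s ++ s0).
have ut : uniq t by rewrite undup_uniq.
have st : {subset s <= t} by move=> n ns; rewrite mem_undup mem_cat ns.
have s0t : {subset s0 <= t}.
  by move=> n ns; rewrite mem_undup mem_cat ns orbT.
have [E1 E2] := sumv_ext us ut st w0.
have [E3 E4] := sumv_ext us0 ut s0t w00.
rewrite -E1 -E2 E3 E4 f0; split=> //.
by move: d0; rewrite directvE /= f0 => /eqP.
Qed.

Lemma directv_sub wt wt' s : uniq s -> (forall n, (wt' n <= wt n)%VS) ->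
  directv (\sum_(n <- s) wt n) -> directv (\sum_(n <- s) wt' n).
Proof.
move=> us sw; rewrite !directvE /= !(big_tnth _ _ s).
have := @directv_sum_independent _ _ _ predT (fun i => wt (tnth (in_tuple s) i)).
have := @directv_sum_independent _ _ _ predT (fun i => wt' (tnth (in_tuple s) i)).
rewrite !directvE /= => H' H /H Hw; apply/H' => us0 Uu u0.
by apply: Hw => // i _; apply: (subvP (sw _)); exact: Uu.
Qed.

End Gradings.

Section GradedAlgebras.
Variable k : fieldType.

Record gralg := GrAlg {
  ga_alg :> falgType k;
  ga_gr : int -> {vspace ga_alg};
  ga_grading : is_grading ga_gr;
  ga_one : 1 \in ga_gr 0;
  ga_mul : forall m n a b,
    a \in ga_gr m -> b \in ga_gr n -> a * b \in ga_gr (m + n) }.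

(* The type {aspace A} allows a unit other than 1, hence the field gs_one. *)
Record grsub (A : gralg) := GrSub {
  gs_sp :> {aspace A};
  gs_one : 1 \in gs_sp;
  gs_graded : exists s : seq int,
    (gs_sp : {vspace A}) = (\sum_(n <- s) (gs_sp :&: ga_gr A n))%VS }.

Section SubAlgebra.
Variables (A : gralg) (U : grsub A).

Definition sub_gr (n : int) : {vspace subvs_of U} :=
  (linfun (@vsval k A U) @^-1: ga_gr A n)%VS.

Lemma sub_grE n (x : subvs_of U) : (x \in sub_gr n) = (vsval x \in ga_gr A n).
Proof. by rewrite -memv_preim lfunE. Qed.

Lemma sub_grading : is_grading sub_gr.
Proof.
have [s [us w0 fs ds]] := ga_grading A.
have E n : sub_gr n = (linfun (vsproj U) @: (U :&: ga_gr A n))%VS.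
  apply/vspaceP => x; rewrite sub_grE; apply/idP/memv_imgP => [xn | [y]].
    by exists (vsval x); rewrite ?memv_cap ?subvsP // lfunE /= vsvalK.
  by rewrite memv_cap => /andP[yU yn] ->; rewrite lfunE /= vsprojK.
have [s0 U0] := gs_graded U.
have Us : (U <= \sum_(n <- s) (U :&: ga_gr A n))%VS.
  rewrite {1}U0 {U0}; elim: s0 => [|n s0 IH]; first by rewrite big_nil sub0v.
  rewrite big_cons subv_add IH andbT.
  case: (boolP (n \in s)) => [ns | /w0 ->]; last by rewrite capv0 sub0v.
  by rewrite (big_rem n) //= addvSl.
apply: (@gradingP _ _ _ s) => //.
- by move=> n /w0 wn; rewrite E wn capv0 limg0.
- under eq_bigr do rewrite E.
  rewrite -limg_sum; apply/subvP => x _.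
  have -> : x = linfun (vsproj U) (vsval x) by rewrite lfunE /= vsvalK.
  by apply: memv_img; apply: (subvP Us); exact: subvsP.
- have d' : directv (\sum_(n <- s) (U :&: ga_gr A n)).
    by apply: directv_sub ds => // n; exact: capvSr.
  move: d'; rewrite directvE /= => /eqP d'.
  apply: (@leq_trans (\sum_(n <- s) \dim (U :&: ga_gr A n))).
    apply: leq_sum => n _; rewrite E.
    by rewrite -(limg_ker_dim (linfun (vsproj U)) (U :&: _)) leq_addl.
  rewrite -d' dimvf; apply: (@leq_trans (\dim U)); last by [].
  by apply: dimvS; elim/big_ind: _ => [|X Y hX hY|n _];
    rewrite ?sub0v ?capvSl // subv_add hX.
Qed.

Lemma sub_one : (1 : subvs_of U) \in sub_gr 0.
Proof.
by rewrite sub_grE /= (unitr_algid1 (gs_one U)) ?unitr1 ?ga_one.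
Qed.

Lemma sub_mul m n a b :
  a \in sub_gr m -> b \in sub_gr n -> a * b \in sub_gr (m + n).
Proof. by rewrite !sub_grE; exact: ga_mul. Qed.

Definition sub_gralg : gralg := GrAlg sub_grading sub_one sub_mul.

End SubAlgebra.

Record grmod (B : gralg) := GrMod {
  gm_car :> vectType k;
  gm_act : 'Hom(B, 'End(gm_car));
  gm_act1 : gm_act 1 = \1%VF;
  gm_actM : forall a b, gm_act (a * b) = (gm_act a \o gm_act b)%VF;
  gm_wt : int -> {vspace gm_car};
  gm_grading : is_grading gm_wt;
  gm_act_wt : forall m n a v,
    a \in ga_gr B m -> v \in gm_wt n -> gm_act a v \in gm_wt (m + n) }.

Definition gm_zero (B : gralg) (M : grmod B) : Prop := {: M}%VS = 0%VS.

Definition is_grhom (B : gralg) (M N : grmod B) (f : 'Hom(M, N)) : Prop :=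
  (forall a v, f (gm_act M a v) = gm_act N a (f v)) /\
  (forall n v, v \in gm_wt M n -> f v \in gm_wt N n).

Definition gm_injective (B : gralg) (I : grmod B) : Prop :=
  forall (M N : grmod B) (j : 'Hom(M, N)) (f : 'Hom(M, I)),
    is_grhom j -> lker j = 0%VS -> is_grhom f ->
    exists g : 'Hom(N, I), is_grhom g /\ (g \o j)%VF = f.

Section Regular.
Variable B : gralg.

Definition reg_act : 'Hom(B, 'End(B)) := linfun (@amull k B).

Lemma reg_actE a x : reg_act a x = a * x.
Proof. by rewrite /reg_act lfunE /= lfunE. Qed.

Lemma reg_act1 : reg_act 1 = \1%VF.
Proof. by apply/lfunP => x; rewrite reg_actE mul1r lfunE. Qed.

Lemma reg_actM a b : reg_act (a * b) = (reg_act a \o reg_act b)%VF.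
Proof. by apply/lfunP => x; rewrite comp_lfunE !reg_actE mulrA. Qed.

Lemma reg_act_wt m n a v :
  a \in ga_gr B m -> v \in ga_gr B n -> reg_act a v \in ga_gr B (m + n).
Proof. by rewrite reg_actE; exact: ga_mul. Qed.

Definition gm_regular : grmod B :=
  GrMod reg_act1 reg_actM (ga_grading B) reg_act_wt.

End Regular.

Section Restriction.
Variables (A : gralg) (U : grsub A) (M : grmod A).

Definition res_act : 'Hom(sub_gralg U, 'End(M)) :=
  (gm_act M \o linfun (@vsval k A U))%VF.

Lemma res_actE a : res_act a = gm_act M (vsval a).
Proof. by rewrite /res_act comp_lfunE lfunE. Qed.

Lemma res_act1 : res_act 1 = \1%VF.
Proof.
by rewrite res_actE /= (unitr_algid1 (gs_one U)) ?unitr1 // gm_act1.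
Qed.

Lemma res_actM a b : res_act (a * b) = (res_act a \o res_act b)%VF.
Proof. by rewrite !res_actE -gm_actM. Qed.

Lemma res_act_wt m n a v : a \in ga_gr (sub_gralg U) m -> v \in gm_wt M n ->
  res_act a v \in gm_wt M (m + n).
Proof. by rewrite sub_grE res_actE; exact: gm_act_wt. Qed.

Definition gm_res : grmod (sub_gralg U) :=
  GrMod res_act1 res_actM (gm_grading M) res_act_wt.

End Restriction.

Definition injective_over (A : gralg) (U : grsub A) (M : grmod A) : Prop :=
  gm_injective (gm_res U M).

Section DirectSum.
Variables (B : gralg) (M N : grmod B).
Local Notation S := (M * N)%type.

Let inl_fun (x : M) : S := (x, 0).
Let inr_fun (y : N) : S := (0, y).

Fact inl_fun_linear : linear inl_fun.
Proof. by move=> c x y; congr pair => /=; rewrite ?scaler0 ?addr0. Qed.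
Fact inr_fun_linear : linear inr_fun.
Proof. by move=> c x y; congr pair => /=; rewrite ?scaler0 ?addr0. Qed.
HB.instance Definition _ := GRing.isLinear.Build k M S _ inl_fun inl_fun_linear.
HB.instance Definition _ := GRing.isLinear.Build k N S _ inr_fun inr_fun_linear.

Definition in1 : 'Hom(M, S) := linfun inl_fun.
Definition in2 : 'Hom(N, S) := linfun inr_fun.
Definition pr1 : 'Hom(S, M) := linfun (@fst M N).
Definition pr2 : 'Hom(S, N) := linfun (@snd M N).

Lemma in1E x : in1 x = (x, 0). Proof. by rewrite lfunE. Qed.
Lemma in2E x : in2 x = (0, x). Proof. by rewrite lfunE. Qed.
Lemma pr1E z : pr1 z = z.1. Proof. by rewrite lfunE. Qed.
Lemma pr2E z : pr2 z = z.2. Proof. by rewrite lfunE. Qed.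

Definition sum_wt n : {vspace S} := (in1 @: gm_wt M n + in2 @: gm_wt N n)%VS.

Lemma sum_wtE n (z : S) :
  (z \in sum_wt n) = (z.1 \in gm_wt M n) && (z.2 \in gm_wt N n).
Proof.
apply/idP/andP => [/memv_addP[x /memv_imgP[a aM ->]] | [zM zN]].
  case=> y /memv_imgP[b bN ->] ->.
  by rewrite in1E in2E /= addr0 add0r.
have -> : z = in1 z.1 + in2 z.2.
  by rewrite in1E in2E; case: z {zM zN} => x y; congr pair;
    rewrite /= ?addr0 ?add0r.
by rewrite memv_add // memv_img.
Qed.

Lemma dim_limg_le (V W : vectType k) (f : 'Hom(V, W)) (X : {vspace V}) :
  (\dim (f @: X) <= \dim X)%N.
Proof. by rewrite -(limg_ker_dim f X) leq_addl. Qed.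

Lemma sum_grading : is_grading sum_wt.
Proof.
have [s1 [us1 w1 _ _]] := gm_grading M; have [s2 [us2 w2 _ _]] := gm_grading N.
pose s := undup (s1 ++ s2); have us : uniq s by rewrite undup_uniq.
have in_s n : (n \notin s) -> n \notin s1 /\ n \notin s2.
  by rewrite mem_undup mem_cat negb_or => /andP.
have w1s n : n \notin s -> gm_wt M n = 0%VS by case/in_s => /w1.
have w2s n : n \notin s -> gm_wt N n = 0%VS by case/in_s => _ /w2.
have [f1 d1] := gradingE us w1s (gm_grading M).
have [f2 d2] := gradingE us w2s (gm_grading N).
apply: (@gradingP _ _ _ s) => //.
- by move=> n ns; rewrite /sum_wt w1s // w2s // !limg0 addv0.
- rewrite big_split /= -!limg_sum f1 f2; apply/subvP => z _.
  have -> : z = in1 z.1 + in2 z.2.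
    by rewrite in1E in2E; case: z => x y; congr pair; rewrite /= ?addr0 ?add0r.
  by rewrite memv_add // memv_img // memvf.
- apply: (@leq_trans (\sum_(n <- s) (\dim (gm_wt M n) + \dim (gm_wt N n)))).
    apply: leq_sum => n _.
    by rewrite (leq_trans (dimv_add_leqif _ _)) // leq_add // dim_limg_le.
  by rewrite big_split /= d1 d2 !dimvf.
Qed.

Let sum_act_fun (a : B) : 'End(S) :=
  ((in1 \o gm_act M a \o pr1) + (in2 \o gm_act N a \o pr2))%VF.

Fact sum_act_fun_linear : linear sum_act_fun.
Proof.
move=> c a b; rewrite /sum_act_fun !linearP /=.
rewrite !comp_lfunDr !comp_lfunDl -!comp_lfunZr -!comp_lfunZl scalerDr.
by rewrite addrACA.
Qed.
HB.instance Definition _ :=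
  GRing.isLinear.Build k B 'End(S) _ sum_act_fun sum_act_fun_linear.

Definition sum_act : 'Hom(B, 'End(S)) := linfun sum_act_fun.

Lemma sum_actE a z : sum_act a z = (gm_act M a z.1, gm_act N a z.2).
Proof.
rewrite /sum_act lfunE /= /sum_act_fun add_lfunE !comp_lfunE pr1E pr2E in1E in2E.
by congr pair; rewrite /= ?addr0 ?add0r.
Qed.

Lemma sum_act1 : sum_act 1 = \1%VF.
Proof. by apply/lfunP => -[x y]; rewrite sum_actE !gm_act1 !lfunE. Qed.

Lemma sum_actM a b : sum_act (a * b) = (sum_act a \o sum_act b)%VF.
Proof.
by apply/lfunP => z; rewrite comp_lfunE !sum_actE !gm_actM !comp_lfunE.
Qed.

Lemma sum_act_wt m n a z :
  a \in ga_gr B m -> z \in sum_wt n -> sum_act a z \in sum_wt (m + n).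
Proof.
by move=> am; rewrite !sum_wtE sum_actE => /andP[zM zN]; rewrite !gm_act_wt.
Qed.

Definition gm_sum : grmod B := GrMod sum_act1 sum_actM sum_grading sum_act_wt.

Lemma in1_grhom : is_grhom (in1 : 'Hom(M, gm_sum)).
Proof.
split=> [a v|n v vn]; first by rewrite /= sum_actE !in1E linear0.
by rewrite /= sum_wtE in1E /= vn mem0v.
Qed.
Lemma in2_grhom : is_grhom (in2 : 'Hom(N, gm_sum)).
Proof.
split=> [a v|n v vn]; first by rewrite /= sum_actE !in2E linear0.
by rewrite /= sum_wtE in2E /= vn mem0v.
Qed.
Lemma pr1_grhom : is_grhom (pr1 : 'Hom(gm_sum, M)).
Proof.
split=> [a v|n v]; first by rewrite /= sum_actE !pr1E.
by rewrite /= sum_wtE pr1E => /andP[].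
Qed.
Lemma pr2_grhom : is_grhom (pr2 : 'Hom(gm_sum, N)).
Proof.
split=> [a v|n v]; first by rewrite /= sum_actE !pr2E.
by rewrite /= sum_wtE pr2E => /andP[].
Qed.

Lemma pr1_in1 : (pr1 \o in1)%VF = \1%VF.
Proof. by apply/lfunP => x; rewrite comp_lfunE pr1E in1E lfunE. Qed.
Lemma pr2_in2 : (pr2 \o in2)%VF = \1%VF.
Proof. by apply/lfunP => x; rewrite comp_lfunE pr2E in2E lfunE. Qed.
Lemma pr1_in2 : (pr1 \o in2)%VF = 0.
Proof. by apply/lfunP => x; rewrite comp_lfunE pr1E in2E lfunE. Qed.
Lemma pr2_in1 : (pr2 \o in1)%VF = 0.
Proof. by apply/lfunP => x; rewrite comp_lfunE pr2E in1E lfunE. Qed.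

End DirectSum.

Lemma lfunD (V W : vectType k) (f : 'Hom(V, W)) x y : f (x + y) = f x + f y.
Proof. exact: linearD. Qed.
Lemma lfunZ (V W : vectType k) (f : 'Hom(V, W)) c x : f (c *: x) = c *: f x.
Proof. exact: linearZ. Qed.

Lemma lfunN (V W : vectType k) (f : 'Hom(V, W)) x : f (- x) = - f x.
Proof. exact: linearN. Qed.
Lemma lfun0 (V W : vectType k) (f : 'Hom(V, W)) : f 0 = 0.
Proof. exact: linear0. Qed.

Section GrHomTheory.
Variables (B : gralg) (L M N : grmod B).

Lemma grhom0 : is_grhom (0 : 'Hom(M, N)).
Proof. by split=> *; rewrite !lfunE /= ?linear0 ?mem0v. Qed.
Lemma grhom1 : is_grhom (\1%VF : 'Hom(M, M)).
Proof. by split=> *; rewrite !lfunE. Qed.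
Lemma grhom_comp (f : 'Hom(M, N)) (g : 'Hom(L, M)) :
  is_grhom f -> is_grhom g -> is_grhom (f \o g)%VF.
Proof.
move=> [fa fw] [ga gw]; split=> [a v|n v vn]; rewrite !comp_lfunE ?ga ?fa //.
by apply: fw; apply: gw.
Qed.
Lemma grhomD (f g : 'Hom(M, N)) : is_grhom f -> is_grhom g -> is_grhom (f + g).
Proof.
move=> [fa fw] [ga gw]; split=> [a v|n v vn]; rewrite !add_lfunE.
  by rewrite fa ga lfunD.
by rewrite memvD ?fw ?gw.
Qed.
Lemma grhomZ c (f : 'Hom(M, N)) : is_grhom f -> is_grhom (c *: f).
Proof.
move=> [fa fw]; split=> [a v|n v vn]; rewrite !scale_lfunE.
  by rewrite fa lfunZ.
by rewrite memvZ ?fw.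
Qed.
Lemma grhomN (f : 'Hom(M, N)) : is_grhom f -> is_grhom (- f).
Proof. by rewrite -scaleN1r; exact: grhomZ. Qed.

End GrHomTheory.
End GradedAlgebras.

Section Complexes.
Variables (k : fieldType) (A : gralg k).

(* The differential carries both of its degrees, and vanishes unless they are
   consecutive; this keeps shifts and cones free of casts between X (p + 1 + i)
   and X (p + i + 1). *)
Record cpx := Cpx {
  cx_ob :> int -> grmod A;
  cx_d : forall p q, 'Hom(cx_ob p, cx_ob q);
  cx_d_hom : forall p q, is_grhom (cx_d p q);
  cx_d_deg : forall p q, q != p + 1 -> cx_d p q = 0;
  cx_dd : forall p q r, (cx_d q r \o cx_d p q)%VF = 0 }.

Record cmap (X Y : cpx) := CMap {
  cm :> forall p, 'Hom(X p, Y p);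
  cm_hom : forall p, is_grhom (cm p);
  cm_comm : forall p q, (cx_d Y p q \o cm p)%VF = (cm q \o cx_d X p q)%VF }.

Definition cm_id (X : cpx) : cmap X X.
Proof.
apply: (@CMap _ _ (fun p => \1%VF)) => [p|p q]; first exact: grhom1.
by rewrite comp_lfun1l comp_lfun1r.
Defined.

Definition cm_comp (X Y Z : cpx) (g : cmap Y Z) (f : cmap X Y) : cmap X Z.
Proof.
apply: (@CMap _ _ (fun p => (g p \o f p)%VF)) => [p|p q].
  exact: grhom_comp (cm_hom g p) (cm_hom f p).
by rewrite comp_lfunA cm_comm -comp_lfunA cm_comm comp_lfunA.
Defined.

Definition quasi_iso (X Y : cpx) (s : cmap X Y) : Prop := forall p : int,
  (forall x, cx_d X p (p + 1) x = 0 ->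
     (exists y, s p x = cx_d Y (p - 1) p y) ->
     exists x', x = cx_d X (p - 1) p x') /\
  (forall y, cx_d Y p (p + 1) y = 0 ->
     exists x y', cx_d X p (p + 1) x = 0 /\ y = s p x + cx_d Y (p - 1) p y').

Definition bounded_below (X : cpx) : Prop :=
  exists a : int, forall p, p < a -> gm_zero (X p).

Definition bounded (X : cpx) : Prop :=
  exists a b : int, forall p, (p < a) || (b < p) -> gm_zero (X p).

Lemma bounded_bb X : bounded X -> bounded_below X.
Proof. by move=> [a [b h]]; exists a => p pa; apply: h; rewrite pa. Qed.

Section Shift.
Variable i : int.

Definition cx_shift (X : cpx) : cpx.
Proof.
apply: (@Cpx (fun p => X (p + i))
             (fun p q => (-1) ^ i *: cx_d X (p + i) (q + i))) => [p q|p q|p q r].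
- exact/grhomZ/cx_d_hom.
- move=> npq; rewrite cx_d_deg ?scaler0 //.
  by rewrite addrAC (inj_eq (addIr i)).
- by rewrite -comp_lfunZl -comp_lfunZr cx_dd !scaler0.
Defined.

Definition cm_shift (X Y : cpx) (f : cmap X Y) : cmap (cx_shift X) (cx_shift Y).
Proof.
apply: (@CMap (cx_shift X) (cx_shift Y) (fun p => f (p + i))) => [p|p q] /=.
  exact: cm_hom.
by rewrite -comp_lfunZl -comp_lfunZr cm_comm.
Defined.

Lemma shift_cocycle (X : cpx) p (x : X (p + i)) :
  cx_d (cx_shift X) p (p + 1) x = 0 <-> cx_d X (p + i) (p + i + 1) x = 0.
Proof.
rewrite /= scale_lfunE.
suff -> : p + 1 + i = p + i + 1.
  by split=> [/eqP|->]; rewrite ?scaler0 // scaler_eq0 expfz_eq0 oppr_eq0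
    oner_eq0 andbF => /eqP.
by rewrite addrAC.
Qed.

Lemma shift_coboundary (X : cpx) p (x : X (p + i)) :
  (exists y, x = cx_d (cx_shift X) (p - 1) p y) <->
  (exists y, x = cx_d X (p + i - 1) (p + i) y).
Proof.
have u : (-1) ^ i != 0 :> k by rewrite expfz_eq0 oppr_eq0 oner_eq0 andbF.
rewrite /=; suff -> : p - 1 + i = p + i - 1.
  split=> -[y ->].
    by exists ((-1) ^ i *: y); rewrite scale_lfunE lfunZ.
  by exists (((-1) ^ i)^-1 *: y); rewrite scale_lfunE lfunZ scalerA mulfV //
    scale1r.
by rewrite addrAC.
Qed.

Lemma quasi_iso_shift (X Y : cpx) (s : cmap X Y) :
  quasi_iso s -> quasi_iso (cm_shift s).
Proof.
move=> qs p; have [inj sur] := qs (p + i); split.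
  move=> x /shift_cocycle dx /shift_coboundary ex.
  by apply/shift_coboundary; exact: inj.
have aux (V : zmodType) (a b c : V) : a = b + c <-> a - b = c.
  by split=> [->|<-]; rewrite addrC ?addKr ?subrK.
move=> y /shift_cocycle /sur[x [y' [dx /aux e]]]; exists x.
have [|y'' e'] := (shift_coboundary (y - s (p + i) x)).2; first by exists y'.
by exists y''; split; [exact/shift_cocycle | exact/aux].
Qed.

Lemma bounded_shift X : bounded X -> bounded (cx_shift X).
Proof.
move=> [a [b h]]; exists (a - i), (b - i) => p pab; apply: h.
by move: pab; rewrite ltrBrDr ltrBlDr.
Qed.

End Shift.

Lemma gm_zero_sum (M N : grmod A) : gm_zero M -> gm_zero N -> gm_zero (gm_sum M N).
Proof.
move=> m0 n0; apply/eqP; rewrite -subv0; apply/subvP => -[x y] _.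
have z (V : vectType k) (v : V) : {: V}%VS = 0%VS -> v = 0.
  by move=> v0; apply/eqP; rewrite -memv0 -v0 memvf.
by rewrite memv0 (z _ x m0) (z _ y n0).
Qed.

Section ConeAndSum.
Variables X Y : cpx.

Section Cone.
Variable f : cmap X Y.

(* f p : X p -> Y p viewed as a map X p -> Y q: zero unless q = p. *)
Definition cm_off p q : 'Hom(X p, Y q) :=
  match p =P q with
  | ReflectT e => ecast r 'Hom(X p, Y r) e (f p)
  | ReflectF _ => 0
  end.

Lemma cm_off_diag p : cm_off p p = f p.
Proof.
by rewrite /cm_off; case: (p =P p) => // e; rewrite (eq_irrelevance e erefl).
Qed.

Lemma cm_off_neq p q : q != p -> cm_off p q = 0.
Proof. by rewrite /cm_off; case: (p =P q) => // e /eqP[]. Qed.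

Lemma cm_off_hom p q : is_grhom (cm_off p q).
Proof.
have [->|npq] := eqVneq q p; first by rewrite cm_off_diag; exact: cm_hom.
by rewrite cm_off_neq //; exact: grhom0.
Qed.

Lemma cm_off_comm p q r s : q = p + 1 -> s = r + 1 ->
  (cx_d Y r s \o cm_off p r)%VF = (cm_off q s \o cx_d X p q)%VF.
Proof.
move=> -> ->; have [->|nrp] := eqVneq r p; first by rewrite !cm_off_diag cm_comm.
rewrite !cm_off_neq ?comp_lfun0l ?comp_lfun0r //.
by rewrite (inj_eq (addIr 1)).
Qed.

Definition cone_d p q :
    'Hom(gm_sum (X (p + 1)) (Y p), gm_sum (X (q + 1)) (Y q)) :=
  ((in1 _ _ \o (- cx_d X (p + 1) (q + 1)) \o pr1 _ _)
   + (in2 _ _ \o cm_off (p + 1) q \o pr1 _ _)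
   + (in2 _ _ \o cx_d Y p q \o pr2 _ _))%VF.

Lemma cone_dE p q z : cone_d p q z =
  (- cx_d X (p + 1) (q + 1) z.1, cm_off (p + 1) q z.1 + cx_d Y p q z.2).
Proof.
rewrite /cone_d !add_lfunE !comp_lfunE pr1E pr2E in1E !in2E opp_lfunE.
by congr pair; rewrite /= ?addr0 ?add0r.
Qed.

Lemma cone_d_hom p q : is_grhom (cone_d p q).
Proof.
have hX := cx_d_hom X (p + 1) (q + 1); have hY := cx_d_hom Y p q.
have ho := cm_off_hom (p + 1) q.
apply: grhomD; first apply: grhomD.
- apply: (grhom_comp _ (pr1_grhom _ _)); apply: (grhom_comp (in1_grhom _ _)).
  exact: grhomN.
- by apply: (grhom_comp _ (pr1_grhom _ _)); apply: (grhom_comp (in2_grhom _ _)).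
- by apply: (grhom_comp _ (pr2_grhom _ _)); apply: (grhom_comp (in2_grhom _ _)).
Qed.

Lemma cone_d_deg p q : q != p + 1 -> cone_d p q = 0.
Proof.
move=> npq; apply/lfunP => z; rewrite cone_dE cx_d_deg; last first.
  by rewrite (inj_eq (addIr 1)).
by rewrite cm_off_neq // cx_d_deg // !lfunE /= oppr0 addr0.
Qed.

Lemma cone_dd p q r : (cone_d q r \o cone_d p q)%VF = 0.
Proof.
have [eq|npq] := eqVneq q (p + 1); last by rewrite (cone_d_deg npq) comp_lfun0r.
have [er|nqr] := eqVneq r (q + 1); last by rewrite (cone_d_deg nqr) comp_lfun0l.
apply/lfunP => z; rewrite comp_lfunE !cone_dE /= [RHS]lfunE /=.
have dd (V : cpx) a b c x : cx_d V b c (cx_d V a b x) = 0.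
  by rewrite -comp_lfunE cx_dd lfunE.
congr pair; rewrite /=; first by rewrite lfunN /= opprK dd.
have /lfunP/(_ z.1) := @cm_off_comm (p + 1) (q + 1) q r (congr1 (+%R^~ 1) eq) er.
rewrite !comp_lfunE => e.
by rewrite lfunD dd addr0 e lfunN /= addNr.
Qed.

Definition cx_cone : cpx := Cpx cone_d_hom cone_d_deg cone_dd.

Lemma bounded_cone : bounded X -> bounded Y -> bounded cx_cone.
Proof.
move=> [a [b h]] [a' [b' h']].
exists (Num.min (a - 1) a'), (Num.max b b') => p pab.
have [pa|pb] := orP pab; apply: gm_zero_sum.
- by apply: h; move: pa; rewrite lt_min ltrBrDr => /andP[->].
- by apply: h'; move: pa; rewrite lt_min => /andP[_ ->].
- apply: h; move: pb; rewrite gt_max => /andP[pb _].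
  by rewrite (lt_trans pb) ?orbT // ltrDl.
- by apply: h'; move: pb; rewrite gt_max => /andP[_ ->]; rewrite orbT.
Qed.

End Cone.

Definition sum_d p q : 'Hom(gm_sum (X p) (Y p), gm_sum (X q) (Y q)) :=
  ((in1 _ _ \o cx_d X p q \o pr1 _ _)
   + (in2 _ _ \o cx_d Y p q \o pr2 _ _))%VF.

Lemma sum_dE p q z : sum_d p q z = (cx_d X p q z.1, cx_d Y p q z.2).
Proof.
rewrite /sum_d !add_lfunE !comp_lfunE pr1E pr2E in1E !in2E.
by congr pair; rewrite /= ?addr0 ?add0r.
Qed.

Definition cx_sum : cpx.
Proof.
apply: (@Cpx (fun p => gm_sum (X p) (Y p)) sum_d) => [p q|p q npq|p q r].
- have hX := cx_d_hom X p q; have hY := cx_d_hom Y p q.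
  apply: grhomD.
  + by apply: (grhom_comp _ (pr1_grhom _ _)); apply: (grhom_comp (in1_grhom _ _)).
  + by apply: (grhom_comp _ (pr2_grhom _ _)); apply: (grhom_comp (in2_grhom _ _)).
- by apply/lfunP => z; rewrite sum_dE !cx_d_deg // !lfunE.
- apply/lfunP => z; rewrite comp_lfunE !sum_dE /= -!comp_lfunE !cx_dd.
  by rewrite !lfunE.
Defined.

Lemma bounded_sum : bounded X -> bounded Y -> bounded cx_sum.
Proof.
move=> [a [b h]] [a' [b' h']].
exists (Num.min a a'), (Num.max b b') => p pab.
apply: gm_zero_sum; [apply: h | apply: h'];
  by case/orP: pab; rewrite ?lt_min ?gt_max => /andP[h1 h2]; rewrite ?h1 ?h2 ?orbT.
Qed.

Definition cm_in1 : cmap X cx_sum.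
Proof.
apply: (@CMap X cx_sum (fun p => in1 _ _)) => [p|p q].
  exact: in1_grhom.
by apply/lfunP => x; rewrite !comp_lfunE /= sum_dE !in1E /= lfun0.
Defined.

Definition cm_in2 : cmap Y cx_sum.
Proof.
apply: (@CMap Y cx_sum (fun p => in2 _ _)) => [p|p q].
  exact: in2_grhom.
by apply/lfunP => x; rewrite !comp_lfunE /= sum_dE !in2E /= lfun0.
Defined.

Definition cm_pr1 : cmap cx_sum X.
Proof.
apply: (@CMap cx_sum X (fun p => pr1 _ _)) => [p|p q].
  exact: pr1_grhom.
by apply/lfunP => x; rewrite !comp_lfunE /= sum_dE !pr1E.
Defined.

Definition cm_pr2 : cmap cx_sum Y.
Proof.
apply: (@CMap cx_sum Y (fun p => pr2 _ _)) => [p|p q].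
  exact: pr2_grhom.
by apply/lfunP => x; rewrite !comp_lfunE /= sum_dE !pr2E.
Defined.

End ConeAndSum.
End Complexes.

Section DerivedCategories.
Variables (k : fieldType) (A : gralg k).

Record cpx_in (P : cpx A -> Prop) := CpxIn {
  ci_cx :> cpx A;
  ci_in : P ci_cx }.

(* The localization of the category of complexes satisfying P at the
   quasi-isomorphisms, by generators and relations: morphisms are formal
   composites of chain maps and of inverses of quasi-isomorphisms, taken up to
   the congruence dm_eq. *)
Inductive dmor (P : cpx A -> Prop) : cpx_in P -> cpx_in P -> Type :=
| dm_map (X Y : cpx_in P) : cmap X Y -> dmor X Y
| dm_inv (X Y : cpx_in P) (s : cmap X Y) : quasi_iso s -> dmor Y X
| dm_comp (X Y Z : cpx_in P) : dmor Y Z -> dmor X Y -> dmor X Z.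

Definition dm_id (P : cpx A -> Prop) (X : cpx_in P) : dmor X X :=
  dm_map (cm_id X).

Inductive dm_eq (P : cpx A -> Prop) :
  forall X Y : cpx_in P, dmor X Y -> dmor X Y -> Prop :=
| dm_refl (X Y : cpx_in P) (f : dmor X Y) : dm_eq f f
| dm_sym (X Y : cpx_in P) (f g : dmor X Y) : dm_eq f g -> dm_eq g f
| dm_trans (X Y : cpx_in P) (f g h : dmor X Y) :
    dm_eq f g -> dm_eq g h -> dm_eq f h
| dm_congr (X Y Z : cpx_in P) (g g' : dmor Y Z) (f f' : dmor X Y) :
    dm_eq g g' -> dm_eq f f' -> dm_eq (dm_comp g f) (dm_comp g' f')
| dm_assoc (X Y Z T : cpx_in P) (h : dmor Z T) (g : dmor Y Z) (f : dmor X Y) :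
    dm_eq (dm_comp h (dm_comp g f)) (dm_comp (dm_comp h g) f)
| dm_idl (X Y : cpx_in P) (f : dmor X Y) : dm_eq (dm_comp (dm_id Y) f) f
| dm_idr (X Y : cpx_in P) (f : dmor X Y) : dm_eq (dm_comp f (dm_id X)) f
| dm_map_ext (X Y : cpx_in P) (f g : cmap X Y) :
    (forall p, f p = g p) -> dm_eq (dm_map f) (dm_map g)
| dm_map_comp (X Y Z : cpx_in P) (g : cmap Y Z) (f : cmap X Y) :
    dm_eq (dm_map (cm_comp g f)) (dm_comp (dm_map g) (dm_map f))
| dm_invl (X Y : cpx_in P) (s : cmap X Y) (qs : quasi_iso s) :
    dm_eq (dm_comp (dm_inv qs) (dm_map s)) (dm_id X)
| dm_invr (X Y : cpx_in P) (s : cmap X Y) (qs : quasi_iso s) :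
    dm_eq (dm_comp (dm_map s) (dm_inv qs)) (dm_id Y).

Definition dm_iso (P : cpx A -> Prop) (X Y : cpx_in P) (f : dmor X Y) : Prop :=
  exists g : dmor Y X,
    dm_eq (dm_comp g f) (dm_id X) /\ dm_eq (dm_comp f g) (dm_id Y).

Notation Db := (cpx_in (@bounded k A)).
Notation Dplus := (cpx_in (@bounded_below k A)).

Definition db_incl (X : Db) : Dplus := CpxIn (bounded_bb (ci_in X)).

Fixpoint dm_incl (X Y : Db) (f : dmor X Y) : dmor (db_incl X) (db_incl Y) :=
  match f with
  | dm_map X Y f => @dm_map _ (db_incl X) (db_incl Y) f
  | dm_inv X Y s qs => @dm_inv _ (db_incl X) (db_incl Y) s qs
  | dm_comp X Y Z g f => dm_comp (dm_incl g) (dm_incl f)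
  end.

Definition db_shift (i : int) (X : Db) : Db :=
  CpxIn (bounded_shift i (ci_in X)).

Fixpoint dm_shift (i : int) (X Y : Db) (f : dmor X Y) :
    dmor (db_shift i X) (db_shift i Y) :=
  match f with
  | dm_map X Y f => @dm_map _ (db_shift i X) (db_shift i Y) (cm_shift i f)
  | dm_inv X Y s qs =>
      @dm_inv _ (db_shift i X) (db_shift i Y) _ (quasi_iso_shift i qs)
  | dm_comp X Y Z g f => dm_comp (dm_shift i g) (dm_shift i f)
  end.

Definition db_cone (X Y : Db) (f : cmap X Y) : Db :=
  CpxIn (bounded_cone f (ci_in X) (ci_in Y)).

Definition db_sum (X Y : Db) : Db := CpxIn (bounded_sum (ci_in X) (ci_in Y)).

Definition db_in1 (X Y : Db) : dmor X (db_sum X Y) :=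
  @dm_map _ X (db_sum X Y) (cm_in1 X Y).
Definition db_in2 (X Y : Db) : dmor Y (db_sum X Y) :=
  @dm_map _ Y (db_sum X Y) (cm_in2 X Y).
Definition db_pr1 (X Y : Db) : dmor (db_sum X Y) X :=
  @dm_map _ (db_sum X Y) X (cm_pr1 X Y).
Definition db_pr2 (X Y : Db) : dmor (db_sum X Y) Y :=
  @dm_map _ (db_sum X Y) Y (cm_pr2 X Y).

(* The distinguished triangles of Db are those isomorphic to
   X -> Y -> cone f -> X[1] for a chain map f, so closure under cones of chain
   maps and under isomorphism is closure under third vertices. *)
Inductive Dsemi (U : grsub A) : Db -> Prop :=
| Dsemi_module (X : Db) :
    (forall p : int, p != 0 -> gm_zero (X p)) -> injective_over U (X 0) ->
    Dsemi U X
| Dsemi_shift i (X : Db) : Dsemi U X -> Dsemi U (db_shift i X)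
| Dsemi_cone (X Y : Db) (f : cmap X Y) :
    Dsemi U X -> Dsemi U Y -> Dsemi U (db_cone f)
| Dsemi_iso (X Y : Db) (f : dmor X Y) : dm_iso f -> Dsemi U X -> Dsemi U Y.

Record thru (B : Db -> Prop) (X Y : Db) := Thru {
  th_mid : Db;
  th_in : B th_mid;
  th_src : dmor X th_mid;
  th_tgt : dmor th_mid Y }.

Definition thru_step (B : Db -> Prop) (X Y : Db) (t t' : thru B X Y) : Prop :=
  exists h : dmor (th_mid t) (th_mid t'),
    dm_eq (dm_comp h (th_src t)) (th_src t') /\
    dm_eq (dm_comp (th_tgt t') h) (th_tgt t).

Definition thru_eq (B : Db -> Prop) (X Y : Db) : thru B X Y -> thru B X Y -> Prop :=
  clos_refl_sym_trans _ (@thru_step B X Y).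

(* t'' is X -(f,f')-> Z (+) Z' -(g,g')-> Y, the morphisms (f,f') and (g,g') being
   determined in the derived category by their components. *)
Definition thru_sum (B : Db -> Prop) (X Y : Db) (t t' t'' : thru B X Y) : Prop :=
  exists (F : dmor X (db_sum (th_mid t) (th_mid t')))
         (G : dmor (db_sum (th_mid t) (th_mid t')) Y)
         (ZB : B (db_sum (th_mid t) (th_mid t'))),
  [/\ dm_eq (dm_comp (db_pr1 _ _) F) (th_src t) /\ dm_eq (dm_comp (db_pr2 _ _) F) (th_src t'),
      dm_eq (dm_comp G (db_in1 _ _)) (th_tgt t) /\ dm_eq (dm_comp G (db_in2 _ _)) (th_tgt t')
    & t'' = Thru ZB F G].

Definition thru_pre (B : Db -> Prop) (X' X Y : Db) (a : dmor X' X)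
  (t : thru B X Y) : thru B X' Y :=
  Thru (th_in t) (dm_comp (th_src t) a) (th_tgt t).

Definition thru_post (B : Db -> Prop) (X Y Y' : Db) (b : dmor Y Y')
  (t : thru B X Y) : thru B X Y' :=
  Thru (th_in t) (th_src t) (dm_comp b (th_tgt t)).

End DerivedCategories.

Notation Db A := (cpx_in (@bounded _ A)).
Notation Dplus A := (cpx_in (@bounded_below _ A)).

Section SemiInfiniteExt.
Variables (k : fieldType) (A : gralg k).

(* The terms are finite dimensional, so the sum over all terms of the weight
   spaces of degree > n is finite dimensional iff almost all terms contribute 0. *)
Definition convex (J : cpx A) : Prop := forall n : int, exists s : seq int,
  forall p m, p \notin s -> n < m -> gm_wt (J p) m = 0%VS.

Definition concave (J : cpx A) : Prop := forall n : int, exists s : seq int,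
  forall p m, p \notin s -> m < n -> gm_wt (J p) m = 0%VS.

Record resolution (good : cpx A -> Prop) (X : Db A) := Resolution {
  rs_cx :> Dplus A;
  rs_good : good rs_cx;
  rs_map : dmor rs_cx (db_incl X);
  rs_iso : dm_iso rs_map }.

Definition down_res (U : grsub A) (X : Db A) : Type :=
  resolution (fun J => convex J /\ forall p, injective_over U (J p)) X.

Definition up_res (U : grsub A) (X : Db A) : Type :=
  resolution (fun J => concave J /\ forall p, injective_over U (J p)) X.

(* The chain map u represents f in the bounded below derived category. *)
Definition res_over (good : cpx A -> Prop) (X X' : Db A)
    (J : resolution good X) (J' : resolution good X')
    (u : cmap J J') (f : dmor X X') : Prop :=
  dm_eq (dm_comp (rs_map J') (@dm_map _ _ _ J J' u))
        (dm_comp (dm_incl f) (rs_map J)).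

Section HomComplex.
Variables J K : cpx A.

Definition hom_fam : Type := forall p q : int, 'Hom(J p, K q).

Definition hom_cochain (n : int) (f : hom_fam) : Prop :=
  (forall p q, is_grhom (f p q)) /\ (forall p q, q != p + n -> f p q = 0).

Definition hom_d (n : int) (f : hom_fam) : hom_fam := fun p q =>
  ((cx_d K (q - 1) q \o f p (q - 1)%R)
   - (-1) ^ n *: (f (p + 1)%R q \o cx_d J p (p + 1)))%VF.

Definition hom_cocycle (n : int) (f : hom_fam) : Prop :=
  hom_cochain n f /\ forall p q, hom_d n f p q = 0.

Definition hom_cohomologous (n : int) (f g : hom_fam) : Prop :=
  exists h, hom_cochain (n - 1) h /\
    forall p q, f p q - g p q = hom_d (n - 1) h p q.

Definition hom_add (f g : hom_fam) : hom_fam := fun p q => f p q + g p q.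

End HomComplex.

Definition hom_pre (J' J K : cpx A) (u : cmap J' J) (f : hom_fam J K) :
  hom_fam J' K := fun p q => (f p q \o u p)%VF.

Definition hom_post (J K K' : cpx A) (v : cmap K K') (f : hom_fam J K) :
  hom_fam J K' := fun p q => (v q \o f p q)%VF.

End SemiInfiniteExt.

Section Assumptions.
Variables (k : fieldType) (A : gralg k).
Implicit Types U V S : {vspace A}.

(* The multiplication map U (x)_S V -> A is an isomorphism, i.e. (A, mult) is a
   tensor product: every S-balanced k-bilinear map b on U x V (the values of b
   elsewhere are irrelevant) factors uniquely through multiplication. *)
Definition mult_tensor_iso S U V : Prop :=
  forall (W : lmodType k) (b : A -> A -> W),
    (forall c x x' y, x \in U -> x' \in U -> y \in V ->
       b (c *: x + x') y = c *: b x y + b x' y) ->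
    (forall c x y y', x \in U -> y \in V -> y' \in V ->
       b x (c *: y + y') = c *: b x y + b x y') ->
    (forall x a y, x \in U -> a \in S -> y \in V -> b (x * a) y = b x (a * y)) ->
    exists g : {linear A -> W},
      (forall x y, x \in U -> y \in V -> g (x * y) = b x y) /\
      forall g' : {linear A -> W},
        (forall x y, x \in U -> y \in V -> g' (x * y) = b x y) -> g' =1 g.

Definition left_ideal S (L : {vspace A}) : Prop :=
  (L <= S)%VS /\ (S * L <= L)%VS.

Definition simple_left_ideal S (L : {vspace A}) : Prop :=
  [/\ left_ideal S L, L <> 0%VS
    & forall L', left_ideal S L' -> (L' <= L)%VS -> L' = 0%VS \/ L' = L].

Definition semisimple S : Prop :=
  exists Ls : seq {vspace A},
    [/\ forall L, L \in Ls -> simple_left_ideal S L,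
        directv (\sum_(L <- Ls) L) & (\sum_(L <- Ls) L)%VS = S].

Record semi_infinite_data (A0 Aneg Apos : grsub A) : Prop := {
  sid_pos : forall n : int, n < 0 -> (Apos :&: ga_gr A n)%VS = 0%VS;
  sid_neg : forall n : int, 0 < n -> (Aneg :&: ga_gr A n)%VS = 0%VS;
  sid_cap : (A0 : {vspace A}) = (Aneg :&: Apos)%VS;
  sid_pos0 : (A0 : {vspace A}) = (Apos :&: ga_gr A 0)%VS;
  sid_neg0 : (A0 : {vspace A}) = (Aneg :&: ga_gr A 0)%VS;
  sid_pn : mult_tensor_iso A0 Apos Aneg;
  sid_np : mult_tensor_iso A0 Aneg Apos;
  sid_semisimple : semisimple A0;
  sid_selfinj : gm_injective (gm_regular (sub_gralg Apos)) }.

End Assumptions.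

(* Main.v *)
(* Let J and K be the resolutions of X and Y. In high degrees the weights of J are
   negative and those of K are positive, so a chain map c : J -> K[i] factors through
   the brutal truncation J_n to degrees <= n. This is a bounded complex with
   Apos-injective terms, hence lies in D_{infty/2}, and X ~ J -> J_n -> K[i] ~ Y[i]
   is a morphism through D_{infty/2}.

   Conversely, let X -> Z -> Y[i] with Z in D_{infty/2}. By devissage Z is
   quasi-isomorphic to a complex of injectives without Apos-submodules of weights
   < c, so J ~ X -> Z factors through some J_n by convexity of J. The composite
   J_n -> Z -> Y[i] ~ K[i] is a chain map, unique up to homotopy: a module with a
   dual basis over Apos lifts along maps of A-modules that split over Aneg, and
   bounded below acyclic complexes of Aneg-injectives split over Aneg. Here the
   dual basis of an Apos-injective module comes from self-injectivity, by counting
   the simple constituents of the socle of Apos. *)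

From Stdlib Require Import ClassicalEpsilon Setoid Morphisms Relation_Operators.
From HB Require Import structures.
Require Import Defs.
From mathcomp Require Import all_boot all_order all_algebra falgebra zify ring.

Set Implicit Arguments.
Unset Strict Implicit.
Unset Printing Implicit Defensive.

Import Order.TTheory GRing.Theory Num.Theory.
Local Open Scope ring_scope.

(** * Graded modules *)

(** Morphisms in the derived categories are formal composites modulo relations. They are compared
    through a complex of A-injectives as target: homotopy classes of chain maps into it pull back
    along every formal composite ([pull]), which turns [dm_eq] into [htp]. For bounded complexes the
    target is a smart truncation of such a resolution, and this shows that Db embeds fully
    faithfully into Dplus, where J and K live.

    The modules Hom_k(A, V) supply all resolutions. Since A is both Aneg (x) Apos and Apos (x) Aneg
    over the semisimple A0, they are injective over A, Apos and Aneg at once. Taking for V only the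
    weights >= c of a module loses the embedding, but excludes Apos-submodules of weights < c; the
    resolution stays exact because the complex resolved is Apos-injective and has no such submodules
    either.

    The terms of J_n need not be projective over A, nor those of K injective. A lift from J_n is
    therefore built weight by weight, Apos-linear throughout and Aneg-linear on a growing range of
    weights; both triangular decompositions enter. *)

Section Projectors.
Variable k : fieldType.

Lemma lfunB (V W : vectType k) (f : 'Hom(V, W)) x y : f (x - y) = f x - f y.
Proof. exact: linearB. Qed.

Lemma lfun_sum (V W : vectType k) (f : 'Hom(V, W)) (I : Type) (r : seq I)
    (P : pred I) (F : I -> V) : f (\sum_(i <- r | P i) F i) = \sum_(i <- r | P i) f (F i).
Proof. exact: linear_sum. Qed.

Lemma directv_tnth (V : vectType k) (wt : int -> {vspace V}) (s : seq int) :
  directv (\sum_(n <- s) wt n) = directv (\sum_i wt (tnth (in_tuple s) i)).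
Proof. by rewrite !directvE /= !(big_tnth _ _ s). Qed.

Lemma grading_projectors (V : vectType k) (wt : int -> {vspace V}) :
  is_grading wt -> exists sP : seq int * (int -> 'End(V)),
  [/\ forall n v, sP.2 n v \in wt n,
      forall v, \sum_(n <- sP.1) sP.2 n v = v,
      forall n v, v \in wt n -> sP.2 n v = v
    & forall m n v, v \in wt n -> m != n -> sP.2 m v = 0].
Proof.
case=> s [us w0 fs ds].
pose P n := if n \in s then sumv_pi_for (esym fs) n else 0.
have Pm n v : P n v \in wt n.
  rewrite /P; case: ifP => _; first exact: memv_sum_pi.
  by rewrite lfunE mem0v.
have Ps v : \sum_(n <- s) P n v = v.
  rewrite -[RHS](sumv_pi_uniq_sum (esym fs)) ?filter_predT ?memvf //.
  by apply: eq_big_seq => n ns; rewrite /P ns.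
have key v n : v \in wt n -> forall m, P m v = if m == n then v else 0.
  move=> vn m; case: (boolP (m \in s)) => ms; last first.
    rewrite /P (negbTE ms) lfunE /=; case: eqP => // e; apply/esym/eqP.
    by rewrite -memv0 -(w0 n) // -e.
  have := ds; rewrite directv_tnth => /directv_sum_independent dd.
  case: (boolP (n \in s)) => ns; last first.
    have -> : v = 0 by apply/eqP; rewrite -memv0 -(w0 n).
    by rewrite lfun0 if_same.
  have ms' : (index m s < size s)%N by rewrite index_mem.
  pose i := Ordinal ms'.
  have ti : tnth (in_tuple s) i = m by rewrite (tnth_nth 0) /= nth_index.
  pose us0 j := P (tnth (in_tuple s) j) v - (if tnth (in_tuple s) j == n then v else 0).
  have := dd us0; rewrite /us0 => h.
  apply/eqP; rewrite -subr_eq0; move: (h) => /(_ _ _ i isT); rewrite ti => -> //.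
    move=> j _; rewrite memvB //; case: eqP => [->|] //; by rewrite mem0v.
  rewrite sumrB -(big_tnth _ _ s predT (fun n => P n v)) Ps.
  rewrite -(big_tnth _ _ s predT (fun m => if m == n then v else 0)).
  rewrite (big_rem n) //= eqxx big_seq big1 ?addr0 ?subrr // => j.
  by rewrite mem_rem_uniq // inE => /andP[/negbTE ->].
exists (s, P); split=> //= [n v /key ->|m n v /key ->]; first by rewrite eqxx.
by move/negbTE->.
Qed.

Section Proj.
Variables (V : vectType k) (wt : int -> {vspace V}) (hV : is_grading wt).

Let sP := proj1_sig (constructive_indefinite_description _ (grading_projectors hV)).
Definition gsupp : seq int := sP.1.
Definition gpr : int -> 'End(V) := sP.2.

Let sPP := proj2_sig (constructive_indefinite_description _ (grading_projectors hV)).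

Lemma gpr_mem n v : gpr n v \in wt n.
Proof. by rewrite /gpr /sP; case: sPP. Qed.
Lemma gpr_sum v : \sum_(n <- gsupp) gpr n v = v.
Proof. by rewrite /gpr /gsupp /sP; case: sPP. Qed.
Lemma gpr_id n v : v \in wt n -> gpr n v = v.
Proof. by rewrite /gpr /sP; case: sPP => _ _ h _; exact: h. Qed.
Lemma gpr_neq m n v : v \in wt n -> m != n -> gpr m v = 0.
Proof. by rewrite /gpr /sP; case: sPP => _ _ _ h; exact: h. Qed.

Lemma gprE m n v : v \in wt n -> gpr m v = if m == n then v else 0.
Proof. by move=> vn; case: eqP => [->|/eqP]; [exact: gpr_id | exact: gpr_neq]. Qed.

Lemma gpr_eq0 v : (forall n, gpr n v = 0) -> v = 0.
Proof. by move=> h; rewrite -(gpr_sum v) big1. Qed.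

Lemma gpr_gsupp m v : m \notin gsupp -> gpr m v = 0.
Proof.
move=> ms; rewrite -(gpr_sum v) lfun_sum big_seq big1 // => n ns /=.
by rewrite (gprE _ (gpr_mem n v)); case: eqP => // e; rewrite e ns in ms.
Qed.

Lemma wt_gsupp m : m \notin gsupp -> wt m = 0%VS.
Proof.
move=> ms; apply/eqP; rewrite -subv0; apply/subvP => v /gpr_id <-.
by rewrite gpr_gsupp ?mem0v.
Qed.

Lemma homog_ext (W : vectType k) (f g : 'Hom(V, W)) :
  (forall n v, v \in wt n -> f v = g v) -> f = g.
Proof.
move=> h; apply/lfunP => v; rewrite -(gpr_sum v) !lfun_sum.
by apply: eq_bigr => n _; exact: h (gpr_mem n v).
Qed.

Definition gsub (U : {vspace V}) := forall n v, v \in U -> gpr n v \in U.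

Lemma gsubP (U : {vspace V}) : gsub U -> U != 0%VS ->
  exists n v, [/\ v \in U, v \in wt n & v != 0].
Proof.
move=> gU U0; have := vpick0 U; have := memv_pick U.
move: (vpick U) => v vU; rewrite (negbTE U0) => v0.
apply: NNPP => h; case/negP: v0; apply/eqP; apply: gpr_eq0 => n.
apply: NNPP => /eqP nz; apply: h; exists n, (gpr n v).
by rewrite gU // gpr_mem.
Qed.

Lemma gpr_gpr m n v : gpr m (gpr n v) = if m == n then gpr n v else 0.
Proof. exact: gprE (gpr_mem n v). Qed.

End Proj.

(** The list [s] may have repetitions, so a vector [v] of weight [m] equals [count_mem m s] copies
    of [P m v]. This suffices for directness: [P m] applied to a vanishing sum of weight vectors
    isolates one summand, up to that multiple. *)
Lemma grading_of_projectors (V : vectType k) (wt : int -> {vspace V})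
    (P : int -> 'End(V)) (s : seq int) :
  (forall n v, P n v \in wt n) -> (forall v, \sum_(n <- s) P n v = v) ->
  (forall m n v, v \in wt n -> m != n -> P m v = 0) -> is_grading wt.
Proof.
move=> Pm Ps0 Pn; pose t := undup s.
have P0 m : m \notin s -> forall v, v \in wt m -> v = 0.
  move=> ms v vm; rewrite -(Ps0 v) big_seq big1 // => n ns.
  by apply: Pn vm _; apply: contraNneq ms => <-.
have w0 n : n \notin t -> wt n = 0%VS.
  rewrite mem_undup => ns; apply/eqP; rewrite -subv0; apply/subvP => v vn.
  by rewrite (P0 _ ns v vn) mem0v.
have Pmul m v : v \in wt m -> \sum_(n <- s) P n v = P m v *+ count_mem m s.
  move=> vm; elim: s {Ps0 t P0 w0} => [|n s IH]; first by rewrite big_nil mulr0n.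
  rewrite big_cons /= IH eq_sym mulrnDr; congr (_ + _).
  by case: eqP => [->|/eqP nm]; rewrite ?mulr1n // (Pn _ _ _ vm) // ?mulr0n // eq_sym.
pose Q n : 'End(V) := (P n) *+ count_mem n s.
exists t; split=> //; first exact: undup_uniq.
  apply/eqP; rewrite eqEsubv subvf; apply/subvP => v _.
  rewrite -(Ps0 v); apply: memv_suml => n _.
  case: (boolP (n \in t)) => nt.
    by rewrite (big_rem n) //=; apply: (subvP (addvSl _ _)).
  by have := Pm n v; rewrite w0 // memv0 => /eqP ->; rewrite mem0v.
rewrite directv_tnth; apply/directv_sum_independent => us Uu u0 i _.
pose m := tnth (in_tuple t) i.
have e : P m (us i) *+ count_mem m s = us i by rewrite -(Pmul m) // Uu.
rewrite -e; suff -> : P m (us i) = 0 by rewrite mul0rn.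
have : P m (\sum_i us i) = 0 by rewrite u0 lfun0.
rewrite lfun_sum (bigD1 i) //= big1 ?addr0 // => j ji.
apply: (Pn _ (tnth (in_tuple t) j)); first exact: Uu.
apply: contraNneq ji => e'; apply/eqP; apply: val_inj.
have : uniq t by exact: undup_uniq.
move/uniqP => /(_ 0) h; apply: h; rewrite ?inE ?ltn_ord //.
by rewrite /m !(tnth_nth 0) in e'; rewrite e'.
Qed.

Section Homogenize.
Variables (V W : vectType k) (wtV : int -> {vspace V}) (wtW : int -> {vspace W}).
Variables (hV : is_grading wtV) (hW : is_grading wtW).

(** The degree-preserving part of a linear map. Extensions are constructed without regard to the
    gradings and then replaced by this part, which agrees with them on every homogeneous vector
    whose degree they preserve. *)
Definition hz (f : 'Hom(V, W)) : 'Hom(V, W) :=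
  \sum_(n <- gsupp hV) (gpr hW n \o f \o gpr hV n)%VF.

Lemma hzE f n v : v \in wtV n -> hz f v = gpr hW n (f v).
Proof.
move=> vn; rewrite /hz sum_lfunE.
under eq_bigr => m _ do rewrite !comp_lfunE (gprE hV m vn).
case: (boolP (n \in gsupp hV)) => ns; last first.
  have -> : v = 0 by apply/eqP; rewrite -memv0 -(wt_gsupp ns).
  by rewrite !lfun0 big1 // => m _; case: eqP; rewrite ?lfun0.
have -> : gpr hW n (f v) = \sum_(m <- gsupp hV) gpr hW n (f (gpr hV m v)).
  by rewrite -!lfun_sum gpr_sum.
apply: eq_bigr => m _; rewrite (gprE hV m vn).
by case: eqP => [->|] //; rewrite !lfun0.
Qed.

Lemma hz_wt f n v : v \in wtV n -> hz f v \in wtW n.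
Proof. by move=> vn; rewrite (hzE _ vn) gpr_mem. Qed.

End Homogenize.

Lemma gpr_comm (V W : vectType k) wtV wtW (hV : is_grading wtV) (hW : is_grading wtW)
    (f : 'Hom(V, W)) : (forall n v, v \in wtV n -> f v \in wtW n) ->
  forall n v, f (gpr hV n v) = gpr hW n (f v).
Proof.
move=> gf n v; rewrite -!comp_lfunE; move: v; apply/lfunP; apply: (homog_ext hV) => m x xm.
by rewrite !comp_lfunE (gprE _ _ xm) (gprE _ _ (gf _ _ xm)); case: eqP; rewrite ?lfun0.
Qed.

Section GradedSub.
Variables (V : vectType k) (wt : int -> {vspace V}) (hV : is_grading wt).
Variable (U : {vspace V}).

Definition sub_wt n : {vspace subvs_of U} := (linfun (@vsval k V U) @^-1: wt n)%VS.

Lemma sub_wtE n (x : subvs_of U) : (x \in sub_wt n) = (vsval x \in wt n).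
Proof. by rewrite -memv_preim lfunE. Qed.

Lemma sub_wt_grading : gsub hV U -> is_grading sub_wt.
Proof.
move=> gU.
pose P n : 'End(subvs_of U) := (linfun (vsproj U) \o gpr hV n \o linfun vsval)%VF.
have PE n x : vsval (P n x) = gpr hV n (vsval x).
  by rewrite !comp_lfunE !lfunE /= vsprojK // gU // subvsP.
apply: (@grading_of_projectors _ _ P (gsupp hV)) => [n v|v|m n v].
- by rewrite sub_wtE PE gpr_mem.
- apply: val_inj => /=; rewrite -[RHS](gpr_sum hV).
  have vsum (r : seq int) (F : int -> subvs_of U) :
      vsval (\sum_(n <- r) F n) = \sum_(n <- r) vsval (F n).
    exact: (raddf_sum vsval).
  by rewrite vsum; apply: eq_bigr => n _; rewrite PE.
- rewrite sub_wtE => vn mn; apply: val_inj; rewrite /= PE.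
  exact: gpr_neq vn mn.
Qed.

End GradedSub.
End Projectors.

Section Modules.
Variables (k : fieldType) (B : gralg k).

Definition stable (M : grmod B) (W : {vspace M}) :=
  gsub (gm_grading M) W /\ forall a v, v \in W -> gm_act M a v \in W.

Lemma grhom_gpr (M N : grmod B) (f : 'Hom(M, N)) n v : is_grhom f ->
  f (gpr (gm_grading M) n v) = gpr (gm_grading N) n (f v).
Proof. by case=> _ gf; exact: gpr_comm. Qed.

Lemma stable_ker (M N : grmod B) (f : 'Hom(M, N)) : is_grhom f -> stable (lker f).
Proof.
move=> hf; split=> [n v|a v]; rewrite !memv_ker => /eqP fv.
  by rewrite grhom_gpr // fv lfun0.
by case: hf => ha _; rewrite ha fv lfun0.
Qed.

Lemma stable_img (M N : grmod B) (f : 'Hom(M, N)) (W : {vspace M}) :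
  is_grhom f -> stable W -> stable (f @: W)%VS.
Proof.
move=> hf [gW sW]; split=> [n v|a v] /memv_imgP[u uW ->].
  by rewrite -grhom_gpr // memv_img // gW.
by case: hf => <- _; rewrite memv_img // sW.
Qed.

Lemma stable_full (M : grmod B) : stable (fullv : {vspace M}).
Proof. by split=> [n v _|a v _]; rewrite memvf. Qed.

Lemma stable_limg (M N : grmod B) (f : 'Hom(M, N)) : is_grhom f -> stable (limg f).
Proof. by move=> hf; apply: stable_img hf (stable_full M). Qed.

Lemma stable0 (M : grmod B) : stable (0%VS : {vspace M}).
Proof. by split=> [n v|a v]; rewrite memv0 => /eqP ->; rewrite lfun0 mem0v. Qed.

Section Submodule.
Variables (M : grmod B) (W : {vspace M}) (sW : stable W).

Let act_fun (a : B) : 'End(subvs_of W) :=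
  (linfun (vsproj W) \o gm_act M a \o linfun vsval)%VF.

Fact subact_linear : linear act_fun.
Proof.
move=> c a b; rewrite /act_fun linearP /=.
by rewrite comp_lfunDr comp_lfunDl -comp_lfunZr -comp_lfunZl.
Qed.
HB.instance Definition _ := GRing.isLinear.Build k B 'End(subvs_of W) _ act_fun subact_linear.

Definition subm_act : 'Hom(B, 'End(subvs_of W)) := linfun act_fun.

Lemma subm_actE a x : vsval (subm_act a x) = gm_act M a (vsval x).
Proof.
by rewrite /subm_act lfunE /= /act_fun !comp_lfunE !lfunE /= vsprojK // sW.2 // subvsP.
Qed.

Lemma subm_act1 : subm_act 1 = \1%VF.
Proof. by apply/lfunP => x; apply: val_inj; rewrite /= subm_actE gm_act1 !lfunE. Qed.

Lemma subm_actM a b : subm_act (a * b) = (subm_act a \o subm_act b)%VF.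
Proof.
by apply/lfunP => x; apply: val_inj; rewrite /= comp_lfunE !subm_actE gm_actM comp_lfunE.
Qed.

Lemma subm_act_wt m n a v : a \in ga_gr B m -> v \in sub_wt (gm_wt M) W n ->
  subm_act a v \in sub_wt (gm_wt M) W (m + n).
Proof. by move=> am; rewrite !sub_wtE subm_actE; apply: gm_act_wt. Qed.

Definition gm_sub : grmod B :=
  GrMod subm_act1 subm_actM (sub_wt_grading sW.1) subm_act_wt.

Definition sub_inc : 'Hom(gm_sub, M) := linfun (@vsval k M W).

Lemma sub_incE x : sub_inc x = vsval x. Proof. by rewrite lfunE. Qed.

Lemma sub_inc_hom : is_grhom sub_inc.
Proof.
by split=> [a v|n v]; rewrite !sub_incE ?subm_actE //= sub_wtE.
Qed.

Lemma sub_inc_inj : lker sub_inc = 0%VS.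
Proof. by apply/eqP/lker0P => x y; rewrite !sub_incE => /val_inj. Qed.

Lemma sub_inc_mem x : sub_inc x \in W. Proof. by rewrite sub_incE subvsP. Qed.

Definition sub_lift (N : grmod B) (f : 'Hom(N, M)) : 'Hom(N, gm_sub) :=
  (linfun (vsproj W) \o f)%VF.

Lemma sub_liftE (N : grmod B) (f : 'Hom(N, M)) x : f x \in W ->
  sub_inc (sub_lift f x) = f x.
Proof. by move=> fx; rewrite sub_incE comp_lfunE lfunE /= vsprojK. Qed.

Lemma sub_lift_hom (N : grmod B) (f : 'Hom(N, M)) :
  is_grhom f -> (forall x, f x \in W) -> is_grhom (sub_lift f).
Proof.
move=> [fa fw] fW; have e x : vsval (sub_lift f x) = f x.
  by rewrite -sub_incE sub_liftE.
split=> [a v|n v vn]; first by apply: val_inj; rewrite /= e subm_actE e fa.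
by rewrite /= sub_wtE e fw.
Qed.

End Submodule.

Section ShiftModule.
Variables (d : int) (M : grmod B).

Lemma shift_grading : is_grading (fun n => gm_wt M (n - d)).
Proof.
pose h := gm_grading M.
apply: (@grading_of_projectors _ _ _ (fun n => gpr h (n - d)) [seq n + d | n <- gsupp h]).
- by move=> n v; rewrite gpr_mem.
- move=> v; rewrite big_map -[RHS](gpr_sum h); apply: eq_bigr => n _.
  by rewrite addrK.
- by move=> m n v vn mn; apply: gpr_neq vn _; rewrite (inj_eq (addIr _)).
Qed.

Lemma shift_act_wt m n a v : a \in ga_gr B m -> v \in gm_wt M (n - d) ->
  gm_act M a v \in gm_wt M (m + n - d).
Proof. by rewrite -addrA; exact: gm_act_wt. Qed.

Definition gm_shift : grmod B :=
  GrMod (gm_act1 M) (@gm_actM _ _ M) shift_grading shift_act_wt.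
End ShiftModule.

Definition gm0 : grmod B := gm_sub (stable0 (gm_regular B)).

Lemma gm0_zero : gm_zero gm0.
Proof.
apply/eqP; rewrite -subv0; apply/subvP => x _; rewrite memv0; apply/eqP/val_inj/eqP.
by rewrite /= -memv0 subvsP.
Qed.

Lemma gm_zeroE (M : grmod B) : gm_zero M -> forall v : M, v = 0.
Proof. by move=> M0 v; apply/eqP; rewrite -memv0 -M0 memvf. Qed.

Lemma gm_zeroI (M : grmod B) : (forall v : M, v = 0) -> gm_zero M.
Proof.
move=> h; apply/eqP; rewrite -subv0; apply/subvP => v _.
by rewrite (h v) mem0v.
Qed.

Lemma grhom_to0 (M N : grmod B) (f g : 'Hom(M, N)) : gm_zero N -> f = g.
Proof. by move=> N0; apply/lfunP => v; rewrite (gm_zeroE N0 (f v)) (gm_zeroE N0 (g v)). Qed.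

Lemma grhomB (M N : grmod B) (f g : 'Hom(M, N)) :
  is_grhom f -> is_grhom g -> is_grhom (f - g).
Proof. by move=> hf hg; apply: grhomD => //; exact: grhomN. Qed.

(** Since [t] kills the kernel of [q], it factors through the submodule [limg q], from where
    injectivity extends it. *)
Lemma inj_ext (I M N : grmod B) (q : 'Hom(M, N)) (t : 'Hom(M, I)) :
  gm_injective I -> is_grhom q -> is_grhom t ->
  (forall x, q x = 0 -> t x = 0) -> exists s : 'Hom(N, I), is_grhom s /\ (s \o q)%VF = t.
Proof.
move=> iI hq ht qt; have sW := stable_limg hq.
have q_inv y : y \in limg q -> q (q^-1%VF y) = y by move/limg_lfunVK.
have tq x x' : q x = q x' -> t x = t x'.
  move=> e; apply/eqP; rewrite -subr_eq0 -lfunB; apply/eqP/qt.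
  by rewrite lfunB e subrr.
pose f : 'Hom(gm_sub sW, I) := (t \o q^-1 \o sub_inc sW)%VF.
have fE x : f x = t (q^-1%VF (vsval x)) by rewrite !comp_lfunE sub_incE.
have hf : is_grhom f.
  split=> [a v|n v].
    rewrite [f v]fE -[RHS]ht.1 fE; apply: tq.
    by rewrite hq.1 !q_inv ?subvsP //= subm_actE.
  rewrite /= sub_wtE fE => vn.
  set u := q^-1%VF _.
  (* The chosen preimage [u] need not be homogeneous; its component of weight [n] has the same image
     under [q], hence under [t]. *)
  have -> : t u = t (gpr (gm_grading M) n u).
    by apply: tq; rewrite grhom_gpr // q_inv ?subvsP // gpr_id.
  by apply: ht.2; exact: gpr_mem.
have [g [hg gf]] := iI _ _ _ _ (sub_inc_hom sW) (sub_inc_inj sW) hf.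
exists g; split=> //; apply/lfunP => x; rewrite comp_lfunE.
have qx : q x \in limg q by rewrite memv_img ?memvf.
have -> : q x = sub_inc sW (vsproj (limg q) (q x)) by rewrite sub_incE vsprojK.
rewrite -comp_lfunE gf fE vsprojK //; apply: tq.
by rewrite q_inv.
Qed.

Lemma gm_injective_sum (M N : grmod B) :
  gm_injective M -> gm_injective N -> gm_injective (gm_sum M N).
Proof.
move=> iM iN X Y j f hj kj hf.
have h1 := grhom_comp (pr1_grhom M N) hf; have h2 := grhom_comp (pr2_grhom M N) hf.
have [g1 [hg1 e1]] := iM _ _ j _ hj kj h1; have [g2 [hg2 e2]] := iN _ _ j _ hj kj h2.
exists ((in1 M N \o g1) + (in2 M N \o g2))%VF; split.
  by apply: grhomD; [exact: grhom_comp (in1_grhom _ _) _|exact: grhom_comp (in2_grhom _ _) _].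
apply/lfunP => x; move/lfunP/(_ x): e1; move/lfunP/(_ x): e2.
rewrite !(comp_lfunE, add_lfunE) pr1E pr2E => -> ->; rewrite in1E in2E.
by case: (f x) => a b; congr pair; rewrite /= ?addr0 ?add0r.
Qed.

Lemma gm_injective_zero (M : grmod B) : gm_zero M -> gm_injective M.
Proof.
move=> M0 X Y j f _ _ _; exists 0; split; first exact: grhom0.
exact: grhom_to0.
Qed.

(** Closure of injectives under retracts: [N] is a retract of [M] with section [g]. *)
Lemma gm_injective_bij (M N : grmod B) (f : 'Hom(M, N)) (g : 'Hom(N, M)) :
  is_grhom f -> is_grhom g -> (f \o g)%VF = \1%VF -> gm_injective M -> gm_injective N.
Proof.
move=> hf hg e iM X Y j u hj kj hu.
have [v [hv ev]] := iM _ _ j _ hj kj (grhom_comp hg hu).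
exists (f \o v)%VF; split; first exact: grhom_comp.
by rewrite -comp_lfunA ev comp_lfunA e comp_lfun1l.
Qed.

End Modules.

Lemma lfun_lin (k : fieldType) (V W : vectType k) (f : 'Hom(V, W)) c x y :
  f (c *: x + y) = c *: f x + f y.
Proof. exact: linearP. Qed.

Lemma subv_bigsum (k : fieldType) (V : vectType k) (I : eqType) (r : seq I)
    (F : I -> {vspace V}) (U : {vspace V}) :
  (forall i, i \in r -> (F i <= U)%VS) -> (\sum_(i <- r) F i <= U)%VS.
Proof.
move=> h; rewrite big_seq; elim/big_ind: _ => [|X Y hX hY|i /h] //; first exact: sub0v.
by rewrite subv_add hX.
Qed.

Section MkLin.
Variables (k : fieldType) (V W : vectType k) (f : V -> W) (hf : linear f).
Fact mklin_sig : {F : 'Hom(V, W) | forall x, F x = f x}.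
Proof.
pose L : {linear V -> W} := HB.pack f (GRing.isLinear.Build k V W _ f hf).
by exists (linfun L) => x; rewrite lfunE.
Qed.
Definition mklin : 'Hom(V, W) := sval mklin_sig.
Lemma mklinE x : mklin x = f x. Proof. exact: (svalP mklin_sig). Qed.
End MkLin.

Lemma gpr_sum_uniq (k : fieldType) (V : vectType k) wt (h : is_grading wt) (t : seq int) (v : V) :
  uniq t -> {subset gsupp h <= t} -> \sum_(n <- t) gpr h n v = v.
Proof.
move=> ut st; apply/eqP; rewrite -subr_eq0; apply/eqP/(gpr_eq0 (hV := h)) => m.
rewrite lfunB lfun_sum; apply/eqP; rewrite subr_eq0.
under eq_bigr => n _ do rewrite gpr_gpr.
case: (boolP (m \in t)) => mt; last first.
  rewrite (gpr_gsupp _ (contra (@st m) mt)) big_seq big1 // => n nt.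
  by case: eqP => // e; rewrite e nt in mt.
rewrite (bigD1_seq m) //= eqxx big1 ?addr0 // => n; rewrite eq_sym.
by move/negbTE->.
Qed.

Section HzHom.
Variables (k : fieldType) (B : gralg k) (M N : grmod B) (f : 'Hom(M, N)).

Lemma gpr_act (X : grmod B) m n a (x : X) : a \in ga_gr B m ->
  gpr (gm_grading X) (m + n) (gm_act X a x) = gm_act X a (gpr (gm_grading X) n x).
Proof.
move=> am; rewrite -!comp_lfunE; move: x; apply/lfunP.
apply: (homog_ext (gm_grading X)) => p x xp.
rewrite !comp_lfunE (gprE _ _ xp) (gprE _ _ (gm_act_wt am xp)) (inj_eq (addrI m)).
by case: eqP; rewrite ?lfun0.
Qed.

Lemma act_lin (X : grmod B) (x : X) : exists e : 'Hom(B, X), forall a, e a = gm_act X a x.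
Proof.
have hl : linear (fun a => gm_act X a x).
  by move=> c a b; rewrite lfun_lin add_lfunE scale_lfunE.
by exists (mklin hl) => a; rewrite mklinE.
Qed.

(** A homogeneous [a] moves the weight components of a vector by its degree ([gpr_act]), so taking
    the degree-preserving part keeps linearity in homogeneous [a]; linearity in general follows by
    additivity. *)
Lemma hz_grhom : (forall a v, f (gm_act M a v) = gm_act N a (f v)) ->
  is_grhom (hz (gm_grading M) (gm_grading N) f).
Proof.
move=> fa; split=> [a v|n v]; last exact: hz_wt.
set h := hz _ _ _.
have [e1 e1E] := act_lin v; have [e2 e2E] := act_lin (h v).
suff : (h \o e1)%VF = e2 by move/lfunP/(_ a); rewrite comp_lfunE e1E e2E.
apply: (homog_ext (ga_grading B)) => m b bm; rewrite comp_lfunE e1E e2E.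
rewrite -!comp_lfunE; move: v {e1 e1E e2 e2E}; apply/lfunP.
apply: (homog_ext (gm_grading M)) => n v vn; rewrite !comp_lfunE.
by rewrite /h (hzE _ _ _ (gm_act_wt bm vn)) (hzE _ _ _ vn) fa gpr_act.
Qed.

End HzHom.

(** * Coinduced modules *)

Section Coind.
Variables (k : fieldType) (A : gralg k).
Variables (V : vectType k) (wt : int -> {vspace V}) (hV : is_grading wt).
Local Notation H := 'Hom(A, V).

Let hA := ga_grading A.

(** A map of degree [n] in Hom(A, V) sends A_m into V_(m + n); the formula cuts out this part block
    by block. [undup] keeps a repeated entry of the support from counting a block twice. *)
Fact coind_pr_lin n : linear (fun f : H => (\sum_(m <- undup (gsupp hA))
  (gpr hV (m + n) \o f \o gpr hA m))%VF : H).
Proof.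
move=> c f g; rewrite scaler_sumr -big_split; apply: eq_bigr => m _ /=.
by rewrite comp_lfunDr comp_lfunDl -comp_lfunZr -comp_lfunZl.
Qed.

Definition coind_pr n : 'End(H) := mklin (coind_pr_lin n).

Lemma coind_prE n (f : H) m x : x \in ga_gr A m -> coind_pr n f x = gpr hV (m + n) (f x).
Proof.
move=> xm; rewrite mklinE sum_lfunE.
under eq_bigr => p _ do rewrite !comp_lfunE (gprE _ _ xm).
case: (boolP (m \in undup (gsupp hA))) => ms.
  rewrite (bigD1_seq m) ?undup_uniq //= eqxx big1 ?addr0 // => p /negbTE ->.
  by rewrite !lfun0.
rewrite big_seq big1 => [|p ps].
  have -> : x = 0 by apply/eqP; rewrite -memv0 -(wt_gsupp (hV := hA) (m := m)) // -mem_undup.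
  by rewrite !lfun0.
by case: eqP => [e|]; [rewrite -e ps in ms | rewrite !lfun0].
Qed.

Definition coind_wt n : {vspace H} := lker (coind_pr n - \1%VF).

Lemma coind_wtP n (f : H) : reflect (forall m x, x \in ga_gr A m -> f x \in wt (m + n))
  (f \in coind_wt n).
Proof.
rewrite memv_ker add_lfunE opp_lfunE id_lfunE subr_eq0; apply: (iffP eqP) => [<- m x xm|h].
  by rewrite (coind_prE _ _ xm) gpr_mem.
apply: (homog_ext hA) => m x xm; rewrite (coind_prE _ _ xm).
by apply: gpr_id; exact: h.
Qed.

Lemma coind_grading : is_grading coind_wt.
Proof.
pose s := undup [seq n - m | n <- gsupp hV, m <- gsupp hA].
apply: (@grading_of_projectors _ _ _ coind_pr s) => [n f|f|m n f /coind_wtP h mn].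
- by apply/coind_wtP => m x xm; rewrite (coind_prE _ _ xm) gpr_mem.
- apply: (homog_ext hA) => m x xm; rewrite sum_lfunE.
  under eq_bigr => n _ do rewrite (coind_prE _ _ xm).
  case: (boolP (m \in gsupp hA)) => ms; last first.
    have -> : x = 0 by apply/eqP; rewrite -memv0 -(wt_gsupp ms).
    by rewrite big1 ?lfun0 // => n _; rewrite !lfun0.
  transitivity (\sum_(p <- [seq m + n | n <- s]) gpr hV p (f x)); first by rewrite big_map.
  apply: gpr_sum_uniq; first by rewrite map_inj_uniq ?undup_uniq //; exact: addrI.
  move=> p ps; apply/mapP; exists (p - m); last by rewrite addrC subrK.
  by rewrite mem_undup; apply/allpairsP; exists (p, m).
- apply: (homog_ext hA) => p x xp; rewrite (coind_prE _ _ xp) zero_lfunE.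
  by apply: gpr_neq (h _ _ xp) _; rewrite (inj_eq (addrI _)).
Qed.

Fact coind_act_lin1 a : linear (fun f : H => (f \o amulr a)%VF : H).
Proof. by move=> c f g; rewrite comp_lfunDl -comp_lfunZl. Qed.

Fact coind_act_lin : linear (fun a => mklin (coind_act_lin1 a)).
Proof.
move=> c a b; apply/lfunP => f; rewrite add_lfunE scale_lfunE !mklinE.
have -> : amulr (c *: a + b) = c *: amulr a + amulr b by exact: linearP.
by rewrite comp_lfunDr -comp_lfunZr.
Qed.

Definition coind_act : 'Hom(A, 'End(H)) := mklin coind_act_lin.

Lemma coind_actE a (f : H) x : coind_act a f x = f (x * a).
Proof. by rewrite /coind_act mklinE mklinE comp_lfunE lfunE. Qed.

Fact coind_act1 : coind_act 1 = \1%VF.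
Proof. by apply/lfunP => f; apply/lfunP => x; rewrite coind_actE mulr1 id_lfunE. Qed.
Fact coind_actM a b : coind_act (a * b) = (coind_act a \o coind_act b)%VF.
Proof. by apply/lfunP => f; apply/lfunP => x; rewrite comp_lfunE !coind_actE mulrA. Qed.
Fact coind_act_wt m n a f : a \in ga_gr A m -> f \in coind_wt n ->
  coind_act a f \in coind_wt (m + n).
Proof.
move=> am /coind_wtP h; apply/coind_wtP => p x xp; rewrite coind_actE addrA.
by apply: h; exact: ga_mul.
Qed.

(** The left A-module coinduced from the graded space V, with (a f)(x) = f(x a). Module maps M ->
    [coind] correspond to linear maps M -> V through evaluation at 1; [coind_map] is the inverse
    correspondence. *)
Definition coind : grmod A :=
  GrMod coind_act1 coind_actM coind_grading coind_act_wt.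

Lemma gm_coindE a (f : H) x : (gm_act coind a f : H) x = f (x * a).
Proof. exact: coind_actE. Qed.

Section Univ.
Variables (M : grmod A) (p : 'Hom(M, V)).

Fact coind_map_lin1 (v : M) : linear (fun x : A => p (gm_act M x v)).
Proof. by move=> c x y; rewrite lfun_lin add_lfunE scale_lfunE lfun_lin. Qed.
Fact coind_map_lin : linear (fun v : M => mklin (coind_map_lin1 v)).
Proof.
move=> c v w; apply/lfunP => x.
by rewrite add_lfunE scale_lfunE !mklinE !lfun_lin.
Qed.

Definition coind_map : 'Hom(M, coind) := mklin coind_map_lin.
Lemma coind_mapE v x : (coind_map v : H) x = p (gm_act M x v).
Proof. by rewrite !mklinE. Qed.

Lemma coind_map_act a v : coind_map (gm_act M a v) = gm_act coind a (coind_map v).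
Proof.
by apply/lfunP => x; rewrite /= coind_actE !coind_mapE gm_actM comp_lfunE.
Qed.

Lemma coind_map_hom : (forall n v, v \in gm_wt M n -> p v \in wt n) -> is_grhom coind_map.
Proof.
move=> hp; split=> [a v|n v vn]; first exact: coind_map_act.
by apply/coind_wtP => m x xm; rewrite coind_mapE hp // gm_act_wt.
Qed.

End Univ.

(** By adjunction it is enough to extend the linear map M -> V, [f] followed by evaluation at 1,
    from M to N. A linear left inverse of [j] does this; it ignores degrees, whence the final
    [hz]. *)
Lemma coind_injective : gm_injective coind.
Proof.
move=> M N j f hj /eqP/lker0P kj hf.
have hl : linear (fun g : H => g 1).
  by move=> c g h; rewrite add_lfunE scale_lfunE.
pose p := (mklin hl \o f \o j^-1)%VF.
have jK x : j^-1%VF (j x) = x by apply: lker0_lfunK; apply/lker0P.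
pose F := coind_map p.
have FE x : F (j x) = f x.
  apply/lfunP => a; rewrite coind_mapE !comp_lfunE -hj.1 jK mklinE hf.1.
  by rewrite /= coind_actE mul1r.
exists (hz (gm_grading N) (gm_grading coind) F); split.
  by apply: hz_grhom => a v; exact: coind_map_act.
apply: (homog_ext (gm_grading M)) => n v vn.
rewrite comp_lfunE (hzE _ _ _ (hj.2 _ _ vn)) FE.
by apply: gpr_id; exact: hf.2.
Qed.

End Coind.

(** * Semisimple subalgebras and injectivity over a tensor factor *)

Section Semisimple.
Variables (k : fieldType) (A : gralg k) (S : {aspace A}).
Hypothesis S1 : 1 \in S.
Hypothesis ssS : semisimple S.

(** A representation of [S] given by a linear map on all of A: the conditions are imposed on
    elements of [S] only, so that modules over a larger subalgebra can be extended to A by an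
    arbitrary linear projection. *)
Definition mulS (W : vectType k) (r : 'Hom(A, 'End(W))) :=
  r 1 = \1%VF /\ forall a b, a \in S -> b \in S -> r (a * b) = (r a \o r b)%VF.

Definition stS (W : vectType k) (r : 'Hom(A, 'End(W))) (C : {vspace W}) :=
  forall a v, a \in S -> v \in C -> r a v \in C.

Lemma ev_lin (W : vectType k) (r : 'Hom(A, 'End(W))) (w : W) :
  linear (fun a => r a w).
Proof. by move=> c a b; rewrite lfun_lin add_lfunE scale_lfunE. Qed.

(** A stable [C] meeting [L] trivially is enlarged until C + L is everything. If [v] lies outside,
    then, as 1 is in the sum of the simple left ideals, some simple [Li] has Li v not contained in C
    + L. By simplicity Li -> W / (C + L) is injective, so C + Li v again meets [L] trivially. The
    induction is on the codimension of C + L. *)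
Lemma ss_complement (W : vectType k) (r : 'Hom(A, 'End(W))) (L : {vspace W}) :
  mulS r -> stS r L ->
  exists C : {vspace W}, [/\ stS r C, (C :&: L)%VS = 0%VS & (C + L)%VS = fullv].
Proof.
move=> [r1 rM] sL.
suff H : forall n (C : {vspace W}), stS r C -> (C :&: L)%VS = 0%VS ->
    (\dim {:W} - \dim (C + L) <= n)%N ->
  exists C : {vspace W}, [/\ stS r C, (C :&: L)%VS = 0%VS & (C + L)%VS = fullv].
  apply: (H _ 0%VS _ _ (leqnn _)); last by rewrite cap0v.
  by move=> a v aS; rewrite memv0 => /eqP ->; rewrite lfun0 mem0v.
elim=> [|n IH] C sC CL0 dC.
  exists C; split=> //; apply/eqP; rewrite eqEdim subvf /=.
  by rewrite -subn_eq0 -leqn0.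
case: (boolP ((C + L)%VS == fullv)) => [/eqP e|ne]; first by exists C.
have sCL : stS r (C + L)%VS.
  by move=> a _ aS /memv_addP[c cC [l lL ->]]; rewrite lfunD memv_add ?sC ?sL.
have /subvPn[v _ vn] : ~~ (fullv <= C + L)%VS.
  by apply: contra ne => h; rewrite eqEsubv subvf.
pose ph := mklin (ev_lin r v).
have phE a : ph a = r a v by rewrite mklinE.
case: ssS => Ls [simL _ sumL].
have [Li [LiL [x xL xn]]] : exists Li, Li \in Ls /\ exists2 x, x \in Li & ph x \notin (C + L)%VS.
  apply: NNPP => h; case/negP: vn.
  have -> : v = ph 1 by rewrite phE r1 id_lfunE.
  suff : (S <= ph @^-1: (C + L))%VS by move/subvP/(_ _ S1); rewrite -memv_preim.
  rewrite -sumL; apply: subv_bigsum => Li LiL; apply/subvP => x xL.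
  rewrite -memv_preim; apply: contraT => xn; case: h; exists Li; split=> //.
  by exists x.
have [[LS SL] L0 Lmin] := simL _ LiL.
have Lmul a b : a \in S -> b \in Li -> a * b \in Li.
  by move=> aS bL; apply: (subvP SL); exact: memv_mul.
have ker0 y : y \in Li -> ph y \in (C + L)%VS -> y = 0.
  move=> yL yC; pose K := (Li :&: ph @^-1: (C + L))%VS.
  have [||K0|KL] := Lmin K; last 1 first.
  - case/negP: xn; move: xL; rewrite -KL memv_cap => /andP[_].
    by rewrite -memv_preim.
  - split; first by rewrite (subv_trans (capvSl _ _)).
    apply/prodvP => a b aS; rewrite !memv_cap -!memv_preim => /andP[bL bC].
    rewrite Lmul //= phE rM; [|done|exact: (subvP LS)].
    by rewrite comp_lfunE -phE; exact: sCL.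
  - exact: capvSl.
  by apply/eqP; rewrite -memv0 -K0 memv_cap yL -memv_preim.
pose D := (ph @: Li)%VS.
have sD : stS r D.
  move=> a _ aS /memv_imgP[y yL ->]; rewrite phE -comp_lfunE -rM; [|done|exact: (subvP LS)].
  by rewrite -phE memv_img // Lmul.
apply: (IH (C + D)%VS).
- by move=> a _ aS /memv_addP[c cC [d dD ->]]; rewrite lfunD memv_add ?sC ?sD.
- apply/eqP; rewrite -subv0; apply/subvP => w; rewrite memv_cap => /andP[].
  case/memv_addP => c cC [_ /memv_imgP[y yL ->] ->] wL.
  have y0 : y = 0.
    apply: ker0 => //; have -> : ph y = (- c) + (c + ph y) by rewrite addKr.
    by rewrite memv_add // memvN.
  by move: wL; rewrite y0 lfun0 addr0 => cL; rewrite -CL0 memv_cap cC.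
have lt : (\dim (C + L) < \dim (C + D + L))%N.
  rewrite ltn_neqAle dimvS ?andbT; last by rewrite addvS // addvSl.
  apply: contra xn => /eqP e.
  have /eqP -> : (C + L)%VS == (C + D + L)%VS.
    by rewrite eqEdim -e leqnn andbT addvS // addvSl.
  apply: (subvP (addvSl _ _)); apply: (subvP (addvSr _ _)).
  by rewrite memv_img.
have : (\dim (C + D + L) <= \dim {:W})%N by rewrite dimvS ?subvf.
by move: lt dC; lia.
Qed.

Lemma ss_retract (W1 W2 : vectType k) (r1 : 'Hom(A, 'End(W1))) (r2 : 'Hom(A, 'End(W2)))
    (j : 'Hom(W1, W2)) : mulS r2 -> lker j = 0%VS ->
  (forall a v, a \in S -> j (r1 a v) = r2 a (j v)) ->
  exists r : 'Hom(W2, W1), (r \o j)%VF = \1%VF /\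
    forall a v, a \in S -> r (r2 a v) = r1 a (r v).
Proof.
move=> m2 /eqP kj ja.
have sL : stS r2 (limg j).
  by move=> a _ aS /memv_imgP[v _ ->]; rewrite -ja // memv_img ?memvf.
have [C [sC CL CLf]] := ss_complement m2 sL.
pose r := (j^-1 \o daddv_pi (limg j) C)%VF.
have LC : (limg j :&: C)%VS = 0%VS by rewrite capvC.
have rE v c : c \in C -> r (j v + c) = v.
  move=> cC; rewrite comp_lfunE lfunD daddv_pi_id ?memv_img ?memvf //.
  have -> : daddv_pi (limg j) C c = 0.
    have : c \in (limg j + C)%VS by apply: (subvP (addvSr _ _)).
    move/(daddv_pi_add LC); rewrite (daddv_pi_id CL cC).
    by move/(congr1 (+%R^~ (- c))); rewrite addrK subrr.
  by rewrite addr0 lker0_lfunK.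
exists r; split=> [|a v aS].
  by apply/lfunP => v; rewrite comp_lfunE -[j v]addr0 rE ?mem0v // id_lfunE.
have : v \in (C + limg j)%VS by rewrite CLf memvf.
case/memv_addP => c cC [_ /memv_imgP[u _ ->] ->].
by rewrite addrC lfunD -ja // !rE // sC.
Qed.

End Semisimple.

Section SubRes.
Variables (k : fieldType) (A : gralg k) (U : grsub A).

Definition Uhom (M N : grmod A) (f : 'Hom(M, N)) :=
  (forall a v, a \in U -> f (gm_act M a v) = gm_act N a (f v)) /\
  (forall n v, v \in gm_wt M n -> f v \in gm_wt N n).

Lemma resP (M N : grmod A) (f : 'Hom(M, N)) :
  is_grhom (f : 'Hom(gm_res U M, gm_res U N)) <-> Uhom f.
Proof.
split=> -[fa fw]; split=> // a v.
  by move=> aU; have := fa (vsproj U a) v; rewrite /= !res_actE vsprojK.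
by rewrite /= !res_actE fa // subvsP.
Qed.

Lemma gm_resE (M : grmod A) (a : sub_gralg U) (v : M) :
  gm_act (gm_res U M) a v = gm_act M (vsval a) v.
Proof. exact: (congr1 (fun h : 'End(M) => h v) (res_actE M a)). Qed.

Lemma grhom_Uhom (M N : grmod A) (f : 'Hom(M, N)) : is_grhom f -> Uhom f.
Proof. by move=> [fa fw]; split. Qed.

Lemma grhom_res (M N : grmod A) (f : 'Hom(M, N)) :
  is_grhom f -> is_grhom (f : 'Hom(gm_res U M, gm_res U N)).
Proof. by move=> hf; apply/resP/grhom_Uhom. Qed.

End SubRes.

Section CoindOver.
Variables (k : fieldType) (A : gralg k) (S T U : grsub A).
Hypothesis hT : mult_tensor_iso S T U.

(** Uniqueness of the factorization of the zero balanced map: [q], the identity minus a projection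
    onto T * U, vanishes on all products just like 0, hence is 0. *)
Lemma mult_full : (T * U)%VS = fullv.
Proof.
have [g [_ gu]] := hT (b := fun _ _ => 0 : A) (fun c _ _ _ _ _ _ => esym (etrans (addr0 _) (scaler0 _ c)))
  (fun c _ _ _ _ _ _ => esym (etrans (addr0 _) (scaler0 _ c))) (fun _ _ _ _ _ _ => erefl).
pose q : 'End(A) := (\1 - projv (T * U))%VF.
have qE x : q x = x - projv (T * U) x by rewrite add_lfunE opp_lfunE id_lfunE.
have e1 : forall x, q x = g x.
  apply: (gu q) => a b aT bU; change (q (a * b) = 0).
  by rewrite qE projv_id ?subrr // memv_mul.
have e2 : forall x, (0 : 'End(A)) x = g x.
  by apply: (gu (0 : 'End(A))) => a b _ _; change ((0 : 'End(A)) (a * b) = 0); rewrite zero_lfunE.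
apply/eqP; rewrite eqEsubv subvf; apply/subvP => x _.
have : q x = 0 by rewrite e1 -e2 zero_lfunE.
by rewrite qE => /eqP; rewrite subr_eq0 => /eqP ->; exact: memv_proj.
Qed.

Lemma mult_ext (W : vectType k) (f g : 'Hom(A, W)) :
  (forall x y, x \in T -> y \in U -> f (x * y) = g (x * y)) -> f = g.
Proof.
move=> h; apply/eqP; rewrite -subr_eq0; apply/eqP/lfunP => a; rewrite zero_lfunE.
have : a \in lker (f - g).
  apply: (subvP (_ : (T * U)%VS <= _)%VS); last by rewrite mult_full memvf.
  by apply/prodvP => x y xT yU; apply/eqlfunP; exact: h.
by rewrite memv_ker => /eqP.
Qed.

Hypothesis SU : (S <= U)%VS.
Hypothesis ssS : semisimple S.
Variables (V : vectType k) (wt : int -> {vspace V}) (hV : is_grading wt).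
Local Notation H := (coind A hV).

(** As A = T (x)_S U, the module Hom_k(A, V) is Hom_S(U, Hom_k(T, V)), coinduced from the semisimple
    S. Explicitly, an S-linear retraction [r] of [j] gives the extension F(m)(t u) = f(r(u m))(t):
    it is balanced because [r] is S-linear, and U-linear because U multiplies the right factor. *)
Lemma coind_injective_over : injective_over U H.
Proof.
move=> M1 M2 j f hj kj hf.
pose vsp := linfun (vsproj U); have vspE a : vsp a = vsproj U a by rewrite lfunE.
have one : vsproj U 1 = 1 :> subvs_of U.
  by apply: val_inj; rewrite /= vsprojK ?gs_one // (unitr_algid1 (gs_one U)) ?unitr1.
have vM a b : a \in U -> b \in U -> vsproj U (a * b) = vsproj U a * vsproj U b.
  by move=> aU bU; apply: val_inj; rewrite /= !vsprojK // (subvP (asubv U)) // memv_mul.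
pose ro (M : grmod (sub_gralg U)) : 'Hom(A, 'End(M)) := (gm_act M \o vsp)%VF.
have roE M a : ro M a = gm_act M (vsproj U a) by rewrite comp_lfunE vspE.
have roM M a b : a \in U -> b \in U -> ro M (a * b) = (ro M a \o ro M b)%VF.
  by move=> aU bU; rewrite !roE vM // gm_actM.
have roMv M a b v : a \in U -> b \in U -> ro M (a * b) v = ro M a (ro M b v).
  by move=> aU bU; rewrite (roM M _ _ aU bU) comp_lfunE.
have SU' a : a \in S -> a \in U by move/(subvP SU).
have m2 : mulS S (ro M2).
  split=> [|a b aS bS]; last by rewrite roM // SU'.
  by rewrite roE one gm_act1.
have [|r [rj rS]] := ss_retract (gs_one S) ssS (r1 := ro M1) (r2 := ro M2) (j := j) m2 kj.
  by move=> a v aS; rewrite !roE hj.1.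
pose fH : 'Hom(M1, 'Hom(A, V)) := f.
have fU a v x : a \in U -> fH (ro M1 a v) x = fH v (x * a).
  by move=> aU; rewrite roE /fH hf.1 gm_resE gm_coindE vsprojK.
have evl (x : A) : linear (fun h : 'Hom(A, V) => h x).
  by move=> c g h; rewrite add_lfunE scale_lfunE.
pose b (n u : A) : 'Hom(M2, V) := (mklin (evl n) \o fH \o r \o ro M2 u)%VF.
have bE n u m : b n u m = fH (r (ro M2 u m)) n by rewrite !comp_lfunE mklinE.
have [||| g [gE _]] := hT (b := b).
- by move=> c x x' y _ _ _; apply/lfunP => m; rewrite add_lfunE scale_lfunE !bE lfun_lin.
- move=> c x y y' _ _ _; apply/lfunP => m; rewrite add_lfunE scale_lfunE !bE.
  by rewrite lfun_lin add_lfunE scale_lfunE !lfun_lin add_lfunE scale_lfunE.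
- move=> x a y xT aS yU; apply/lfunP => m; rewrite !bE.
  by rewrite (roMv _ _ _ _ (SU' _ aS) yU); apply: etrans (esym (fU _ _ _ (SU' _ aS))) _;
    rewrite (rS _ _ aS).
pose gh := linfun g; have ghE x : gh x = g x by rewrite lfunE.
have Fl1 (m : M2) : linear (fun x => gh x m) by move=> c x y; rewrite lfun_lin add_lfunE scale_lfunE.
have Fl : linear (fun m : M2 => mklin (Fl1 m)).
  by move=> c m m'; apply/lfunP => x; rewrite add_lfunE scale_lfunE !mklinE lfun_lin.
pose F : 'Hom(M2, 'Hom(A, V)) := mklin Fl.
have FE m x : F m x = gh x m by rewrite !mklinE.
have FU a m : F (gm_act M2 a m) = gm_act (gm_res U H) a (F m).
  set a' := vsval a; have a'U : a' \in U by exact: subvsP.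
  have ea : gm_act M2 a = ro M2 a' by rewrite roE vsvalK.
  apply: mult_ext => x y xT yU.
  have yaU : y * a' \in U by apply: (subvP (asubv U)); exact: memv_mul.
  rewrite gm_resE gm_coindE !FE !ghE -mulrA (gE _ _ xT yU) (gE _ _ xT yaU).
  by rewrite !bE ea (roMv _ _ _ _ yU a'U).
have FJ m : F (j m) = fH m.
  apply: mult_ext => x y xT yU; rewrite FE ghE gE // bE -(fU y) //.
  have -> : ro M2 y (j m) = j (ro M1 y m) by rewrite !roE hj.1.
  by rewrite -[r (j _)]comp_lfunE rj id_lfunE.
pose F' : 'Hom(M2, gm_res U H) := F.
exists (hz (gm_grading M2) (gm_grading (gm_res U H)) F'); split.
  by apply: hz_grhom => a v; exact: FU.
apply: (homog_ext (gm_grading M1)) => n v vn.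
rewrite comp_lfunE (hzE _ _ _ (hj.2 _ _ vn)) [F' _]FJ.
by apply: gpr_id; exact: hf.2.
Qed.

End CoindOver.

(** One representative per class turns [f] into a self-map of the finite set [C] of representatives,
    which is injective there and hence onto. It will be applied to isomorphism classes of simple
    modules. *)
Lemma pigeonhole_equiv (n : nat) (E : 'I_n -> 'I_n -> Prop) (f : 'I_n -> 'I_n) :
  (forall i, E i i) -> (forall i j, E i j -> E j i) ->
  (forall i j l, E i j -> E j l -> E i l) ->
  (forall i j, E (f i) (f j) -> E i j) -> forall i, exists j, E (f j) i.
Proof.
move=> Er Es Et finj i.
pose e i j : bool := if excluded_middle_informative (E i j) then true else false.
have eP x y : reflect (E x y) (e x y).
  by rewrite /e; case: excluded_middle_informative => h; constructor.
pose c x := odflt x [pick y | e x y].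
have cE x : E x (c x).
  by rewrite /c; case: pickP => [y /eP //|h]; exact: Er.
have cP x y : E x y -> c x = c y.
  move=> exy; rewrite /c.
  have -> : [pick z | e x z] = [pick z | e y z].
    apply: eq_pick => z; apply/eP/eP => h; apply: Et h => //; exact: Es.
  by case: pickP => // /(_ y) /eP; case; exact: Er.
have cI x y : c x = c y -> E x y.
  by move=> h; apply: Et (cE x) _; rewrite h; apply: Es.
pose C := [set x | c x == x].
pose g x := c (f x).
have cc x : c (c x) = c x by apply/esym/cP.
have gC : g @: C \subset C.
  by apply/subsetP => _ /imsetP[x _ ->]; rewrite inE /g cc.
have ginj : {in C &, injective g}.
  move=> x y; rewrite !inE => /eqP cx /eqP cy /cI /finj /cP.
  by rewrite cx cy.
have gE : g @: C = C.
  by apply/eqP; rewrite eqEcard gC /= card_in_imset.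
have : c i \in C by rewrite inE cc.
by rewrite -gE => /imsetP[j _ /esym /cI h]; exists j.
Qed.

Lemma seq_int_max (s : seq int) : s != [::] -> exists2 x, x \in s & forall y, y \in s -> y <= x.
Proof.
elim: s => // a s IH _; case: (eqVneq s [::]) => [->|/IH [x xs xm]].
  by exists a => [|y]; rewrite inE // => /eqP ->.
have [ax|xa] := lerP a x.
  by exists x => [|y]; rewrite inE ?xs ?orbT // => /orP[/eqP ->|/xm].
exists a => [|y]; rewrite inE ?eqxx // => /orP[/eqP ->|/xm h] //.
by rewrite (le_trans h) // ltW.
Qed.

Lemma gsub_top (k : fieldType) (V : vectType k) wt (hV : is_grading wt) (W : {vspace V}) :
  gsub hV W -> W != 0%VS -> exists n v, [/\ v \in W, v \in wt n, v != 0 &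
    forall p w, n < p -> w \in W -> w \in wt p -> w = 0].
Proof.
move=> gW W0; have [n0 [v0 [v0W v0n v00]]] := gsubP gW W0.
pose s := [seq n <- gsupp hV | (W :&: wt n)%VS != 0%VS].
have ins n v : v \in W -> v \in wt n -> v != 0 -> n \in s.
  move=> vW vn nz; rewrite mem_filter; apply/andP; split.
    by apply: contraNneq nz => z; rewrite -memv0 -z memv_cap vW.
  by apply: contraR nz => h; rewrite -memv0 -(wt_gsupp (hV := hV) h).
have s0 : s != [::] by apply: contraTneq (ins _ _ v0W v0n v00) => ->.
have [n ns nm] := seq_int_max s0.
move: (ns); rewrite mem_filter => /andP[nz _].
have := memv_pick (W :&: wt n); rewrite memv_cap => /andP[vW vn].
exists n, (vpick (W :&: wt n)); split=> //; first by rewrite vpick0.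
move=> p w np wW wp; apply: contraTeq np => w0.
by rewrite -leNgt nm // (ins p w).
Qed.

(** * Dual bases over the nonnegative part *)

Section DualBasis.
Variables (k : fieldType) (B : gralg k).
Hypothesis Bpos : forall n : int, n < 0 -> ga_gr B n = 0%VS.

(** The last clause says that every nonzero element of B_0 e_i generates it, so that the left ideal
    B_0 e_i is simple. Thus the indices list the simple B_0-modules, possibly with repetitions. *)
Definition simple_idempotents (n : nat) (e : 'I_n -> B) :=
  [/\ \sum_i e i = 1, forall i, e i \in ga_gr B 0, forall i, e i * e i = e i,
      forall i, e i != 0
    & forall i x, x \in ga_gr B 0 -> x * e i != 0 ->
        exists2 b, b \in ga_gr B 0 & b * x * e i = e i].

Variables (n : nat) (e : 'I_n -> B).
Hypothesis he : simple_idempotents e.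
Hypothesis selfinj : gm_injective (gm_regular B).

Let hB := ga_grading B.
Let M0 m (a b : B) : a \in ga_gr B 0 -> b \in ga_gr B m -> a * b \in ga_gr B m.
Proof. by move=> a0 bm; rewrite -(add0r m); exact: ga_mul. Qed.
Let Mr m (a b : B) : a \in ga_gr B m -> b \in ga_gr B 0 -> a * b \in ga_gr B m.
Proof. by move=> a0 bm; rewrite -(addr0 m); exact: ga_mul. Qed.

Definition Blin_deg (M : grmod B) (d : int) (f : 'Hom(M, B)) :=
  (forall a v, f (gm_act M a v) = a * f v) /\
  (forall p v, v \in gm_wt M p -> f v \in ga_gr B (p - d)).

Lemma act_hom (M : grmod B) (y : M) p : y \in gm_wt M p ->
  forall q, exists f : 'Hom(gm_shift q (gm_regular B), gm_shift (q - p) M),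
  is_grhom f /\ forall c, f c = gm_act M c y.
Proof.
move=> yp q; have [f fE] := act_lin y.
exists f; split=> //; split=> [a v|m v]; first by rewrite !fE /= reg_actE gm_actM comp_lfunE.
move=> vm; rewrite fE /=; have -> : m - (q - p) = (m - q) + p by ring.
exact: gm_act_wt.
Qed.

(** Self-injectivity applied to c y |-> c z, which is well defined by the condition on annihilators.
    The maps c |-> c y and c |-> c z become graded after shifting. *)
Lemma ext_cyclic (M : grmod B) (y : M) (z : B) p q :
  y \in gm_wt M p -> z \in ga_gr B q ->
  (forall c, gm_act M c y = 0 -> c * z = 0) ->
  exists f : 'Hom(M, B), Blin_deg (p - q) f /\ f y = z.
Proof.
move=> yp zq h; have [u [hu uE]] := act_hom yp q.
have [t [ht tE]] := act_hom (M := gm_regular B) zq q.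
have [||||s [hs sE]] := inj_ext (I := gm_shift (q - q) (gm_regular B)) (q := u) (t := t).
(* The shift by [q - q] is trivial, but only propositionally; injectivity is carried over from the
   unshifted regular module. *)
- move=> X Y j f hj kj hf.
  have rw (N : grmod B) (g : 'Hom(N, B)) :
      is_grhom (g : 'Hom(N, gm_shift (q - q) (gm_regular B))) <->
      is_grhom (g : 'Hom(N, gm_regular B)).
    by split=> -[ga gw]; split=> // m v /gw /=; rewrite subrr subr0.
  have [g [hg eg]] := selfinj hj kj ((rw _ _).1 hf).
  by exists g; split=> //; apply/(rw _ _).2.
- exact: hu.
- exact: ht.
- by move=> c; rewrite uE tE /= reg_actE; exact: h.
exists s; split.
  split=> [a v|m v vm]; first by rewrite hs.1 /= reg_actE.
  have vm' : v \in gm_wt (gm_shift (q - p) M) (m + q - p).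
    by rewrite /=; have -> : m + q - p - (q - p) = m by ring.
  have := hs.2 _ _ vm'; rewrite /=; have -> // : m + q - p - (q - q) = m - (p - q) by ring.
have : (s \o u)%VF 1 = t 1 by rewrite sE.
by rewrite comp_lfunE uE tE gm_act1 id_lfunE /= reg_actE mul1r.
Qed.

(** The annihilator of a homogeneous element is a graded left ideal. *)
Lemma ann_homog (M : grmod B) (y : M) p (z : B) q :
  y \in gm_wt M p -> z \in ga_gr B q ->
  (forall m c, c \in ga_gr B m -> gm_act M c y = 0 -> c * z = 0) ->
  forall c, gm_act M c y = 0 -> c * z = 0.
Proof.
move=> yp zq h c cy; rewrite -(gpr_sum hB c) mulr_suml big1 // => m _.
apply: (h m); first exact: gpr_mem.
have [f fE] := act_lin y.
suff e0 : (f \o gpr hB m)%VF = (gpr (gm_grading M) (m + p) \o f)%VF.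
  by move/lfunP/(_ c): e0; rewrite !comp_lfunE !fE cy lfun0.
apply: (homog_ext hB) => i t ti; rewrite !comp_lfunE (gprE _ _ ti) !fE.
rewrite (gprE _ _ (gm_act_wt ti yp)) (inj_eq (addIr p)).
by case: eqP => // _; rewrite lfun0 zero_lfunE.
Qed.

(** Killed by the whole positive part. As B_0 is semisimple, such elements lie in the socle of B. *)
Definition socB q (w : B) := w \in ga_gr B q /\
  (forall m c, 0 < m -> c \in ga_gr B m -> c * w = 0).

(** The space e_i B_0 e_j is Hom(B_0 e_i, B_0 e_j), so [E] is isomorphism of the two simple
    modules. *)
Let E i j := exists2 u, u \in ga_gr B 0 & e i * u * e j != 0.

Let e0 i : e i \in ga_gr B 0. Proof. by case: he. Qed.
Let eI i : e i * e i = e i. Proof. by case: he. Qed.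
Let eS i x : x \in ga_gr B 0 -> x * e i != 0 ->
  exists2 b, b \in ga_gr B 0 & b * x * e i = e i.
Proof. by case: he => ? ? ? ?; apply. Qed.

Lemma top_simple (M : grmod B) (y : M) : y != 0 -> exists i, gm_act M (e i) y != 0.
Proof.
move=> y0; apply: NNPP => h; case/negP: y0; apply/eqP.
have -> : y = gm_act M 1 y by rewrite gm_act1 id_lfunE.
have [s1 _ _ _ _] := he; rewrite -s1 lfun_sum sum_lfunE big1 // => i _.
by apply/eqP; apply: contraT => ne; case: h; exists i.
Qed.

Lemma E_refl i : E i i.
Proof. by exists 1; rewrite ?ga_one // mulr1 eI; case: he. Qed.
Lemma E_sym i j : E i j -> E j i.
Proof.
case=> u u0 nz; have [b b0 be] := eS (M0 (e0 i) u0) nz.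
exists b => //; apply: contraTneq (_ : e j != 0) => [h|]; last by case: he.
by rewrite negbK -eI -{2}be !mulrA h !mul0r.
Qed.
Lemma E_trans i j l : E i j -> E j l -> E i l.
Proof.
case=> u u0 nz [v v0 nz']; have [b b0 be] := eS (M0 (e0 i) u0) nz.
exists (u * e j * v); first by apply: M0 => //; exact: Mr.
apply: contraNneq nz' => h.
have -> : e j * v * e l = b * (e i * (u * e j * v) * e l).
  by rewrite -{1}be !mulrA.
by rewrite h mulr0.
Qed.

(** A nonzero vector of top degree in B e_j is killed by the positive part, which would raise its
    degree, and some e_i does not kill it. The assignment of [i] to [j] is the Nakayama permutation
    on which [soc_all] relies. *)
Lemma soc_exists j : exists q i w, [/\ socB q w, w != 0, w * e j = w & e i * w = w].
Proof.
pose W := limg (amulr (e j)).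
have WP x : reflect (x * e j = x) (x \in W).
  apply: (iffP idP) => [/memv_imgP[y _ ->]|<-]; first by rewrite lfunE /= -mulrA eI.
  by apply/memv_imgP; exists x; rewrite ?memvf // lfunE.
have gW : gsub hB W.
  move=> m x /WP xe; apply/WP.
  have gc : forall m x, x \in ga_gr B m -> amulr (e j) x \in ga_gr B m.
    by move=> p y yp; rewrite lfunE /=; exact: Mr.
  have := gpr_comm hB hB gc m x; rewrite !lfunE /= => ->.
  by rewrite xe.
have W0 : W != 0%VS.
  apply: contraTneq (_ : e j != 0) => [h|]; last by case: he.
  by rewrite negbK -memv0 -h; apply/WP.
have [q [w [wW wq w0 wtop]]] := gsub_top gW W0.
have [i] := top_simple (M := gm_regular B) w0; rewrite /= reg_actE => iw.
exists q, i, (e i * w); split=> //; last 2 first.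
- by rewrite -mulrA; move/WP: wW => ->.
- by rewrite mulrA eI.
split=> [|m c m0 cm]; first exact: M0.
apply: (wtop (m + q)); first by rewrite ltrDr.
- by apply/WP; move/WP: wW; rewrite -!mulrA => ->.
- by apply: ga_mul => //; exact: M0.
Qed.

(* A socle element fixed by a simple idempotent generates a simple module, so
   it is annihilated by as little as possible. *)
Lemma soc_ann (M : grmod B) (y : M) p i q w :
  y \in gm_wt M p -> gm_act M (e i) y = y -> y != 0 -> socB q w -> e i * w = w ->
  forall c, gm_act M c y = 0 -> c * w = 0.
Proof.
move=> yp ey y0 [wq ws] ew; apply: ann_homog yp wq _ => m c cm cy.
have [m0|m0|m0] := ltrgtP m 0.
- by move: cm; rewrite Bpos // memv0 => /eqP ->; rewrite mul0r.
- exact: ws m0 cm.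
move: cm; rewrite m0 => cm; rewrite -ew mulrA.
have [->|nz] := eqVneq (c * e i) 0; first by rewrite mul0r.
have [b b0 be] := eS cm nz; case/negP: y0; apply/eqP.
by rewrite -ey -be !gm_actM !comp_lfunE ey cy lfun0.
Qed.

(** The elements w and x w' generate isomorphic simple submodules, so by self-injectivity right
    multiplications by some [d] and [d'] carry each to the other. Their degrees are q' - q and q -
    q', and B has no negative degrees; hence q = q', and e_j d e_j' is a nonzero element of degree
    0. *)
Lemma soc_inj j i w q j' i' w' q' :
  socB q w -> w != 0 -> w * e j = w -> e i * w = w ->
  socB q' w' -> w' != 0 -> w' * e j' = w' -> e i' * w' = w' ->
  E i i' -> E j j'.
Proof.
move=> sw w0 wj iw sw' w'0 w'j' i'w' [u u0 nz].
set x := e i * u * e i' in nz.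
have x0 : x \in ga_gr B 0 by apply: Mr => //; exact: M0.
have ix : e i * x = x by rewrite /x !mulrA eI.
have xi : x * e i' = x by rewrite /x -!mulrA eI.
have [b b0] := eS x0 (etrans (congr1 (fun z => z != 0) xi) nz).
rewrite -mulrA xi => bx.
have xw0 : x * w' != 0.
  by apply: contraNneq w'0 => h; rewrite -i'w' -bx -mulrA h mulr0.
have sxw : socB q' (x * w').
  split=> [|m c m0 cm]; first by apply: M0 => //; case: sw'.
  by rewrite mulrA; case: sw' => _; apply; [exact: m0 | exact: Mr].
have ixw : e i * (x * w') = x * w' by rewrite mulrA ix.
have regE (c y : B) : gm_act (gm_regular B) c y = c * y by rewrite /= reg_actE.
have key (y z : B) p r : socB p y -> socB r z -> y != 0 -> e i * y = y -> e i * z = z ->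
    exists2 d, d \in ga_gr B (r - p) & y * d = z.
  move=> sy sz y0 ey ez.
  have [f [[fl fw] fy]] := @ext_cyclic (gm_regular B) y z p r sy.1 sz.1
     (@soc_ann (gm_regular B) y p i r z sy.1 (etrans (regE _ _) ey) y0 sz ez).
  exists (f 1).
    have -> : r - p = 0 - (p - r) by ring.
    exact: fw (ga_one B).
  by rewrite -fl regE mulr1.
have [d dd wd] := key _ _ _ _ sw sxw w0 iw ixw.
have [d' dd' xd'] := key _ _ _ _ sxw sw xw0 ixw iw.
have qq : q' = q.
  have neg (a : B) r : a \in ga_gr B r -> r < 0 -> a = 0.
    by move=> ar r0; move: ar; rewrite Bpos // memv0 => /eqP.
  have [lt|lt|//] := ltrgtP q' q.
    by case/negP: xw0; rewrite -wd (neg _ _ dd) ?subr_lt0 // mulr0.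
  by case/negP: w0; rewrite -xd' (neg _ _ dd') ?subr_lt0 // mulr0.
exists d; first by rewrite -(subrr q) -{1}qq.
apply: contraNneq xw0 => h.
have -> : x * w' = w * (e j * d * e j') by rewrite !mulrA wj wd -mulrA w'j'.
by rewrite h mulr0.
Qed.

(** Here [nu j] is a simple constituent of the socle of B e_j. By [soc_inj] the map [nu] is
    injective on isomorphism classes, so it meets the class of every [i]; the socle element found
    for [nu j] is then transported to [i] by the isomorphism [x]. *)
Lemma soc_all i : exists q w, [/\ socB q w, w != 0 & e i * w = w].
Proof.
pose R j i := exists q w, [/\ socB q w, w != 0, w * e j = w & e i * w = w].
have Rex j : exists i, R j i.
  by have [q [l [w h]]] := soc_exists j; exists l, q, w.
pose nu j := proj1_sig (constructive_indefinite_description _ (Rex j)).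
have nuP j : R j (nu j) := proj2_sig (constructive_indefinite_description _ (Rex j)).
have [j Eji] : exists j, E (nu j) i.
  apply: (pigeonhole_equiv E_refl E_sym E_trans) => j j'.
  have [q [w [h1 h2 h3 h4]]] := nuP j; have [q' [w' [h1' h2' h3' h4']]] := nuP j'.
  exact: soc_inj h1 h2 h3 h4 h1' h2' h3' h4'.
have [u u0 nz] := E_sym Eji.
have [q [w [sw w0 _ jw]]] := nuP j.
have [b b0 be] := eS (M0 (e0 i) u0) nz.
set x := e i * u * e (nu j) in nz.
exists q, (x * w); split.
- split=> [|m c m0 cm]; first by apply: M0; [apply: Mr => //; exact: M0 | case: sw].
  rewrite mulrA; case: sw => _; apply; first exact: m0.
  by apply: Mr => //; apply: Mr => //; exact: M0.
- apply: contraNneq w0 => h; rewrite -jw -be.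
  have -> : b * (e i * u) * e (nu j) * w = b * (x * w) by rewrite /x !mulrA.
  by rewrite h mulr0.
- by rewrite /x !mulrA eI.
Qed.

Definition freemod (s : seq int) : grmod B :=
  foldr (fun d M => gm_sum (gm_shift d (gm_regular B)) M) (gm0 B) s.

(** While the kernel is nonzero, one more coordinate M -> B is added: for a homogeneous [y] in the
    kernel with e_i y nonzero, it sends e_i y to a socle element of type [i], which exists by
    [soc_all]. The kernel shrinks strictly each time. *)
Lemma free_embedding (M : grmod B) :
  exists s (f : 'Hom(M, freemod s)), is_grhom f /\ lker f = 0%VS.
Proof.
suff H : forall N s (f : 'Hom(M, freemod s)), is_grhom f -> (\dim (lker f) <= N)%N ->
    exists s (f : 'Hom(M, freemod s)), is_grhom f /\ lker f = 0%VS.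
  exact: (H _ [::] 0 (grhom0 _ _) (leqnn _)).
elim=> [|N IH] s f hf dN.
  by exists s, f; split=> //; apply/eqP; rewrite -dimv_eq0 -leqn0.
have [k0|kn0] := eqVneq (lker f) 0%VS; first by exists s, f.
have [gk sk] := stable_ker hf.
have [p [y [yk yp y0 ytop]]] := gsub_top gk kn0.
have [i iy] := top_simple y0; set y1 := gm_act M (e i) y in iy.
have y1p : y1 \in gm_wt M p by rewrite -(add0r p); apply: gm_act_wt.
have y1k : y1 \in lker f by exact: sk.
have [q [w [sw w0 ew]]] := soc_all i.
have ey1 : gm_act M (e i) y1 = y1 by rewrite /y1 -comp_lfunE -gm_actM eI.
have [g [[gl gw] gy]] := ext_cyclic y1p sw.1 (soc_ann y1p ey1 iy sw ew).
pose g' : 'Hom(M, gm_shift (p - q) (gm_regular B)) := g.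
have hg' : is_grhom g'.
  split=> [a v|m v vm]; first by rewrite /g' gl /= reg_actE.
  exact: gw.
pose F : 'Hom(M, freemod ((p - q) :: s)) := ((in1 _ _ \o g') + (in2 _ _ \o f))%VF.
have FE x : F x = (g' x, f x).
  rewrite /F add_lfunE !comp_lfunE in1E in2E.
  by congr pair; rewrite /= ?addr0 ?add0r.
apply: (IH _ F).
  by apply: grhomD; [exact: grhom_comp (in1_grhom _ _) _|exact: grhom_comp (in2_grhom _ _) _].
rewrite -ltnS (leq_trans _ dN) // ltn_neqAle; apply/andP; split; last first.
  by apply: dimvS; apply/subvP => x; rewrite !memv_ker FE => /eqP [_ ->].
have sub : (lker F <= lker f)%VS.
  by apply/subvP => x; rewrite !memv_ker FE => /eqP [_ ->].
apply: contraNneq w0 => h.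
have : y1 \in lker F.
  have /eqP -> // : lker F == lker f by rewrite eqEdim sub h leqnn.
by rewrite memv_ker FE => /eqP [+ _]; rewrite /g' gy => ->.
Qed.

Definition dual_basis (M : grmod B) (l : seq (int * 'Hom(M, B) * M)) :=
  (forall t, t \in l -> Blin_deg t.1.1 t.1.2 /\ t.2 \in gm_wt M t.1.1) /\
  (forall x, x = \sum_(t <- l) gm_act M (t.1.2 x) t.2).

(** An embedding into a free module splits by injectivity. The coordinates of the embedding and the
    images of the free generators under the retraction form the dual basis. *)
Lemma injective_dual_basis (M : grmod B) : gm_injective M -> exists l, @dual_basis M l.
Proof.
move=> iM; have [s [f [hf kf]]] := free_embedding M.
have [r [hr rf]] := iM _ _ _ _ hf kf (grhom1 M).
suff [l [lP lE]] : exists l : seq (int * 'Hom(M, B) * M),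
    (forall t, t \in l -> Blin_deg t.1.1 t.1.2 /\ t.2 \in gm_wt M t.1.1) /\
    (forall x, r (f x) = \sum_(t <- l) gm_act M (t.1.2 x) t.2).
  by exists l; split=> // x; rewrite -lE -comp_lfunE rf id_lfunE.
elim: s f r hf hr {kf rf} => [|d s IH] f r hf hr.
  by exists [::]; split=> // x; rewrite big_nil (gm_zeroE (@gm0_zero _ B) (f x)) lfun0.
pose f2 := (pr2 _ _ \o f)%VF; pose r2 := (r \o in2 _ _)%VF.
have [l [lP lE]] := IH f2 r2 (grhom_comp (pr2_grhom _ _) hf) (grhom_comp hr (in2_grhom _ _)).
pose f1 : 'Hom(M, gm_shift d (gm_regular B)) := (pr1 _ _ \o f)%VF.
pose r1 : 'Hom(gm_shift d (gm_regular B), M) := (r \o in1 _ _)%VF.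
have hf1 : is_grhom f1 := grhom_comp (pr1_grhom _ _) hf.
have hr1 : is_grhom r1 := grhom_comp hr (in1_grhom _ _).
exists ((d, (f1 : 'Hom(M, B)), r1 (1 : B)) :: l); split.
  move=> t; rewrite inE => /orP[/eqP -> /=|/lP //]; split.
    split=> [a v|p v vp]; first by rewrite hf1.1 /= reg_actE.
    exact: hf1.2 vp.
  by apply: hr1.2; rewrite /= subrr ga_one.
move=> x; rewrite big_cons /= -lE.
have -> : gm_act M (f1 x) (r1 (1 : B)) = r1 (f1 x).
  by rewrite -hr1.1 /= reg_actE mulr1.
rewrite /r1 /f1 /r2 /f2 !comp_lfunE pr1E pr2E -lfunD in1E in2E.
by case: (f x) => a b; congr (r (_, _)); rewrite ?addr0 ?add0r.
Qed.

End DualBasis.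

Lemma wt_bounds (k : fieldType) (V : vectType k) (wt : int -> {vspace V}) :
  is_grading wt -> exists a b, forall p, (p < a) || (b < p) -> wt p = 0%VS.
Proof.
case=> s [_ w0 _ _].
have [m mP] : exists m : nat, forall n, n \in s -> `|n| <= m%:Z.
  elim: s {w0} => [|n s [m mP]]; first by exists 0%N.
  exists (maxn `|n|%N m) => p; rewrite inE => /orP[/eqP ->|/mP]; lia.
exists (- m%:Z), m%:Z => p pm; apply: w0; apply: contraTN pm => /mP; lia.
Qed.

Section SemisimpleIdempotents.
Variables (k : fieldType) (A : gralg k) (S : {aspace A}).

(** Decompose 1 into e_i in L_i. For x in L_i the sum of the x e_j in L_j is x, so directness forces
    x e_i = x; in particular e_i is idempotent and generates L_i, and simplicity of L_i gives the
    last clause. *)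
Lemma semisimple_idempotents : 1 \in S -> semisimple S ->
  exists (n : nat) (e : 'I_n -> A),
  [/\ \sum_i e i = 1, forall i, e i \in S, forall i, e i * e i = e i,
      forall i, e i != 0
    & forall i x, x \in S -> x * e i != 0 -> exists2 b, b \in S & b * x * e i = e i].
Proof.
move=> S1 [Ls [simL dL sL]].
pose n := size Ls; pose L (i : 'I_n) := tnth (in_tuple Ls) i.
have simLi i : simple_left_ideal S (L i) by apply: simL; exact: mem_tnth.
have sumL : (\sum_i L i)%VS = S by rewrite -sL (big_tnth _ _ Ls).
have dirL : directv (\sum_i L i).
  by move: dL; rewrite !directvE /= !(big_tnth _ _ Ls).
have LS i x : x \in L i -> x \in S by case: (simLi i) => -[LS _] _ _ /(subvP LS).
have mulL i a x : a \in S -> x \in L i -> a * x \in L i.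
  by case: (simLi i) => -[_ SL] _ _ aS xL; apply: (subvP SL); exact: memv_mul.
have : 1 \in (\sum_i L i)%VS by rewrite sumL.
case/memv_sumP => e eL e1.
have eLi i : e i \in L i by exact: eL.
have xe i x : x \in L i -> x * e i = x.
  move=> xL.
  have := elimT directv_sum_unique dirL (fun j => x * e j) (fun j => if j == i then x else 0).
  rewrite -mulr_sumr -e1 mulr1 (bigD1 i) //= eqxx big1 ?addr0; last by move=> j /negbTE ->.
  have h1 j : true -> x * e j \in L j by move=> _; apply: mulL => //; exact: LS xL.
  have h2 j : true -> (if j == i then x else 0) \in L j.
    by move=> _; case: eqP => [->|_]; rewrite ?mem0v.
  by move/(_ h1 h2); rewrite eqxx => /esym/forall_inP /(_ i isT) /eqP; rewrite eqxx.
exists n, e; split=> //.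
- by move=> i; exact: LS (eLi i).
- by move=> i; exact: xe.
- move=> i; case: (simLi i) => _ L0 _; apply/eqP => ei0; apply: L0.
  apply/eqP; rewrite -subv0; apply/subvP => x /xe <-.
  by rewrite ei0 mulr0 mem0v.
move=> i x xS nz; pose K := (amulr (x * e i) @: S)%VS.
have KE y : y \in K -> exists2 b, b \in S & y = b * (x * e i).
  by case/memv_imgP => b bS ->; exists b; rewrite // lfunE.
have KI b : b \in S -> b * (x * e i) \in K.
  by move=> bS; apply/memv_imgP; exists b; rewrite // lfunE.
have KL : (K <= L i)%VS.
  by apply/subvP => _ /KE[b bS ->]; apply: (mulL) => //; exact: mulL.
case: (simLi i) => _ _ /(_ K) [||K0|KeL] //.
- split; first by apply/subvP => y /(subvP KL); exact: LS.
  apply/prodvP => a _ aS /KE[b bS ->]; rewrite mulrA; apply: KI.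
  by apply: (subvP (asubv S)); exact: memv_mul.
- by case/negP: nz; rewrite -memv0 -K0 -[x * e i]mul1r; exact: KI.
have : e i \in K by rewrite KeL.
by case/KE => b bS be; exists b => //; rewrite -mulrA.
Qed.
End SemisimpleIdempotents.

Section SemiInfiniteData.
Variables (k : fieldType) (A : gralg k) (A0 Aneg Apos : grsub A).
Hypothesis hA : semi_infinite_data A0 Aneg Apos.

Lemma A0pos a : a \in A0 -> a \in Apos.
Proof. by rewrite (sid_pos0 hA) memv_cap => /andP[]. Qed.
Lemma A0neg a : a \in A0 -> a \in Aneg.
Proof. by rewrite (sid_neg0 hA) memv_cap => /andP[]. Qed.
Lemma Apos0 a : a \in Apos -> a \in ga_gr A 0 -> a \in A0.
Proof. by rewrite (sid_pos0 hA) memv_cap => -> ->. Qed.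
Lemma Aneg0 a : a \in Aneg -> a \in ga_gr A 0 -> a \in A0.
Proof. by rewrite (sid_neg0 hA) memv_cap => -> ->. Qed.

(** The subalgebra over which injectivity is claimed has to be the right tensor factor: Aneg (x)
    Apos here, Apos (x) Aneg in [coind_neg]. *)
Lemma coind_pos (V : vectType k) wt (hV : is_grading (wt : int -> {vspace V})) :
  injective_over Apos (coind A hV).
Proof.
apply: (coind_injective_over (sid_np hA)) (sid_semisimple hA) _ _ hV.
by apply/subvP => a; exact: A0pos.
Qed.

Lemma coind_neg (V : vectType k) wt (hV : is_grading (wt : int -> {vspace V})) :
  injective_over Aneg (coind A hV).
Proof.
apply: (coind_injective_over (sid_pn hA)) (sid_semisimple hA) _ _ hV.
by apply/subvP => a; exact: A0neg.
Qed.

(** [injective_dual_basis] for B = Apos, whose degree 0 part is A0, with coordinates taken in A so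
    that they act on M itself. *)
Lemma pos_dual_basis (M : grmod A) : injective_over Apos M ->
  exists l : seq (int * 'Hom(M, A) * M),
  [/\ forall t, t \in l -> t.2 \in gm_wt M t.1.1,
      forall t x, t \in l -> t.1.2 x \in Apos,
      forall t a x, t \in l -> a \in Apos -> t.1.2 (gm_act M a x) = a * t.1.2 x,
      forall t p x, t \in l -> x \in gm_wt M p -> t.1.2 x \in ga_gr A (p - t.1.1)
    & forall x, x = \sum_(t <- l) gm_act M (t.1.2 x) t.2].
Proof.
move=> iM; pose P := sub_gralg Apos.
have [n [e [e1 eS eI e0 eK]]] := semisimple_idempotents (gs_one A0) (sid_semisimple hA).
have one : vsproj Apos 1 = 1 :> P.
  by apply: val_inj; rewrite /= vsprojK ?gs_one // (unitr_algid1 (gs_one Apos)) ?unitr1.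
have P0 (x : P) : (x \in ga_gr P 0) = (vsval x \in A0).
  rewrite /= sub_grE; apply/idP/idP => [x0|]; first by apply: Apos0; rewrite ?subvsP.
  by rewrite (sid_pos0 hA) memv_cap => /andP[].
pose eP i : P := vsproj Apos (e i).
have ePE i : vsval (eP i) = e i by rewrite vsprojK //; exact: A0pos (eS i).
have he : simple_idempotents (B := P) eP.
  split=> [|i|i|i|i x].
  - have vs : vsval (\sum_i eP i) = \sum_i vsval (eP i) by exact: (raddf_sum vsval).
    apply: val_inj; change (vsval (\sum_i eP i) = vsval (1 : P)); rewrite vs -one.
    by under eq_bigr => i _ do rewrite ePE; rewrite e1 vsprojK ?gs_one.
  - by rewrite P0 ePE.
  - by apply: val_inj; rewrite /= ePE.
  - by apply: contraNneq (e0 i) => h; rewrite -ePE h.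
  rewrite P0 => x0 nz; have nz' : vsval x * e i != 0.
    by apply: contraNneq nz => h; apply/eqP/val_inj; rewrite /= ePE.
  have [b bS be] := eK _ _ x0 nz'.
  exists (vsproj Apos b); first by rewrite P0 vsprojK // A0pos.
  by apply: val_inj; rewrite /= ePE vsprojK ?A0pos.
have Ppos m : m < 0 -> ga_gr P m = 0%VS.
  move=> m0; apply/eqP; rewrite -subv0; apply/subvP => x; rewrite /= sub_grE => xm.
  have : vsval x \in (Apos :&: ga_gr A m)%VS by rewrite memv_cap subvsP.
  by rewrite (sid_pos hA) // memv0 => /eqP h; rewrite memv0; apply/eqP/val_inj.
have [l [lP lE]] := injective_dual_basis Ppos he (sid_selfinj hA) iM.
pose vv : 'Hom(P, A) := linfun vsval.
have vvE x : vv x = vsval x by rewrite lfunE.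
pose T (t : int * 'Hom(gm_res Apos M, P) * gm_res Apos M) : int * 'Hom(M, A) * M :=
  (t.1.1, (vv \o t.1.2)%VF, t.2).
have TE t x : (T t).1.2 x = vsval (t.1.2 x) by rewrite /T comp_lfunE vvE.
exists [seq T t | t <- l]; split.
- by move=> _ /mapP[t tl ->]; case: (lP t tl).
- by move=> _ x /mapP[t tl ->]; rewrite TE subvsP.
- move=> _ a x /mapP[t tl ->] aP; rewrite !TE.
  case: (lP t tl) => -[h _] _; have := h (vsproj Apos a) x.
  by rewrite gm_resE vsprojK // => ->; rewrite /= vsprojK.
- move=> _ p x /mapP[t tl ->] xp; rewrite TE.
  by case: (lP t tl) => -[_ /(_ _ _ xp)]; rewrite /= sub_grE.
move=> x; rewrite big_map {1}(lE x); apply: eq_bigr => t _.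
by rewrite gm_resE TE.
Qed.

Lemma neg_ind (V : {vspace A}) :
  (forall e a, e <= 0 -> a \in Aneg -> a \in ga_gr A e -> a \in V) ->
  forall a, a \in Aneg -> a \in V.
Proof.
move=> h; apply/subvP; have [s ->] := gs_graded Aneg.
apply: subv_bigsum => e _; apply/subvP => a ae.
have [e0|e0] := ltrP 0 e; first by move: ae; rewrite (sid_neg hA) // memv0 => /eqP ->; rewrite mem0v.
by move: ae; rewrite memv_cap => /andP[]; exact: h.
Qed.

(** * Lifting along maps split over the nonpositive part *)

Section Lifting.
Variables (M C1 C2 : grmod A) (g : 'Hom(C1, C2)) (s : 'Hom(C2, C1)) (u : 'Hom(M, C2)).
Hypotheses (iM : injective_over Apos M) (iC : injective_over Aneg C1).
Hypotheses (hg : is_grhom g) (hs : Uhom Aneg s) (hu : is_grhom u).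
Hypothesis gsg : (g \o s \o g)%VF = g.
Hypothesis gsu : forall x, g (s (u x)) = u x.

(** Elements of A are sums of products a b with a in Apos and b in Aneg, and v(a b x) = a v(b x) = a
    b v(x). *)
Let act_ext (x : M) (v : 'Hom(M, C1)) : Uhom Apos v ->
  (forall a, a \in Aneg -> v (gm_act M a x) = gm_act C1 a (v x)) ->
  forall c, v (gm_act M c x) = gm_act C1 c (v x).
Proof.
move=> [vP _] vN c; have [e1 e1E] := act_lin x; have [e2 e2E] := act_lin (v x).
suff : (v \o e1)%VF = e2 by move/lfunP/(_ c); rewrite comp_lfunE e1E e2E.
apply: (mult_ext (sid_pn hA)) => a b aP bN; rewrite comp_lfunE e1E e2E.
by rewrite !gm_actM !comp_lfunE vP // vN.
Qed.

(* The lift is made Aneg-linear weight by weight: the restriction of v to the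
   weights < j extends to an Aneg-linear w : M -> C1, and the next lift takes the
   value w m on the dual basis elements m of weight j and v m on the others. *)
Let compat (j : int) (v : 'Hom(M, C1)) :=
  [/\ Uhom Apos v, (g \o v)%VF = u
    & forall p y a, y \in gm_wt M p -> p <= j -> a \in Aneg ->
        v (gm_act M a y) = gm_act C1 a (v y)].

Variable l : seq (int * 'Hom(M, A) * M).
Hypotheses (l_wt : forall t, t \in l -> t.2 \in gm_wt M t.1.1)
  (l_pos : forall t x, t \in l -> t.1.2 x \in Apos)
  (l_lin : forall t a x, t \in l -> a \in Apos -> t.1.2 (gm_act M a x) = a * t.1.2 x)
  (l_deg : forall t p x, t \in l -> x \in gm_wt M p -> t.1.2 x \in ga_gr A (p - t.1.1))
  (l_sum : forall x, x = \sum_(t <- l) gm_act M (t.1.2 x) t.2).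

Let free_map (c : int * 'Hom(M, A) * M -> C1) :
  (forall t, t \in l -> c t \in gm_wt C1 t.1.1 /\ g (c t) = u t.2) ->
  exists v : 'Hom(M, C1), [/\ Uhom Apos v, (g \o v)%VF = u &
    forall x, v x = \sum_(t <- l) gm_act C1 (t.1.2 x) (c t)].
Proof.
move=> hc.
have vl : linear (fun x => \sum_(t <- l) gm_act C1 (t.1.2 x) (c t)).
  move=> a x y; rewrite scaler_sumr -big_split; apply: eq_bigr => t _ /=.
  by rewrite !lfun_lin add_lfunE scale_lfunE.
exists (mklin vl); split=> [||x]; last by rewrite mklinE.
  split=> [a x aP|p x xp]; rewrite !mklinE.
    rewrite lfun_sum; apply: eq_big_seq => t tl.
    by rewrite l_lin // gm_actM comp_lfunE.
  rewrite big_seq; apply: memv_suml => t tl.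
  have -> : p = (p - t.1.1) + t.1.1 by rewrite subrK.
  by apply: gm_act_wt; [exact: l_deg | case: (hc t tl)].
apply/lfunP => x; rewrite comp_lfunE mklinE {2}(l_sum x) !lfun_sum.
apply: eq_big_seq => t tl; rewrite hg.1 hu.1.
by case: (hc t tl) => _ ->.
Qed.

(** The coordinate would be an element of Apos of negative degree. *)
Let small t p x : t \in l -> x \in gm_wt M p -> p < t.1.1 -> t.1.2 x = 0.
Proof.
move=> tl xp lt; have : t.1.2 x \in (Apos :&: ga_gr A (p - t.1.1))%VS.
  by rewrite memv_cap l_pos // l_deg.
by rewrite (sid_pos hA) ?subr_lt0 // memv0 => /eqP.
Qed.

Let below (j : int) : {vspace M} :=
  (\sum_(n <- [seq n <- gsupp (gm_grading M) | n < j]) gm_wt M n)%VS.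

Let belowI j p x : x \in gm_wt M p -> p < j -> x \in below j.
Proof.
move=> xp pj; case: (boolP (p \in gsupp (gm_grading M))) => ps.
  by apply: (subvP (_ : gm_wt M p <= below j)%VS) xp; rewrite /below (big_rem p) ?addvSl //= mem_filter pj.
by move: xp; rewrite (wt_gsupp ps) memv0 => /eqP ->; rewrite mem0v.
Qed.

Let belowE j (V : {vspace M}) :
  (forall p x, p < j -> x \in gm_wt M p -> x \in V) -> (below j <= V)%VS.
Proof.
move=> h; apply: subv_bigsum => n; rewrite mem_filter => /andP[nj _].
by apply/subvP => x; exact: h.
Qed.

Let below_stable j : stable (M := gm_res Aneg M) (below j).
Proof.
split=> [m x|a x].
  rewrite !memv_preim; move: x; apply/subvP/belowE => p x pj xp.
  rewrite -memv_preim (gprE _ _ xp); case: eqP => _; last by rewrite mem0v.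
  exact: belowI xp pj.
rewrite gm_resE !memv_preim; move: x; apply/subvP/belowE => p x pj xp.
rewrite -memv_preim; have [e eE] := act_lin x; rewrite -eE memv_preim.
apply: neg_ind (subvsP a) => i b i0 bN bi; rewrite -memv_preim eE.
by apply: belowI (gm_act_wt bi xp) _; rewrite (le_lt_trans _ pj) // gerDr.
Qed.

(** The weights < j form an Aneg-submodule, from which Aneg-injectivity of C1 extends [v]. A vector
    [y] of weight [j] is [top y], an A0-combination of dual basis elements of weight [j], plus
    Apos-multiples of dual basis elements of smaller weight, where [v] is already A-linear. As v' y
    = v (y - top y) + w (top y), Aneg-linearity at [y] follows from that of [w] and [v]. *)
Let compat_step j v : compat (j - 1) v -> exists v', compat j v'.
Proof.
move=> [vP gv vN]; have sW := below_stable j.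
have vN' p y : y \in gm_wt M p -> p < j ->
    forall c, v (gm_act M c y) = gm_act C1 c (v y).
  by move=> yp pj; apply: act_ext => // a aN; apply: vN yp _ aN; lia.
pose inc := sub_inc sW.
pose v0 : 'Hom(gm_sub sW, gm_res Aneg C1) := (v \o inc)%VF.
have v0E z : v0 z = v (inc z) by rewrite /v0 comp_lfunE.
have hv0 : is_grhom v0.
  split=> [a y|n y yn]; last first.
    by rewrite v0E; apply: vP.2; exact: (sub_inc_hom sW).2.
  rewrite !v0E /inc (sub_inc_hom sW).1 !gm_resE.
  have := sub_inc_mem y; rewrite -/inc; move: (inc y) => x xW.
  pose f1 := (v \o gm_act M (vsval a))%VF; pose f2 := (gm_act C1 (vsval a) \o v)%VF.
  suff : x \in lker (f1 - f2) by move/eqlfunP; rewrite /f1 /f2 !comp_lfunE.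
  move: x xW; apply/subvP/belowE => p x pj xp; apply/eqlfunP.
  by rewrite /f1 /f2 !comp_lfunE (vN' _ _ xp pj).
have [w0 [hw0 w0E]] := iC (sub_inc_hom sW) (sub_inc_inj sW) hv0.
move/resP: hw0 => hw0; pose w0' : 'Hom(M, C1) := w0.
have w0v p y : y \in gm_wt M p -> p < j -> w0' y = v y.
  move=> yp pj; have yW := belowI yp pj; move/lfunP: w0E => /(_ (vsproj _ y)).
  by rewrite /v0 !comp_lfunE !sub_incE !vsprojK.
(* [w0'] need not lift [u]. Adding s (u - g w0') corrects this, because g s g = g and g s u = u, and
   changes nothing in weights < j, where g v = u. *)
pose w : 'Hom(M, C1) := (w0' - (s \o g \o w0') + (s \o u))%VF.
have wE y : w y = w0' y - s (g (w0' y)) + s (u y).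
  by rewrite /w !add_lfunE opp_lfunE !comp_lfunE.
have gvE y : g (v y) = u y by rewrite -comp_lfunE gv.
have gsgE y : g (s (g y)) = g y by move/lfunP: gsg => /(_ y); rewrite !comp_lfunE.
have wv p y : y \in gm_wt M p -> p < j -> w y = v y.
  by move=> yp pj; rewrite wE (w0v _ _ yp pj) gvE subrK.
have gw y : g (w y) = u y by rewrite wE lfunD lfunB gsgE subrr add0r gsu.
have wN a y : a \in Aneg -> w (gm_act M a y) = gm_act C1 a (w y).
  by move=> aN; rewrite !wE hw0.1 // hg.1 hu.1 !hs.1 // lfunD lfunB.
have ww n y : y \in gm_wt M n -> w y \in gm_wt C1 n.
  move=> yn; rewrite wE memvD ?memvB //; first exact: hw0.2.
    by apply: hs.2; apply: hg.2; exact: hw0.2.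
  by apply: hs.2; exact: hu.2.
have [|v' [v'P gv' v'E]] := @free_map (fun t => if t.1.1 == j then w t.2 else v t.2).
  move=> t tl; case: eqP => _; split=> //; first by apply: ww; exact: l_wt.
  by apply: vP.2; exact: l_wt.
pose top y := \sum_(t <- l | t.1.1 == j) gm_act M (t.1.2 y) t.2.
have v'E2 y : v' y = v y + \sum_(t <- l | t.1.1 == j) gm_act C1 (t.1.2 y) (w t.2 - v t.2).
  rewrite v'E {2}(l_sum y) lfun_sum [X in _ = _ + X]big_mkcond -big_split /=.
  apply: eq_big_seq => t tl; rewrite vP.1 ?l_pos //.
  by case: eqP => _; rewrite ?addr0 // lfunB addrC subrK.
have v'v p y : y \in gm_wt M p -> p < j -> v' y = v y.
  move=> yp pj; rewrite v'E2 big_seq_cond big1 ?addr0 // => t /andP[tl /eqP tj].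
  by rewrite (small tl yp) ?tj // lfun0 zero_lfunE.
have v'A0 a y : a \in A0 -> v' (gm_act M a y) = gm_act C1 a (v' y).
  by move=> a0; rewrite v'P.1 // A0pos.
exists v'; split=> // p y a yp pj aN.
have [e1 e1E] := act_lin y; have [e2 e2E] := act_lin (v' y).
apply/eqP; rewrite -subr_eq0 -e1E -e2E -comp_lfunE.
have -> : (v' \o e1)%VF a - e2 a = ((v' \o e1)%VF - e2) a by rewrite add_lfunE opp_lfunE.
rewrite -memv_ker; move: a aN; apply: neg_ind => e a e0 aN ae.
apply/eqlfunP; rewrite comp_lfunE e1E e2E.
have [p_lt|j_lt|pj'] := ltrgtP p j; last 2 first.
- by move: pj; rewrite leNgt j_lt.
- move: yp; rewrite pj' => yj.
  have [en|ep|ez] := ltrgtP e 0; last 2 first.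
  + by move: e0; rewrite leNgt ep.
  + by apply: v'A0; apply: Aneg0 => //; rewrite -ez.
  have topA0 t : t \in l -> t.1.1 = j -> t.1.2 y \in A0.
    move=> tl tj; apply: Apos0; first exact: l_pos.
    by have := l_deg tl yj; rewrite tj subrr.
  have topj : top y \in gm_wt M j.
    rewrite /top big_seq_cond; apply: memv_suml => t /andP[tl /eqP tj].
    have := l_deg tl yj; rewrite tj subrr => h.
    by rewrite -(add0r j); apply: gm_act_wt h _; rewrite -tj; exact: l_wt.
  have v'y : v' y = v (y - top y) + w (top y).
    rewrite v'E2 lfunB -addrA; congr (_ + _); rewrite addrC /top !lfun_sum -sumrB.
    rewrite big_seq_cond [RHS]big_seq_cond; apply: eq_bigr => t /andP[tl /eqP tj].
    rewrite lfunB wN; last exact: A0neg (topA0 _ tl tj).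
    by rewrite vP.1 // l_pos.
  have aj x i : x \in gm_wt M j -> gm_act M a x \in gm_wt M (e + j) by exact: gm_act_wt.
  have ej : e + j < j by rewrite gtrDr.
  rewrite (v'v (e + j)) //; last exact: gm_act_wt.
  rewrite v'y lfunD -wN // (wv (e + j)) //; last exact: gm_act_wt.
  suff -> : gm_act C1 a (v (y - top y)) = v (gm_act M a (y - top y)).
    by rewrite -lfunD -lfunD subrK.
  have -> : y - top y = \sum_(t <- l | t.1.1 < j) gm_act M (t.1.2 y) t.2.
    rewrite {1}(l_sum y) (bigID (fun t => t.1.1 == j)) /= addrC addrK.
    rewrite [LHS]big_mkcond [RHS]big_mkcond; apply: eq_big_seq => t tl /=.
    by case: ltrgtP => // lt; rewrite (small tl yj lt) lfun0 zero_lfunE.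
  rewrite !lfun_sum big_seq_cond [RHS]big_seq_cond; apply: eq_bigr => t /andP[tl tj].
  have mt := l_wt tl.
  rewrite (vN' _ _ mt tj) -[gm_act M a _]comp_lfunE -gm_actM (vN' _ _ mt tj).
  by rewrite gm_actM comp_lfunE.
rewrite (v'v _ _ yp p_lt) (v'v (e + p)).
- exact: vN' yp p_lt _.
- exact: gm_act_wt.
- by rewrite (le_lt_trans _ p_lt) // gerDr.
Qed.

Lemma lifting_aux : exists v : 'Hom(M, C1), is_grhom v /\ (g \o v)%VF = u.
Proof.
have [a [b ab]] := wt_bounds (gm_grading M).
have zero p y : (p < a) || (b < p) -> y \in gm_wt M p -> y = 0.
  by move=> /ab -> ; rewrite memv0 => /eqP.
(* The weights of M lie between [a] and [b]: compatibility up to a - 1 is vacuous, and b - a + 1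
   steps reach [b]. *)
have H (N : nat) : exists v, compat (a - 1 + N%:Z) v.
  elim: N => [|N [v hv]].
    have [|v [h1 h2 _]] := @free_map (fun t => s (u t.2)).
      by move=> t tl; split; [apply: hs.2; apply: hu.2; exact: l_wt | exact: gsu].
    exists v; split=> // p y c yp pj cN.
    have -> : y = 0 by apply: zero yp; apply/orP; left; lia.
    by rewrite !lfun0.
  apply: (compat_step (j := a - 1 + N.+1%:Z)).
  suff -> : a - 1 + N.+1%:Z - 1 = a - 1 + N%:Z by exact: hv.
  by lia.
have [v [vP gv vN]] := H (absz (b - a + 1)).
exists v; split=> //; split=> [c y|n y]; last exact: vP.2.
rewrite -!comp_lfunE; move: y; apply/lfunP; apply: (homog_ext (gm_grading M)) => p y yp.
rewrite !comp_lfunE; have [bp|pb] := ltrP b p.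
  have -> : y = 0 by apply: zero yp; rewrite bp orbT.
  by rewrite !lfun0.
by apply: act_ext => // d dN; apply: (vN p) => //; lia.
Qed.

End Lifting.

Lemma lifting (M C1 C2 : grmod A) (g : 'Hom(C1, C2)) (s : 'Hom(C2, C1)) (u : 'Hom(M, C2)) :
  injective_over Apos M -> injective_over Aneg C1 ->
  is_grhom g -> Uhom Aneg s -> is_grhom u -> (g \o s \o g)%VF = g ->
  (forall x, g (s (u x)) = u x) ->
  exists v : 'Hom(M, C1), is_grhom v /\ (g \o v)%VF = u.
Proof.
move=> iM iC hg hs hu gsg gsu; have [l [h1 h2 h3 h4 h5]] := pos_dual_basis iM.
exact: (lifting_aux iC hg hs hu gsg gsu h1 h2 h3 h4 h5).
Qed.

End SemiInfiniteData.

(** * Homotopies *)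

Section Homotopy.
Variables (k : fieldType) (A : gralg k).
Implicit Types (X Y Z S I Q C : cpx A).

Lemma gm_zero_eq (M : grmod A) : gm_zero M -> forall x y : M, x = y.
Proof. by move=> M0 x y; rewrite (gm_zeroE M0 x) (gm_zeroE M0 y). Qed.

Lemma cmE X Y (f : cmap X Y) p q x : cx_d Y p q (f p x) = f q (cx_d X p q x).
Proof. by rewrite -!comp_lfunE cm_comm. Qed.

Lemma ddE X p q r x : cx_d X q r (cx_d X p q x) = 0.
Proof. by rewrite -comp_lfunE cx_dd zero_lfunE. Qed.

Lemma cmap_of X Y (F : forall p, 'Hom(X p, Y p)) :
  (forall p, is_grhom (F p)) ->
  (forall p q, q = p + 1 -> forall x, cx_d Y p q (F p x) = F q (cx_d X p q x)) ->
  exists f : cmap X Y, forall p, f p = F p.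
Proof.
move=> hF dF; have c p q : (cx_d Y p q \o F p)%VF = (F q \o cx_d X p q)%VF.
  have [e|ne] := eqVneq q (p + 1); first by apply/lfunP => x; rewrite !comp_lfunE dF.
  by rewrite !cx_d_deg // comp_lfun0l comp_lfun0r.
by exists (CMap hF c).
Qed.

(** Degrees are variables tied by equations, in line with [cx_d], so that no casts enter. Components
    [h p q] off the line p = q + 1 are unconstrained graded maps. *)
Definition htp X Y (f g : cmap X Y) : Prop :=
  exists h : forall p q, 'Hom(X p, Y q), (forall p q, is_grhom (h p q)) /\
  forall p q r, p = q + 1 -> r = p + 1 -> forall x,
    f p x - g p x = cx_d Y q p (h p q x) + h r p (cx_d X p r x).

Lemma htp_ext X Y (f g : cmap X Y) : (forall p x, f p x = g p x) -> htp f g.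
Proof.
move=> e; exists (fun _ _ => 0); split=> [p q|p q r _ _ x]; first exact: grhom0.
by rewrite e subrr !zero_lfunE lfun0 addr0.
Qed.

Lemma htp_sym X Y (f g : cmap X Y) : htp f g -> htp g f.
Proof.
move=> [h [hh e]]; exists (fun p q => - h p q); split=> [p q|p q r pq rp x].
  exact: grhomN.
by rewrite -opprB (e _ _ _ pq rp) !opp_lfunE lfunN opprD.
Qed.

Lemma htp_trans X Y (f g l : cmap X Y) : htp f g -> htp g l -> htp f l.
Proof.
move=> [h [hh e]] [h' [hh' e']]; exists (fun p q => h p q + h' p q).
split=> [p q|p q r pq rp x]; first exact: grhomD.
rewrite -(subrK (g p x) (f p x)) -addrA (e _ _ _ pq rp) (e' _ _ _ pq rp).
by rewrite !add_lfunE lfunD addrACA.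
Qed.

Lemma htp_comp X Y Z (u v : cmap Y Z) (f g : cmap X Y) :
  htp u v -> htp f g -> htp (cm_comp u f) (cm_comp v g).
Proof.
move=> [h [hh e]] [h' [hh' e']].
apply: (@htp_trans _ _ _ (cm_comp v f)).
  exists (fun p q => (h p q \o f p)%VF); split=> [p q|p q r pq rp x].
    by apply: grhom_comp => //; exact: cm_hom.
  by rewrite !comp_lfunE (e _ _ _ pq rp) cmE.
exists (fun p q => (v q \o h' p q)%VF); split=> [p q|p q r pq rp x].
  by apply: grhom_comp => //; exact: cm_hom.
by rewrite !comp_lfunE -lfunB (e' _ _ _ pq rp) lfunD cmE.
Qed.

Lemma cm_add_ex X Y (f g : cmap X Y) : {s : cmap X Y | forall p x, s p x = f p x + g p x}.
Proof.
unshelve eexists (@CMap _ _ X Y (fun p => f p + g p) _ _).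
- by move=> p; apply: grhomD; exact: cm_hom.
- by move=> p q; rewrite comp_lfunDl comp_lfunDr !cm_comm.
- by move=> p x /=; rewrite add_lfunE.
Qed.
Definition cm_add X Y (f g : cmap X Y) : cmap X Y := sval (cm_add_ex f g).
Lemma cm_addE X Y (f g : cmap X Y) p x : cm_add f g p x = f p x + g p x.
Proof. exact: (svalP (cm_add_ex f g)). Qed.

Lemma htp_add X Y (f f' g g' : cmap X Y) : htp f f' -> htp g g' ->
  htp (cm_add f g) (cm_add f' g').
Proof.
move=> [h [hh e]] [h' [hh' e']]; exists (fun p q => h p q + h' p q).
split=> [p q|p q r pq rp x]; first exact: grhomD.
rewrite !cm_addE opprD addrACA (e _ _ _ pq rp) (e' _ _ _ pq rp).
by rewrite !add_lfunE lfunD addrACA.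
Qed.

Section Reindex.
Variables X Y : int -> grmod A.

(** Transport along an equality of degrees, extended by 0 so that the equality itself is not an
    argument. *)
Definition recast p q : 'Hom(X p, X q) :=
  match p =P q with
  | ReflectT e => ecast r 'Hom(X p, X r) e \1%VF
  | ReflectF _ => 0
  end.

Lemma recastE p x : recast p p x = x.
Proof.
by rewrite /recast; case: (p =P p) => // e; rewrite (eq_irrelevance e erefl) id_lfunE.
Qed.

Lemma recast_hom p q : is_grhom (recast p q).
Proof.
rewrite /recast; case: (p =P q) => [e|_]; last exact: grhom0.
by case: q / e; exact: grhom1.
Qed.

End Reindex.

Lemma reidx_src (X Y : int -> grmod A) (f : forall p q, 'Hom(X (p + 1), Y q)) :
  (forall p q, is_grhom (f p q)) -> exists g : forall p q, 'Hom(X p, Y q),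
  (forall p q, is_grhom (g p q)) /\ forall p q x, g (p + 1) q x = f p q x.
Proof.
move=> hf; exists (fun p q => (f (p - 1)%R q \o recast X p (p - 1 + 1))%VF).
split=> [p q|p q x]; first by apply: grhom_comp => //; exact: recast_hom.
rewrite comp_lfunE; move: (p + 1 - 1) (addrK 1 p) => t et; subst t.
by rewrite recastE.
Qed.

Lemma reidx_tgt (X Y : int -> grmod A) (f : forall p q, 'Hom(X p, Y (q + 1))) :
  (forall p q, is_grhom (f p q)) -> exists g : forall p q, 'Hom(X p, Y q),
  (forall p q, is_grhom (g p q)) /\ forall p q x, g p (q + 1) x = f p q x.
Proof.
move=> hf; exists (fun p q => (recast Y (q - 1 + 1) q \o f p (q - 1)%R)%VF).
split=> [p q|p q x]; first by apply: grhom_comp => //; exact: recast_hom.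
rewrite comp_lfunE; move: (q + 1 - 1) (addrK 1 q) => t et; subst t.
by rewrite recastE.
Qed.

Definition acyclic S := forall p q r, q = p + 1 -> r = q + 1 ->
  forall x : S q, cx_d S q r x = 0 -> exists y, x = cx_d S p q y.

Lemma qisoP X Y (s : cmap X Y) : quasi_iso s <->
  forall p q r, q = p + 1 -> r = q + 1 ->
    (forall x : X q, cx_d X q r x = 0 -> (exists y, s q x = cx_d Y p q y) ->
      exists x', x = cx_d X p q x') /\
    (forall y : Y q, cx_d Y q r y = 0 ->
      exists x y', cx_d X q r x = 0 /\ y = s q x + cx_d Y p q y').
Proof.
split=> [h p q r e -> | h p].
  by have -> : p = q - 1 by [rewrite e addrK]; exact: h.
by apply: h; rewrite ?subrK.
Qed.

Lemma coneE X Y (s : cmap X Y) p z :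
  cx_d (cx_cone s) p (p + 1) z = (- cx_d X (p + 1) (p + 1 + 1) z.1, s (p + 1) z.1 + cx_d Y p (p + 1) z.2).
Proof. by rewrite -cm_off_diag; exact: cone_dE. Qed.

Lemma cone_acyclic X Y (s : cmap X Y) : quasi_iso s -> acyclic (cx_cone s).
Proof.
move=> /qisoP qs p q r -> -> [x y]; rewrite coneE => -[dx sy].
have dx0 : cx_d X (p + 1 + 1) (p + 1 + 1 + 1) x = 0 by apply/eqP; rewrite -oppr_eq0; apply/eqP.
have sx : s (p + 1 + 1) x = cx_d Y (p + 1) (p + 1 + 1) (- y).
  by apply/eqP; rewrite lfunN -addr_eq0; apply/eqP.
have [|x' xx'] := (qs _ _ _ erefl erefl).1 _ dx0; first by exists (- y).
have dy : cx_d Y (p + 1) (p + 1 + 1) (y + s (p + 1) x') = 0.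
  by rewrite lfunD cmE -xx' sx lfunN subrr.
have [x'' [y' [dx'' e]]] := (qs _ _ _ erefl erefl).2 _ dy.
exists (x'' - x', y'); rewrite coneE /= !lfunB dx'' sub0r opprK -xx'; congr pair.
by rewrite addrAC -e addrK.
Qed.

Section Null.
Variables (S I : cpx A) (n : int) (eps : k) (f : forall p q, 'Hom(S p, I q)).
Hypotheses (eps0 : eps != 0) (hf : forall p q, is_grhom (f p q)).
Hypothesis df : forall p q r s x, q = p + n -> r = p + 1 -> s = q + 1 ->
  cx_d I q s (f p q x) = eps *: f r s (cx_d S p r x).

(** [f] is a cochain of degree [n], closed up to the sign [eps], and a primitive is sought. Degree
    and sign are parameters so that the same inductions serve extension (n = 1), lifting (n = 0) and
    the two uniqueness statements (n = 0 and n = -1). *)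
Definition null := exists h : forall p q, 'Hom(S p, I q),
  (forall p q, is_grhom (h p q)) /\
  forall p q q' r x, q = p + n -> q = q' + 1 -> r = p + 1 ->
    f p q x = cx_d I q' q (h p q' x) + eps *: h r q (cx_d S p r x).

(** Choice with default 0: the components of a homotopy are first defined by recursion, and their
    equations are proved afterwards by induction. *)
Definition chosen (M N : grmod A) (P : 'Hom(M, N) -> Prop) : 'Hom(M, N) :=
  if excluded_middle_informative (exists s, is_grhom s /\ P s) is left e
  then proj1_sig (constructive_indefinite_description _ e) else 0.

Lemma chosen_hom (M N : grmod A) P : is_grhom (@chosen M N P).
Proof.
rewrite /chosen; case: excluded_middle_informative => [e|_]; last exact: grhom0.
by case: constructive_indefinite_description => s [].
Qed.
Lemma chosenP (M N : grmod A) P : (exists s, is_grhom s /\ P s) -> P (@chosen M N P).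
Proof.
rewrite /chosen; case: excluded_middle_informative => // e _.
by case: constructive_indefinite_description => s [].
Qed.

(** Induction on the target degree, starting at [a], below which [I] vanishes. The equation
    prescribes the next component on boundaries of [S]. The prescription is consistent because
    cocycles are boundaries and the induction hypothesis applies to them; [Hext] extends it. *)
Lemma null_ext (a : int) :
  (forall p, p < a -> gm_zero (I p)) -> acyclic S ->
  (forall p r q, r = p + 1 -> forall t : 'Hom(S p, I q), is_grhom t ->
     (forall x, cx_d S p r x = 0 -> t x = 0) ->
     exists s : 'Hom(S r, I q), is_grhom s /\ (s \o cx_d S p r)%VF = t) -> null.
Proof.
move=> Ia aS Hext.
pose H := fix H (N : nat) : forall p q, 'Hom(S p, I q) := if N is N'.+1 then
  fun p q => @chosen (S p) (I q) (fun s => (s \o cx_d S (p - 1)%R p)%VF =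
    eps^-1 *: (f (p - 1)%R q - (cx_d I (q - 1)%R q \o H N' (p - 1)%R (q - 1)%R))%VF)
  else fun _ _ => 0.
have HH N p q : is_grhom (H N p q).
  by case: N => [|N] /=; [exact: grhom0 | exact: chosen_hom].
(* The recursion depth needed in target degree [q]: 0 below [a], where 0 is the only map, then one
   more per degree. *)
pose Nf (q : int) : nat := if q < a then 0%N else absz (q - a + 1).
pose h p q := H (Nf q) p q.
suff hE (N : nat) : forall p r q q' x, q < a + N%:Z -> q = p + n -> r = p + 1 -> q = q' + 1 ->
    h r q (cx_d S p r x) = eps^-1 *: (f p q x - cx_d I q' q (h p q' x)).
  exists h; split=> [p q|p q q' r x e1 e2 e3]; first exact: HH.
  rewrite (hE (absz (q - a + 1)) _ _ _ q') //; last by lia.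
  by rewrite scalerA mulfV // scale1r addrC subrK.
elim: N => [|N IH] p r q q' x qa e1 e2 e3.
  have Iq : gm_zero (I q) by apply: Ia; lia.
  exact: gm_zero_eq Iq _ _.
have [qa'|aq] := ltrP q a.
  exact: gm_zero_eq (Ia _ qa') _ _.
have NfE : Nf q = (Nf q').+1.
  by rewrite /Nf; case: ltP => h1; [lia|case: ltP => h2; lia].
have er : r - 1 = p by lia.
have eq' : q - 1 = q' by lia.
have := @chosenP (S r) (I q) (fun s => (s \o cx_d S p r)%VF =
    eps^-1 *: (f p q - (cx_d I q' q \o h p q'))%VF).
rewrite /h NfE /= er eq' => P.
have : exists s : 'Hom(S r, I q), is_grhom s /\ (s \o cx_d S p r)%VF =
    eps^-1 *: (f p q - (cx_d I q' q \o h p q'))%VF.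
  apply: Hext => // [|y dy].
    by apply: grhomZ; apply: grhomB => //; apply: grhom_comp; [exact: cx_d_hom|exact: HH].
  have [z ->] : exists z, y = cx_d S (p - 1) p z by apply: (aS _ _ r) => //; lia.
  rewrite scale_lfunE add_lfunE opp_lfunE comp_lfunE.
  have -> : h p q' (cx_d S (p - 1) p z) =
      eps^-1 *: (f (p - 1) q' z - cx_d I (q' - 1) q' (h (p - 1) (q' - 1) z)).
    by apply: IH; lia.
  rewrite lfunZ lfunB ddE subr0 (df (r := p) (s := q)); try lia.
  by rewrite scalerA mulVf // scale1r subrr scaler0.
move/P => /lfunP/(_ x); rewrite comp_lfunE => ->.
by rewrite scale_lfunE add_lfunE opp_lfunE comp_lfunE.
Qed.

(** Dual to [null_ext]: descending induction on the source degree from [b], above which [S]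
    vanishes. The equation prescribes the differential of the next component, and [Hlift] supplies a
    lift. *)
Lemma null_lift (b : int) :
  (forall p, b < p -> gm_zero (S p)) ->
  (forall p q' q r, q = q' + 1 -> r = q + 1 -> forall u : 'Hom(S p, I q), is_grhom u ->
     (forall x, cx_d I q r (u x) = 0) ->
     exists v : 'Hom(S p, I q'), is_grhom v /\ (cx_d I q' q \o v)%VF = u) -> null.
Proof.
move=> Sb Hlift.
pose H := fix H (N : nat) : forall p q, 'Hom(S p, I q) := if N is N'.+1 then
  fun p q => @chosen (S p) (I q) (fun s => (cx_d I q (q + 1)%R \o s)%VF =
    (f p (q + 1)%R - eps *: (H N' (p + 1)%R (q + 1)%R \o cx_d S p (p + 1)))%VF)
  else fun _ _ => 0.
have HH N p q : is_grhom (H N p q).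
  by case: N => [|N] /=; [exact: grhom0 | exact: chosen_hom].
pose Nf (p : int) : nat := if b < p then 0%N else absz (b - p + 1).
pose h p q := H (Nf p) p q.
suff hE (N : nat) : forall p r q q' x, b < p + N%:Z -> q = p + n -> r = p + 1 -> q = q' + 1 ->
    cx_d I q' q (h p q' x) = f p q x - eps *: h r q (cx_d S p r x).
  exists h; split=> [p q|p q q' r x e1 e2 e3]; first exact: HH.
  by rewrite (hE (absz (b - p + 1)) _ r) ?subrK //; lia.
elim: N => [|N IH] p r q q' x pb e1 e2 e3.
  have Sp : gm_zero (S p) by apply: Sb; lia.
  by rewrite (gm_zeroE Sp x) !lfun0 scaler0 subrr.
have [pb'|bp] := ltrP b p.
  by rewrite (gm_zeroE (Sb _ pb') x) !lfun0 scaler0 subrr.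
have NfE : Nf p = (Nf r).+1.
  by rewrite /Nf; case: ltP => h1; [lia|case: ltP => h2; lia].
have := @chosenP (S p) (I q') (fun s => (cx_d I q' q \o s)%VF =
    (f p q - eps *: (h r q \o cx_d S p r))%VF).
rewrite /h NfE /= -e3 -e2 => P.
have : exists s : 'Hom(S p, I q'), is_grhom s /\ (cx_d I q' q \o s)%VF =
    (f p q - eps *: (h r q \o cx_d S p r))%VF.
  apply: (Hlift _ _ _ (q + 1)) => // [|y].
    apply: grhomB => //; apply: grhomZ; apply: grhom_comp; [exact: HH|exact: cx_d_hom].
  rewrite add_lfunE opp_lfunE scale_lfunE comp_lfunE lfunB lfunZ.
  have -> : cx_d I q (q + 1) (h r q (cx_d S p r y)) =
     f r (q + 1) (cx_d S p r y) - eps *: h (r + 1) (q + 1) (cx_d S r (r + 1) (cx_d S p r y)).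
    by apply: IH; lia.
  by rewrite ddE lfun0 scaler0 subr0 (df (r := r) (s := q + 1)) ?subrr //; lia.
move/P => /lfunP/(_ x); rewrite comp_lfunE => ->.
by rewrite add_lfunE opp_lfunE scale_lfunE comp_lfunE.
Qed.

End Null.

Section QisoExt.
Variables (W W' I : cpx A) (s : cmap W W') (a : int).
Hypotheses (qs : quasi_iso s) (Ia : forall p, p < a -> gm_zero (I p)).
Hypothesis Iinj : forall p, gm_injective (I p).

Let Hext (p r q : int) (S : cpx A) : forall t : 'Hom(S p, I q), is_grhom t ->
  (forall x, cx_d S p r x = 0 -> t x = 0) ->
  exists s : 'Hom(S r, I q), is_grhom s /\ (s \o cx_d S p r)%VF = t.
Proof. by move=> t ht h; apply: inj_ext => //; exact: cx_d_hom. Qed.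

(** [u] on the first summand of the cone of [s] is a closed cochain of degree 1. A primitive of it
    is minus the extension on the summand W' and minus the homotopy on the summand W. *)
Lemma qiso_extend (u : cmap W I) : exists v : cmap W' I, htp (cm_comp v s) u.
Proof.
pose S := cx_cone s.
pose f p q : 'Hom(S p, I q) := (cm_off u (p + 1)%R q \o pr1 _ _)%VF.
have fE p z : f p (p + 1) z = u (p + 1) z.1 by rewrite comp_lfunE pr1E cm_off_diag.
have hf p q : is_grhom (f p q).
  exact: grhom_comp (cm_off_hom _ _ _) (pr1_grhom _ _).
have [h [hh hE]] : null 1 (-1) f.
  apply: (null_ext _ hf _ Ia (cone_acyclic qs)).
- by rewrite oppr_eq0 oner_eq0.
- move=> p q r t x -> -> ->; rewrite !fE coneE /= lfunN scaleN1r opprK.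
  by rewrite cmE.
- by move=> p r q _; exact: Hext.
have key p (z : S p) : u (p + 1) z.1 = cx_d I p (p + 1) (h p p z) -
    h (p + 1) (p + 1) (cx_d S p (p + 1) z).
  by rewrite -fE (hE p (p + 1) p (p + 1)) // scaleN1r.
have [||v vE] := @cmap_of W' I (fun p => (- (h p p \o in2 _ _))%VF).
- by move=> p; apply: grhomN; exact: grhom_comp (hh p p) (in2_grhom _ _).
- move=> p q -> y; rewrite !opp_lfunE !comp_lfunE !in2E lfunN; congr (- _).
  have := key p (0, y); rewrite coneE /= !lfun0 oppr0 add0r => /eqP.
  by rewrite eq_sym subr_eq0 => /eqP.
exists v; have [g [hg gE]] := @reidx_src W I (fun p q => (- (h p q \o in1 _ _))%VF)
  (fun p q => grhomN (grhom_comp (hh p q) (in1_grhom _ _))).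
exists g; split=> // p q r -> -> x; rewrite !gE /= comp_lfunE vE.
rewrite !opp_lfunE !comp_lfunE !in1E in2E.
have := key q (x, 0); rewrite coneE /= lfun0 addr0 => ->.
have -> : (- cx_d W (q + 1) (q + 1 + 1) x, s (q + 1) x) =
  (0, s (q + 1) x) - (cx_d W (q + 1) (q + 1 + 1) x, 0) :> S (q + 1).
  by congr pair; rewrite /= ?sub0r ?subr0.
have zid (V : zmodType) (a' b' c' : V) : - a' - (c' - (a' - b')) = - c' - b'.
  by rewrite opprB -!addrA addKr addrC.
by rewrite lfunB lfunN; exact: zid.
Qed.

(** u - v on W' and the given homotopy [g] on W make up a closed map on the cone of [s]; its
    primitive, restricted to W', is the homotopy from [u] to [v]. *)
Lemma qiso_unique (u v : cmap W' I) :
  htp (cm_comp u s) (cm_comp v s) -> htp u v.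
Proof.
case=> g [hg gE]; pose S := cx_cone s.
pose f p q : 'Hom(S p, I q) :=
  ((cm_off u p q \o pr2 _ _) - (cm_off v p q \o pr2 _ _) + (g (p + 1)%R q \o pr1 _ _))%VF.
have fE p z : f p p z = u p z.2 - v p z.2 + g (p + 1) p z.1.
  by rewrite !add_lfunE opp_lfunE !comp_lfunE !pr2E pr1E !cm_off_diag.
have hf p q : is_grhom (f p q).
  apply: grhomD; first apply: grhomB.
  - exact: grhom_comp (cm_off_hom _ _ _) (pr2_grhom _ _).
  - exact: grhom_comp (cm_off_hom _ _ _) (pr2_grhom _ _).
  - exact: grhom_comp (hg _ _) (pr1_grhom _ _).
have [h [hh hE]] : null 0 1 f.
  apply: (null_ext _ hf _ Ia (cone_acyclic qs)).
- by rewrite oner_eq0.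
- move=> p q r t x -> -> ->; rewrite addr0 !fE coneE /= scale1r.
  rewrite !lfunD !lfunN !cmE.
  have zid (V : zmodType) (ud vd dg us vs gd : V) : us - vs = dg + gd ->
      ud - vd + dg = us + ud - (vs + vd) - gd.
    by move=> e; rewrite opprD addrACA e [RHS]addrAC addrK addrC.
  have := gE _ _ _ erefl erefl x.1; rewrite /= !comp_lfunE; exact: zid.
- by move=> p r q _; exact: Hext.
exists (fun p q => (h p q \o in2 _ _)%VF); split=> [p q|p q r e1 e2 x].
  exact: grhom_comp (hh _ _) (in2_grhom _ _).
have := hE p p q r (0, x) (esym (addr0 p)) e1 e2.
rewrite fE /= lfun0 addr0 scale1r => ->; rewrite !comp_lfunE !in2E.
by rewrite e2 coneE /= !lfun0 oppr0 add0r.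
Qed.

End QisoExt.

Section QisoLift.
Variables (K I Q : cpx A) (i : cmap K I) (b : int).
Hypothesis Qb : forall p, b < p -> gm_zero (Q p).
Hypothesis Hlift : forall p q' q r, q = q' + 1 -> r = q + 1 ->
  forall u : 'Hom(Q p, cx_cone i q), is_grhom u ->
     (forall x, cx_d (cx_cone i) q r (u x) = 0) ->
     exists v : 'Hom(Q p, cx_cone i q'), is_grhom v /\ (cx_d (cx_cone i) q' q \o v)%VF = u.

(** Followed by I -> cone i, the map [u] becomes null-homotopic. The two components of the
    null-homotopy in the cone are the lift to K and the homotopy between its image in I and [u]. *)
Lemma qiso_lift (u : cmap Q I) : exists v : cmap Q K, htp (cm_comp i v) u.
Proof.
pose C := cx_cone i.
pose f p q : 'Hom(Q p, C q) := (in2 _ _ \o cm_off u p q)%VF.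
have fE p x : f p p x = (0, u p x) by rewrite comp_lfunE in2E cm_off_diag.
have hf p q : is_grhom (f p q).
  exact: grhom_comp (in2_grhom _ _) (cm_off_hom _ _ _).
have [h [hh hE]] : null 0 1 f.
  apply: (null_lift _ hf _ Qb Hlift); first by rewrite oner_eq0.
  move=> p q r t x -> -> ->; rewrite addr0 !fE coneE /= scale1r.
  by rewrite !lfun0 oppr0 add0r cmE.
have [a [ha aE]] := @reidx_tgt Q K (fun p q => (pr1 _ _ \o h p q)%VF)
  (fun p q => grhom_comp (pr1_grhom _ _) (hh p q)).
have key q (x : Q (q + 1)) : (0, u (q + 1) x) =
    cx_d C q (q + 1) (h (q + 1) q x) + h (q + 1 + 1) (q + 1) (cx_d Q (q + 1) (q + 1 + 1) x) :> C (q + 1).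
  by rewrite -fE (hE (q + 1) (q + 1) q (q + 1 + 1)) ?addr0 // scale1r.
have ind (P : int -> Prop) : (forall q, P (q + 1)) -> forall p, P p.
  by move=> h' p; rewrite -(subrK 1 p); exact: h'.
have [||v vE] := @cmap_of Q K (fun p => a p p).
- by move=> p; exact: ha.
- apply: ind => p q -> x; rewrite !aE !comp_lfunE !pr1E.
  have zeq (V : zmodType) (a' b' : V) : 0 = - a' + b' -> a' = b'.
    by move/esym/eqP; rewrite addrC subr_eq0 => /eqP.
  by have := congr1 fst (key p x); rewrite coneE /=; exact: zeq.
exists v; apply: htp_sym; exists (fun p q => (pr2 _ _ \o h p q)%VF); split=> [p q|p q r -> -> x].
  exact: grhom_comp (pr2_grhom _ _) (hh _ _).
rewrite /= comp_lfunE vE aE !comp_lfunE pr1E !pr2E.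
have := congr1 snd (key q x); rewrite coneE /= => ->.
have zid (V : zmodType) (a' b' c' : V) : a' + b' + c' - a' = b' + c'.
  by apply/eqP; rewrite subr_eq [X in _ == X]addrC addrA.
exact: zid.
Qed.

Lemma qiso_lift_unique (u v : cmap Q K) :
  htp (cm_comp i u) (cm_comp i v) -> htp u v.
Proof.
case=> g [hg gE]; pose C := cx_cone i.
pose f p q : 'Hom(Q p, C q) :=
  ((in1 _ _ \o (cm_off u p (q + 1)%R - cm_off v p (q + 1)%R)) - (in2 _ _ \o g p q))%VF.
have fE q x : f (q + 1) q x = (u (q + 1) x - v (q + 1) x, - g (q + 1) q x).
  rewrite !add_lfunE opp_lfunE !comp_lfunE in1E in2E add_lfunE opp_lfunE !cm_off_diag.
  by congr pair; rewrite /= ?addr0 ?sub0r ?subr0.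
have hf p q : is_grhom (f p q).
  apply: grhomB; last exact: grhom_comp (in2_grhom _ _) (hg _ _).
  by apply: grhom_comp (in1_grhom _ _) _; apply: grhomB; exact: cm_off_hom.
have ind (P : int -> Prop) : (forall q, P (q + 1)) -> forall p, P p.
  by move=> h' p; rewrite -(subrK 1 p); exact: h'.
have [h [hh hE]] : null (-1) (-1) f.
  apply: (null_lift _ hf _ Qb Hlift); first by rewrite oppr_eq0 oner_eq0.
  apply: ind => p q r t x e1 -> ->; have -> : q = p by rewrite e1 addrK.
  rewrite !fE coneE /= scaleN1r.
  congr pair; rewrite /=; first by rewrite lfunB !cmE.
  rewrite lfunB lfunN opprK.
  have := gE _ _ _ erefl erefl x; rewrite /= !comp_lfunE => ->.
  have zid (V : zmodType) (a' b' : V) : a' + b' - a' = b' by rewrite addrAC subrr add0r.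
  exact: zid.
have [a [ha aE]] := @reidx_tgt Q K (fun p q => (- (pr1 _ _ \o h p q))%VF)
  (fun p q => grhomN (grhom_comp (pr1_grhom _ _) (hh p q))).
exists a; split=> // p q r -> ->; move: q; apply: ind => q x.
have := hE (q + 1 + 1) (q + 1) q (q + 1 + 1 + 1) x (esym (addrK _ _)) erefl erefl.
rewrite fE !aE !opp_lfunE !comp_lfunE !pr1E => /(congr1 fst); rewrite /= coneE /= => ->.
by rewrite scaleN1r lfunN.
Qed.

End QisoLift.
End Homotopy.

(** * Injective resolutions *)

Section NatComplex.
Variables (k : fieldType) (A : gralg k) (M : nat -> grmod A).
Variable d : forall n, 'Hom(M n, M n.+1).
Hypotheses (hd : forall n, is_grhom (d n)) (dd : forall n x, d n.+1 (d n x) = 0).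

Definition ncar (z : int) : grmod A := if z is Posz n then M n else gm0 A.

Definition noff n m : 'Hom(M n, M m) :=
  match n.+1 =P m with
  | ReflectT e => ecast m 'Hom(M n, M m) e (d n)
  | ReflectF _ => 0
  end.

Lemma noffE n : noff n n.+1 = d n.
Proof. by rewrite /noff; case: (n.+1 =P n.+1) => // e; rewrite (eq_irrelevance e erefl). Qed.

Lemma noff_neq n m : m != n.+1 -> noff n m = 0.
Proof. by rewrite /noff; case: (n.+1 =P m) => // e /eqP ne; case: ne. Qed.

Definition nd (z z' : int) : 'Hom(ncar z, ncar z') :=
  match z, z' return 'Hom(ncar z, ncar z') with
  | Posz n, Posz m => noff n m
  | _, _ => 0
  end.

Lemma nd_hom z z' : is_grhom (nd z z').
Proof.
case: z z' => n [] m /=; try exact: grhom0.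
have [->|ne] := eqVneq m n.+1; first by rewrite noffE.
by rewrite noff_neq //; exact: grhom0.
Qed.

Lemma nd_deg z z' : z' != z + 1 -> nd z z' = 0.
Proof.
case: z z' => n [] m //= ne; rewrite noff_neq //.
by apply: contra_neq ne => ->; lia.
Qed.

Lemma nd_dd z z' z'' : (nd z' z'' \o nd z z')%VF = 0.
Proof.
have [e1|ne] := eqVneq z' (z + 1); last by rewrite (nd_deg ne) comp_lfun0r.
have [e2|ne] := eqVneq z'' (z' + 1); last by rewrite (nd_deg ne) comp_lfun0l.
case: z z' z'' e1 e2 => n [] m [] p //= e1 e2; rewrite ?comp_lfun0l ?comp_lfun0r //.
have em : m = n.+1 by lia.
have ep : p = m.+1 by lia.
subst p m; rewrite !noffE.
by apply/lfunP => x; rewrite comp_lfunE dd zero_lfunE.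
Qed.

Variable a : int.
Definition ncpx : cpx A.
Proof.
apply: (@Cpx _ _ (fun p => ncar (p - a)) (fun p q => nd (p - a) (q - a))) => [p q|p q|p q r].
- exact: nd_hom.
- by move=> ne; apply: nd_deg; apply: contra_neq ne => e; lia.
- exact: nd_dd.
Defined.
End NatComplex.

(** The restriction of the sum and the sum of the restrictions share carrier and weights, while
    their actions agree only propositionally; identity maps compare the two. *)
Lemma injective_over_sum (k : fieldType) (A : gralg k) (U : grsub A) (M N : grmod A) :
  injective_over U M -> injective_over U N -> injective_over U (gm_sum M N).
Proof.
move=> iM iN; pose S := gm_sum (gm_res U M) (gm_res U N).
have actE a (z : S) : gm_act S a z = gm_act (gm_res U (gm_sum M N)) a z.
  rewrite gm_resE; apply: etrans (sum_actE a z) _.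
  apply: etrans _ (esym (@sum_actE _ _ M N (vsval a) z)).
  by rewrite !gm_resE.
apply: (@gm_injective_bij _ _ S (gm_res U (gm_sum M N)) \1%VF \1%VF).
- split=> [a v|n v vn]; first by rewrite !id_lfunE actE.
  by rewrite id_lfunE; move: vn; rewrite /= !sum_wtE.
- split=> [a v|n v vn]; first by rewrite !id_lfunE actE.
  by rewrite id_lfunE; move: vn; rewrite /= !sum_wtE.
- by rewrite comp_lfun1l.
- exact: gm_injective_sum.
Qed.

Lemma gm_zero_res (k : fieldType) (A : gralg k) (U : grsub A) (M : grmod A) :
  gm_zero M -> injective_over U M.
Proof. by move=> M0; apply: gm_injective_zero. Qed.

Section Resolution.
Variables (k : fieldType) (A : gralg k) (A0 Aneg Apos : grsub A).
Hypothesis hA : semi_infinite_data A0 Aneg Apos.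

(* Equivalently, M has no nonzero Apos-submodule with all weights < c. *)
Definition cutfree (c : int) (M : grmod A) := forall w : M,
  (forall u n, u \in Apos -> c <= n -> gpr (gm_grading M) n (gm_act M u w) = 0) -> w = 0.

Lemma cutfree_zero c M : gm_zero M -> cutfree c M.
Proof. by move=> M0 w _; exact: gm_zeroE. Qed.

Lemma cutfree_wt c M : (forall n, n < c -> gm_wt M n = 0%VS) -> cutfree c M.
Proof.
move=> M0 w h; apply: (gpr_eq0 (hV := gm_grading M)) => n.
have [cn|nc] := lerP c n; first by rewrite -(h 1 n (gs_one Apos) cn) gm_act1 id_lfunE.
by apply/eqP; rewrite -memv0 -(M0 n nc) gpr_mem.
Qed.

Lemma cutfree_sum c M N : cutfree c M -> cutfree c N -> cutfree c (gm_sum M N).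
Proof.
move=> cM cN w h; have h1 := grhom_gpr _ _ (pr1_grhom M N).
have h2 := grhom_gpr _ _ (pr2_grhom M N).
have p1 : w.1 = 0.
  apply: cM => u n uP cn; have := h u n uP cn => /(congr1 (pr1 M N)).
  by rewrite h1 lfun0 (pr1_grhom M N).1 pr1E.
have p2 : w.2 = 0.
  apply: cN => u n uP cn; have := h u n uP cn => /(congr1 (pr2 M N)).
  by rewrite h2 lfun0 (pr2_grhom M N).1 pr2E.
by case: w p1 p2 {h} => x y /= -> ->.
Qed.

(** Apos-translates of a vector in the image come from M, so they have weights < c only. *)
Lemma cutfree_hom c (M N : grmod A) (f : 'Hom(M, N)) : cutfree c N ->
  (forall n, c <= n -> gm_wt M n = 0%VS) -> is_grhom f -> f = 0.
Proof.
move=> cN M0 hf; apply/lfunP => x; rewrite zero_lfunE; apply: cN => u n _ cn.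
rewrite -hf.1 -grhom_gpr //; suff -> : gpr (gm_grading M) n (gm_act M u x) = 0 by rewrite lfun0.
by apply/eqP; rewrite -memv0 -(M0 n cn) gpr_mem.
Qed.

(** By A = Aneg Apos it suffices to evaluate [f] at products x y, and f(x y) = (y f)(x). By
    assumption y f has components of weights n < c only, and these send [x] of degree e <= 0 into
    V_(e + n) = 0. *)
Lemma cutfree_coind c (V : vectType k) wt (hV : is_grading (wt : int -> {vspace V})) :
  (forall n, n < c -> wt n = 0%VS) -> cutfree c (coind A hV).
Proof.
move=> V0 f h; apply: (mult_ext (sid_np hA)) => x y xN yP; rewrite zero_lfunE.
rewrite -(gm_coindE hV y f x); move: x xN.
set g := gm_act _ y f; have gE n : c <= n -> gpr (gm_grading (coind A hV)) n g = 0.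
  by move=> cn; exact: h.
pose g' : 'Hom(A, V) := g.
suff H : forall x, x \in Aneg -> x \in lker g' by move=> x /H; rewrite memv_ker => /eqP.
apply: (neg_ind hA) => e x e0 xN xe; rewrite memv_ker; apply/eqP.
have -> : g' = \sum_(n <- gsupp (gm_grading (coind A hV))) (gpr (gm_grading (coind A hV)) n g : 'Hom(A, V)).
  by rewrite (gpr_sum (gm_grading (coind A hV)) g).
rewrite sum_lfunE big1 // => n _; have [cn|nc] := lerP c n.
  by rewrite gE // zero_lfunE.
apply/eqP; rewrite -memv0 -(V0 (e + n)); last by rewrite (le_lt_trans _ nc) // gerDr.
by have /coind_wtP := gpr_mem (gm_grading (coind A hV)) n g; apply.
Qed.

Section Stage.
Variables (E : grmod A) (c : int).
Let hE := gm_grading E.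

Definition cutpr : 'End(E) := \sum_(n <- gsupp hE | c <= n) gpr hE n.
Definition cutsp : {vspace E} := (\sum_(n <- [seq n <- gsupp hE | (c <= n)%R]) gm_wt E n)%VS.

Lemma cutprE n v : v \in gm_wt E n -> cutpr v = if c <= n then v else 0.
Proof.
move=> vn; rewrite /cutpr sum_lfunE.
case: (boolP (n \in gsupp hE)) => ns; last first.
  have -> : v = 0 by apply/eqP; rewrite -memv0 -(wt_gsupp (hV := hE) ns).
  by rewrite if_same big1 // => m _; rewrite lfun0.
transitivity (if c <= n then \sum_(m <- gsupp hE) gpr hE m v else 0).
  rewrite big_mkcond; case: ifP => cn; [apply: eq_bigr => m _|apply: big1 => m _].
    by rewrite (gprE hE m vn); case: eqP => [->|]; rewrite ?cn // if_same.
  by rewrite (gprE hE m vn); case: eqP => [->|]; rewrite ?cn // if_same.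
by rewrite gpr_sum.
Qed.

Lemma cutspI n v : v \in gm_wt E n -> c <= n -> v \in cutsp.
Proof.
move=> vn cn; case: (boolP (n \in gsupp hE)) => ns; last first.
  by move: vn; rewrite (wt_gsupp (hV := hE) ns) memv0 => /eqP ->; rewrite mem0v.
apply: (subvP (_ : gm_wt E n <= cutsp)%VS) vn.
by rewrite /cutsp (big_rem n) ?addvSl //= mem_filter cn.
Qed.

Lemma cutpr_sp v : cutpr v \in cutsp.
Proof.
rewrite /cutpr sum_lfunE; apply: memv_suml => n cn.
exact: cutspI (gpr_mem hE n v) cn.
Qed.

Lemma cutsp_gsub : gsub hE cutsp.
Proof.
move=> m v; rewrite memv_preim; move: v; apply/subvP/subv_bigsum => n.
rewrite mem_filter => /andP[cn _]; apply/subvP => v vn.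
rewrite -memv_preim (gprE hE m vn); case: eqP => _; last exact: mem0v.
exact: cutspI vn cn.
Qed.

Lemma cutsp_wt n : n < c -> sub_wt (gm_wt E) cutsp n = 0%VS.
Proof.
move=> nc; apply/eqP; rewrite -subv0; apply/subvP => x; rewrite sub_wtE => xn.
have h : forall v, v \in cutsp -> v \in lker (gpr hE n).
  apply/subvP/subv_bigsum => m; rewrite mem_filter => /andP[cm _]; apply/subvP => v vm.
  by rewrite memv_ker (gpr_neq hE vm) //; apply: contraTneq nc => ->; rewrite -leNgt.
have := h _ (subvsP x); rewrite memv_ker (gpr_id hE xn) => /eqP x0.
by rewrite memv0; apply/eqP/val_inj.
Qed.

(** Not a minimal injective hull: it is coinduced from the weights >= c of [E]. If [c] is below all
    weights of [E], it contains [E]; a larger [c] gives up the embedding in exchange for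
    [cutfree_coind]. *)
Definition hull : grmod A := coind A (sub_wt_grading cutsp_gsub).

(** A graded linear endomorphism with kernel [R], for graded [R], standing in for E -> E / R.
    Linearity over the ground field is all that the universal property of [coind] asks for. *)
Definition proj_away (R : {vspace E}) : 'End(E) := hz hE hE (\1 - projv R)%VF.

Lemma proj_away_ker R v : gsub hE R -> (proj_away R v == 0) = (v \in R).
Proof.
move=> gR; have wE w : (\1 - projv R)%VF w = w - projv R w by rewrite add_lfunE opp_lfunE id_lfunE.
apply/eqP/idP => [h|vR].
  rewrite -(gpr_sum hE v); apply: memv_suml => n _; have := gpr_mem hE n v.
  have : proj_away R (gpr hE n v) = 0.
    by rewrite (gpr_comm hE hE) ?h ?lfun0 //; exact: hz_wt.
  move: (gpr hE n v) => w + wn; rewrite /proj_away (hzE _ _ _ wn) wE lfunB gpr_id // => /eqP.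
  by rewrite subr_eq0 => /eqP ->; apply: gR; exact: memv_proj.
rewrite -(gpr_sum hE v) lfun_sum big1 // => n _.
rewrite /proj_away (hzE _ _ _ (gpr_mem hE n v)) wE projv_id ?subrr ?lfun0 //.
exact: gR.
Qed.

Definition hull_pr (R : {vspace E}) : 'Hom(E, subvs_of cutsp) :=
  (linfun (vsproj cutsp) \o cutpr \o proj_away R)%VF.

Definition hull_map (R : {vspace E}) : 'Hom(E, hull) :=
  coind_map (sub_wt_grading cutsp_gsub) (hull_pr R).

Lemma hull_prE R v : vsval (hull_pr R v) = cutpr (proj_away R v).
Proof. by rewrite !comp_lfunE lfunE /= vsprojK // cutpr_sp. Qed.

Lemma hull_map_hom R : is_grhom (hull_map R).
Proof.
apply: coind_map_hom => n v vn; rewrite sub_wtE hull_prE.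
have h : proj_away R v \in gm_wt E n by exact: hz_wt.
by rewrite (cutprE h); case: ifP; rewrite ?mem0v.
Qed.

Lemma hull_map0 R v : stable R -> v \in R -> hull_map R v = 0.
Proof.
move=> [gR sR] vR; apply/lfunP => x; rewrite coind_mapE zero_lfunE; apply: val_inj.
rewrite /= hull_prE; have /eqP -> : proj_away R (gm_act E x v) == 0 by rewrite proj_away_ker // sR.
by rewrite lfun0.
Qed.

Lemma hull_map_ker R v : stable R -> hull_map R v = 0 ->
  forall x n, c <= n -> gpr hE n (gm_act E x v) \in R.
Proof.
move=> [gR sR] h x n cn; have := coind_mapE (sub_wt_grading cutsp_gsub) (hull_pr R) v x.
rewrite -/(hull_map R) h zero_lfunE => /(congr1 (@vsval _ _ _)); rewrite hull_prE /=.
move: (gm_act E x v) => w e; rewrite -proj_away_ker //.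
have gp m u : proj_away R (gpr hE m u) = gpr hE m (proj_away R u).
  by rewrite (gpr_comm hE hE) //; exact: hz_wt.
rewrite gp; set y := proj_away R w in e *.
have cc : forall m u, u \in gm_wt E m -> cutpr u \in gm_wt E m.
  by move=> m u um; rewrite (cutprE um); case: ifP; rewrite ?mem0v.
have := gpr_comm hE hE cc n y; rewrite -e lfun0 (cutprE (gpr_mem hE n y)) cn => ->.
by [].
Qed.

End Stage.

Variables (K : cpx A) (a : int) (ka : grmod A -> int).

(* The n-th term of the resolution of K starting in degree a. rI n.+1 contains
   the quotient of rE n = K n (+) rI n by the image rR n of the previous
   differential of the cone, up to a part of weights < ka. *)
Fixpoint rI (n : nat) : grmod A :=
  if n is m.+1 then hull (gm_sum (K (m%:Z + a)) (rI m)) (ka (gm_sum (K (m%:Z + a)) (rI m)))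
  else gm0 A.
Definition rE n := gm_sum (K (n%:Z + a)) (rI n).

(** [rE n] is the term of the cone of K -> I in degree n - 1 + a, and this is its differential. The
    subspace is a variable [R] so that [rR] can be defined by recursion through it. *)
Definition rc n (R : {vspace rE n}) : 'Hom(rE n, rE n.+1) :=
  ((in1 (K (n.+1%:Z + a)) (rI n.+1) \o (- cx_d K (n%:Z + a) (n.+1%:Z + a)) \o pr1 (K (n%:Z + a)) (rI n))
   + (in2 (K (n.+1%:Z + a)) (rI n.+1) \o (hull_map (ka (rE n)) R : 'Hom(rE n, rI n.+1))))%VF.

Fixpoint rR n : {vspace rE n} := if n is m.+1 then limg (rc (rR m)) else 0%VS.

Definition rq n : 'Hom(rE n, rI n.+1) := hull_map (ka (rE n)) (rR n).

Lemma rcE n z : rc (rR n) z = (- cx_d K (n%:Z + a) (n.+1%:Z + a) z.1, rq n z).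
Proof.
rewrite add_lfunE !comp_lfunE pr1E in1E in2E opp_lfunE.
by congr pair; rewrite /= ?addr0 ?add0r.
Qed.

Lemma rcE2 n x y : rc (rR n) (x, y) = (- cx_d K (n%:Z + a) (n.+1%:Z + a) x, rq n (x, y)).
Proof. exact: rcE. Qed.

Lemma rq_hom n : is_grhom (rq n). Proof. exact: hull_map_hom. Qed.

Lemma rc_hom n : is_grhom (rc (rR n)).
Proof.
apply: grhomD; last exact: grhom_comp (in2_grhom _ _) (rq_hom n).
apply: grhom_comp (pr1_grhom _ _); apply: grhom_comp (in1_grhom _ _) _.
by apply: grhomN; exact: cx_d_hom.
Qed.

Lemma rR_stable n : stable (rR n).
Proof. by case: n => [|n]; [exact: stable0 | exact: stable_limg (rc_hom n)]. Qed.

Lemma rq_R n v : v \in rR n -> rq n v = 0.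
Proof. by apply: hull_map0; exact: rR_stable. Qed.

Lemma rq_c n v : rq n.+1 (rc (rR n) v) = 0.
Proof. by apply: rq_R; rewrite /= memv_img ?memvf. Qed.

Definition rd n : 'Hom(rI n.+1, rI n.+2) := (rq n.+1 \o in2 (K (n.+1%:Z + a)) (rI n.+1))%VF.

Lemma rdE n y : rd n y = rq n.+1 (0, y). Proof. by rewrite comp_lfunE in2E. Qed.

Lemma rd_hom n : is_grhom (rd n).
Proof. exact: grhom_comp (rq_hom _) (in2_grhom _ _). Qed.

Lemma rd_dd n y : rd n.+1 (rd n y) = 0.
Proof.
rewrite !rdE; have := rq_c (n := n.+1) (0, y).
by rewrite rcE2 lfun0 oppr0; apply.
Qed.

Definition res_cpx : cpx A := @ncpx _ _ (fun n => rI n.+1) rd rd_hom rd_dd a.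

Definition ri (z : int) : 'Hom(K (z + a), ncar (fun n => rI n.+1) z) :=
  match z return 'Hom(K (z + a), ncar (fun n => rI n.+1) z) with
  | Posz n => (rq n \o in1 (K (n%:Z + a)) (rI n))%VF
  | Negz _ => 0
  end.

Lemma ri_hom z : is_grhom (ri z).
Proof. by case: z => n /=; [exact: grhom_comp (rq_hom _) (in1_grhom _ _) | exact: grhom0]. Qed.

Hypothesis Ka : forall p, p < a -> gm_zero (K p).
Hypothesis exq : forall n v, rq n v = 0 -> v \in rR n.

Local Notation dz := (nd rd).

Lemma riE n x : ri (Posz n) x = rq n (x, 0).
Proof. by rewrite [ri _]/ri comp_lfunE in1E. Qed.

Lemma dzE n y : dz (Posz n) (Posz n.+1) y = rq n.+1 (0, y).
Proof. by rewrite [nd _ _ _]/nd noffE rdE. Qed.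

Lemma ri_comm z z' x : z' = z + 1 -> dz z z' (ri z x) = ri z' (cx_d K (z + a) (z' + a) x).
Proof.
case: z x => n x e; last first.
  have Kz : gm_zero (K (Negz n + a)) by apply: Ka; lia.
  by rewrite (gm_zeroE Kz x) !lfun0.
have {e} -> : z' = Posz n.+1 by lia.
rewrite !riE dzE; have := rq_c (n := n) (x, 0); rewrite rcE2.
have -> : (- cx_d K (n%:Z + a) (n.+1%:Z + a) x, rq n (x, 0)) =
  (0, rq n (x, 0)) - (cx_d K (n%:Z + a) (n.+1%:Z + a) x, 0) :> rE n.+1.
  by congr pair; rewrite ?sub0r ?subr0.
by rewrite lfunB => /eqP; rewrite subr_eq0 => /eqP.
Qed.

(** In front of degree 0 both [rI 0] and the preceding term of the resolution are zero. This form
    lets [ri_qiso] treat the start like every other degree. *)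
Lemma prev_ex n z : Posz n = z + 1 ->
  (forall y, exists y', dz z n y = rq n (0, y')) /\ (forall y', exists y, dz z n y = rq n (0, y')).
Proof.
case: n z => [|n] z e.
  have -> : z = Negz 0 by lia.
  have g0 : gm_zero (rI 0) by exact: gm0_zero.
  have d0 y : dz (Negz 0) 0 y = 0 by rewrite zero_lfunE.
  have q0 : rq 0 (0, 0) = 0 by exact: lfun0.
  by split=> y; exists 0; rewrite d0 ?(gm_zeroE g0 y) q0.
have -> : z = Posz n by lia.
by split=> y; exists y; exact: dzE.
Qed.

(** Both halves are exactness of the cone in the form [exq]. For a cocycle [x] with ri x = d y, the
    vector (x, - y') lies in the image of the previous differential; for a cocycle [y] of the
    resolution, (0, y) does so one stage later. *)
Lemma ri_qiso z z' z'' : z' = z + 1 -> z'' = z' + 1 ->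
  (forall x, cx_d K (z' + a) (z'' + a) x = 0 -> (exists y, ri z' x = dz z z' y) ->
     exists x', x = cx_d K (z + a) (z' + a) x') /\
  (forall y, dz z' z'' y = 0 -> exists x y', cx_d K (z' + a) (z'' + a) x = 0 /\
     y = ri z' x + dz z z' y').
Proof.
case: z' => n e1 e2; last first.
  have Kz : gm_zero (K (Negz n + a)) by apply: Ka; lia.
  split=> [x _ _|y _]; first by exists 0; rewrite (gm_zeroE Kz x) lfun0.
  exists 0, 0; rewrite lfun0; split=> //.
  have n0 : gm_zero (ncar (fun n => rI n.+1) (Negz n)) by exact: gm0_zero.
  by rewrite (gm_zeroE n0 y) !lfun0 addr0.
have [P1 P2] := prev_ex e1; have {e2} -> : z'' = Posz n.+1 by lia.
have pairB (x : K (n%:Z + a)) (y : rI n) : rq n (x, y) = rq n (x, 0) + rq n (0, y).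
  by rewrite -lfunD; congr (rq n (_, _)); rewrite ?addr0 ?add0r.
split=> [x dx [y]|y].
  have [y' ->] := P1 y; rewrite riE => e.
  have : (x, - y') \in rR n.
    apply: exq; rewrite pairB e -lfunD.
    have -> : (0, y') + (0, - y') = 0 :> rE n by congr pair; rewrite ?addr0 ?subrr.
    exact: lfun0.
  case: n e1 x dx y y' e {P1 P2 pairB} => [|n] e1 x dx y y' _.
    by rewrite memv0 => /eqP[-> _]; exists 0; rewrite lfun0.
  case/memv_imgP => -[x0 m0] _; rewrite rcE2 => -[-> _].
  have -> : z = Posz n by lia.
  by exists (- x0); rewrite lfunN.
rewrite dzE => /exq /memv_imgP[[x m] _].
rewrite rcE2 => -[/esym/eqP + ->]; rewrite oppr_eq0 => /eqP dx.
have [y' y'E] := P2 m; exists x, y'; split=> //.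
by rewrite pairB -y'E riE.
Qed.

Lemma res_qiso : exists i : cmap K res_cpx, quasi_iso i.
Proof.
pose ip p : 'Hom(K p, res_cpx p) := (ri (p - a) \o recast K p (p - a + a))%VF.
have [||i iE] := @cmap_of _ _ K res_cpx ip.
- by move=> p; apply: grhom_comp; [exact: ri_hom | exact: recast_hom].
- move=> p q e x; rewrite /ip !comp_lfunE /=.
  have : q - a = p - a + 1 by rewrite e; ring.
  move: {e} (p - a) (q - a) (subrK a p) (subrK a q) => z z' ep eq e'.
  subst p q; rewrite !recastE; exact: ri_comm.
exists i; apply/qisoP => p q r e1 e2.
have iE' x : i q x = ri (q - a) (recast K q (q - a + a) x) by rewrite iE comp_lfunE.
split=> [x dx|y].
  rewrite iE'; move: x dx {iE'}; rewrite /=.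
  have : q - a = p - a + 1 by rewrite e1; ring.
  have : r - a = q - a + 1 by rewrite e2; ring.
  move: {e1 e2} (p - a) (q - a) (r - a) (subrK a p) (subrK a q) (subrK a r) => z z' z'' ep eq er ez2 ez1.
  move=> x; subst p q r; rewrite recastE.
  by have [h _] := ri_qiso ez1 ez2; exact: h.
have : cx_d res_cpx q r y = 0 -> exists x y', cx_d K q r x = 0 /\
    y = ri (q - a) (recast K q (q - a + a) x) + cx_d res_cpx p q y'.
  move: y; rewrite /=.
  have : q - a = p - a + 1 by rewrite e1; ring.
  have : r - a = q - a + 1 by rewrite e2; ring.
  move: {e1 e2} (p - a) (q - a) (r - a) (subrK a p) (subrK a q) (subrK a r) => z z' z'' ep eq er ez2 ez1.
  move=> y; subst p q r => dy; have [_ h] := ri_qiso ez1 ez2.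
  by have [x [y' [dx e]]] := h y dy; exists x, y'; rewrite recastE.
by move=> h /h [x [y' [dx e]]]; exists x, y'; rewrite iE'.
Qed.

Lemma res_zero p : p < a -> gm_zero (res_cpx p).
Proof.
move=> pa; have : p - a < 0 by rewrite subr_lt0.
by rewrite /=; case: (p - a) => // n _; exact: gm0_zero.
Qed.

Lemma res_term p : gm_zero (res_cpx p) \/ exists E, res_cpx p = hull E (ka E).
Proof.
rewrite /=; case: (p - a) => n /=; last by left; exact: gm0_zero.
by right; exists (rE n).
Qed.

End Resolution.

Section ResolutionExists.
Variables (k : fieldType) (A : gralg k) (A0 Aneg Apos : grsub A).
Hypothesis hA : semi_infinite_data A0 Aneg Apos.

Definition inj_cpx (I : cpx A) := forall p,
  [/\ gm_injective (I p), injective_over Apos (I p) & injective_over Aneg (I p)].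

Lemma hull_inj (M : grmod A) : gm_zero M \/ (exists E c, M = hull E c) ->
  [/\ gm_injective M, injective_over Apos M & injective_over Aneg M].
Proof.
case=> [M0|[E [c ->]]].
  by split; [exact: gm_injective_zero | exact: gm_zero_res | exact: gm_zero_res].
by split; [exact: coind_injective | exact: coind_pos hA _ _ _ | exact: coind_neg hA _ _ _].
Qed.

Variables (K : cpx A) (a : int).
Hypothesis Ka : forall p, p < a -> gm_zero (K p).

Lemma injective_resolution : exists (I : cpx A) (i : cmap K I),
  [/\ quasi_iso i, forall p, p < a -> gm_zero (I p) & inj_cpx I].
Proof.
have lb (E : grmod A) : exists c, forall n, n < c -> gm_wt E n = 0%VS.
  by have [c [b h]] := wt_bounds (gm_grading E); exists c => n nc; apply: h; rewrite nc.
(* With a cut below all weights of [E] nothing is cut off, so that everything killed by [rq] lies in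
   [rR]. *)
pose ka E := proj1_sig (constructive_indefinite_description _ (lb E)).
have kaP E : forall n, n < ka E -> gm_wt E n = 0%VS.
  exact: proj2_sig (constructive_indefinite_description _ (lb E)).
have [|i qi] := @res_qiso _ _ K a ka Ka.
  move=> n v /(hull_map_ker (rR_stable K a ka n)) h.
  rewrite -(gpr_sum (gm_grading _) v); apply: memv_suml => m _.
  have [cm|mc] := lerP (ka (rE K a ka n)) m.
    by have := h 1 m cm; rewrite gm_act1 id_lfunE.
  have := gpr_mem (gm_grading (rE K a ka n)) m v; rewrite (kaP _ _ mc) memv0 => /eqP ->.
  exact: mem0v.
exists (res_cpx K a ka), i; split=> // [p|p]; first exact: res_zero.
apply: hull_inj; case: (res_term K a ka p) => [|[E ->]]; first by left.
by right; exists E, (ka E).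
Qed.

(** With a fixed cut the map [q n] could kill more than [R n]. To exclude this, every [E n] gets an
    Apos-linear [t] that kills [R n] and is the identity modulo [R n]. If q n v = 0, the
    Apos-translates of t v have no weights >= c, so t v = 0 because [E n] is cut-free, and [v] is in
    [R n]. The next [t] comes from Apos-injectivity of [E n]: as [t] kills the kernel of [q n], it
    factors as s q n, and 1 - cc s pr2 has the required properties on [E n.+1]. *)
Lemma cut_resolution c :
  (forall p, injective_over Apos (K p)) -> (forall p, cutfree Apos c (K p)) ->
  exists (I : cpx A) (i : cmap K I),
  [/\ quasi_iso i, forall p, p < a -> gm_zero (I p), inj_cpx I & forall p, cutfree Apos c (I p)].
Proof.
move=> iK cK; pose ka (_ : grmod A) := c.
pose E := rE K a ka; pose R := rR K a ka; pose q := rq K a ka.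
have hullcut (M : grmod A) : cutfree Apos c (hull M c).
  by apply: (cutfree_coind hA) => n; exact: cutsp_wt.
have Ecut n : cutfree Apos c (E n).
  apply: cutfree_sum; first exact: cK.
  by case: n => [|n]; [apply: cutfree_zero; exact: gm0_zero | exact: hullcut].
have Einj n : injective_over Apos (E n).
  apply: injective_over_sum; first exact: iK.
  by case: n => [|n]; [apply: gm_zero_res; exact: gm0_zero | exact: coind_pos hA _ _ _].
have ker_of n (t : 'End(E n)) : Uhom Apos t -> (forall e, e \in R n -> t e = 0) ->
    (forall e, t e - e \in R n) -> forall v, q n v = 0 -> v \in R n.
  move=> [tP tw] tR te v qv; have := hull_map_ker (rR_stable K a ka n) qv => h.
  have tv : t v = 0.
    apply: Ecut => u m uP cm; rewrite -tP // -(gpr_comm (gm_grading _) (gm_grading _) tw).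
    by apply: tR; exact: h.
  by have := te v; rewrite tv sub0r memvN.
have tau n : exists t : 'End(E n), [/\ Uhom Apos t, forall e, e \in R n -> t e = 0 &
    forall e, t e - e \in R n].
  elim: n => [|n [t [tU tR te]]].
    exists \1%VF; split=> [|e|e]; first by split=> *; rewrite !id_lfunE.
      by rewrite memv0 => /eqP ->; rewrite lfun0.
    by rewrite id_lfunE subrr mem0v.
  have [||||s [hs sE]] := inj_ext (B := sub_gralg Apos) (I := gm_res Apos (E n))
    (M := gm_res Apos (E n)) (N := gm_res Apos (rI K a ka n.+1)) (q := q n) (t := t).
  - exact: Einj.
  - by apply: grhom_res; exact: rq_hom.
  - exact/resP.
  - by move=> x /(ker_of n t tU tR te); exact: tR.
  move/resP: hs => hs.
  pose s0 : 'Hom(rI K a ka n.+1, E n) := s.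
  have sq x : s0 (q n x) = t x by rewrite -comp_lfunE [(_ \o _)%VF]sE.
  pose cc := rc (rR K a ka n); have hc : is_grhom cc by exact: rc_hom.
  pose t' : 'End(E n.+1) := (\1 - (cc \o s0 \o pr2 _ _))%VF.
  have t'E e : t' e = e - cc (s0 e.2).
    by rewrite add_lfunE opp_lfunE id_lfunE !comp_lfunE pr2E.
  have ccR e : e \in R n -> cc e = 0.
    move=> eR; rewrite /cc rcE [rq _ _ _ _ _]rq_R //.
    case: n e eR {t tU tR te s hs sE s0 sq cc hc t' t'E} => [|n] e.
      by rewrite memv0 => /eqP ->; rewrite lfun0 oppr0.
    by case/memv_imgP => e0 _ ->; rewrite rcE /= lfunN opprK ddE.
  exists t'; split=> [|e|e].
  - split=> [b v bP|m v vm].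
      have h2 := (pr2_grhom (K (n.+1%:Z + a)) (rI K a ka n.+1)).1 b v.
      rewrite !pr2E in h2; rewrite !t'E h2 hs.1 // hc.1 lfunB.
      by [].
    rewrite t'E memvB //; apply: hc.2; apply: hs.2.
    by have := (pr2_grhom (K (n.+1%:Z + a)) (rI K a ka n.+1)).2 m v vm; rewrite pr2E.
  (* t' (cc e0) = cc (e0 - t e0), and e0 - t e0 lies in [R n], which [cc] kills. *)
  - case/memv_imgP => e0 _ ->; rewrite t'E -/cc /cc rcE /= -/(q n e0) sq -rcE -/cc.
    rewrite -lfunB; apply: ccR; rewrite -memvN opprB; exact: te.
  by rewrite t'E addrAC subrr sub0r memvN memv_img ?memvf.
have [|i qi] := @res_qiso _ _ K a ka Ka.
  by move=> n v; have [t [tU tR te]] := tau n; exact: ker_of tU tR te v.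
exists (res_cpx K a ka), i; split=> // [p|p|p]; first exact: res_zero.
  apply: hull_inj; case: (res_term K a ka p) => [|[M ->]]; first by left.
  by right; exists M, (ka M).
case: (res_term K a ka p) => [|[M ->]]; first exact: cutfree_zero.
exact: hullcut.
Qed.

End ResolutionExists.

#[global] Instance dm_eq_equiv (k : fieldType) (A : gralg k) (P : cpx A -> Prop)
  (X Y : cpx_in P) : Equivalence (@dm_eq k A P X Y).
Proof.
split; first exact: dm_refl.
- by move=> f g; exact: dm_sym.
- by move=> f g h; exact: dm_trans.
Qed.

#[global] Instance dm_comp_proper (k : fieldType) (A : gralg k) (P : cpx A -> Prop)
  (X Y Z : cpx_in P) :
  Proper (@dm_eq k A P Y Z ==> @dm_eq k A P X Y ==> @dm_eq k A P X Z) (@dm_comp k A P X Y Z).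
Proof. by move=> g g' eg f f' ef; exact: dm_congr. Qed.

#[global] Hint Resolve dm_refl : core.

(** * Derived categories *)

Section Quasi.
Variables (k : fieldType) (A : gralg k).
Implicit Types X Y Z : cpx A.

Lemma qiso_id X : quasi_iso (cm_id X).
Proof.
move=> p; split=> [x dx [y]|y dy]; first by rewrite id_lfunE => ->; exists y.
by exists y, 0; rewrite id_lfunE lfun0 addr0.
Qed.

Lemma qiso_htp X Y (f g : cmap X Y) : htp f g -> quasi_iso f -> quasi_iso g.
Proof.
move=> [h [hh hE]] /qisoP qf; apply/qisoP => p q r e1 e2.
have [inj sur] := qf p q r e1 e2.
have fg x : cx_d X q r x = 0 -> f q x = g q x + cx_d Y p q (h q p x).
  move=> dx; apply/eqP; rewrite addrC -subr_eq; apply/eqP.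
  by rewrite (hE _ _ _ e1 e2) dx lfun0 addr0.
split=> [x dx [y gy]|y dy].
  by apply: inj => //; exists (y + h q p x); rewrite fg // gy lfunD.
have [x [y' [dx ->]]] := sur y dy; exists x, (h q p x + y'); split=> //.
by rewrite fg // lfunD addrA.
Qed.

Lemma qiso_comp X Y Z (g : cmap Y Z) (f : cmap X Y) :
  quasi_iso g -> quasi_iso f -> quasi_iso (cm_comp g f).
Proof.
move=> qg qf p; have [ig sg] := qg p; have [jf sf] := qf p.
split=> [x dx [y]|z dz].
  rewrite comp_lfunE => e; apply: jf => //; apply: ig; last by exists y.
  by rewrite cmE dx lfun0.
have [y [z' [dy ->]]] := sg z dz; have [x [y' [dx ->]]] := sf y dy.
exists x, (g (p - 1) y' + z'); split=> //.
by rewrite comp_lfunE !lfunD cmE addrA.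
Qed.

Lemma qiso_hequiv X Y (f : cmap X Y) (g : cmap Y X) :
  htp (cm_comp g f) (cm_id X) -> htp (cm_comp f g) (cm_id Y) -> quasi_iso f.
Proof.
move=> /htp_sym h1 /htp_sym h2.
have q1 := qiso_htp h1 (qiso_id X); have q2 := qiso_htp h2 (qiso_id Y).
move=> p; have [inj _] := q1 p; have [_ sur] := q2 p; split=> [x dx [y fy]|y dy].
  by apply: inj => //; exists (g (p - 1) y); rewrite comp_lfunE fy cmE.
have [x [y' [dx ->]]] := sur y dy; exists (g p x), y'; split; first by rewrite cmE dx lfun0.
by rewrite comp_lfunE.
Qed.

Lemma cm_compE X Y Z (g : cmap Y Z) (f : cmap X Y) p x : cm_comp g f p x = g p (f p x).
Proof. by rewrite comp_lfunE. Qed.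

Lemma cm_idE X p x : cm_id X p x = x. Proof. by rewrite id_lfunE. Qed.

End Quasi.

Section HtpLocalized.
Variables (k : fieldType) (A : gralg k) (P : cpx A -> Prop).
Hypothesis Pcone : forall X Y (f : cmap X Y), P X -> P Y -> P (cx_cone f).
Hypothesis Psum : forall X Y, P X -> P Y -> P (cx_sum X Y).

Lemma dm_map_ext' (X Y : cpx_in P) (f g : cmap X Y) : (forall p x, f p x = g p x) ->
  dm_eq (dm_map f) (dm_map g).
Proof. by move=> e; apply: dm_map_ext => p; apply/lfunP => x; exact: e. Qed.

(** A right inverse of an invertible morphism is its inverse. *)
Lemma dm_section (X Y : cpx_in P) (s : cmap Y X) (qs : quasi_iso s) (i : cmap X Y) :
  (forall p x, s p (i p x) = x) -> dm_eq (dm_map i) (dm_inv qs).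
Proof.
move=> si; transitivity (dm_comp (dm_id Y) (dm_map i)); first by rewrite dm_idl.
rewrite -(dm_invl qs) -dm_assoc -dm_map_comp.
have -> : dm_eq (dm_map (cm_comp s i)) (dm_id X).
  by apply: dm_map_ext' => p x; rewrite cm_compE cm_idE.
exact: dm_idr.
Qed.

Section Cylinder.
Variables (X Y : cpx_in P) (f g : cmap X Y).

Fact diag_ex : {D : cmap X (cx_sum X X) | forall p x, D p x = (x, - x)}.
Proof.
pose F p : 'Hom(X p, cx_sum X X p) := (in1 _ _ - in2 _ _).
have FE p x : F p x = (x, - x).
  by rewrite add_lfunE opp_lfunE in1E in2E; congr pair; rewrite /= ?subr0 ?sub0r.
unshelve eexists (@CMap _ _ X (cx_sum X X) F _ _).
- by move=> p; apply: grhomB; [exact: in1_grhom | exact: in2_grhom].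
- move=> p q; apply/lfunP => x; rewrite !comp_lfunE !FE /= sum_dE /=.
  by rewrite lfunN.
- by move=> p x; exact: FE.
Qed.

Let D := sval diag_ex.
Let DE p x : D p x = (x, - x). Proof. exact: (svalP diag_ex). Qed.
Let Cyl : cpx_in P := CpxIn (Pcone D (ci_in X) (Psum (ci_in X) (ci_in X))).

(** The cylinder is the cone of x |-> (x, - x). Adding its two ends is a quasi-isomorphism [pr], so
    the sections [i0] and [i1] of [pr] become equal in the localization. The homotopy defines a map
    [G] on the cylinder that restricts to [f] along [i0] and to [g] along [i1]. *)
Lemma htp_dm_eq : htp f g -> dm_eq (dm_map f) (dm_map g).
Proof.
move=> [h [hh hE]].
pose c1 p (z : Cyl p) : X (p + 1) := z.1.
pose c2 p (z : Cyl p) : X p := z.2.1.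
pose c3 p (z : Cyl p) : X p := z.2.2.
have dC p z : cx_d Cyl p (p + 1) z = (- cx_d X (p + 1) (p + 1 + 1) z.1,
    (z.1 + cx_d X p (p + 1) z.2.1, - z.1 + cx_d X p (p + 1) z.2.2)).
  rewrite coneE DE /= sum_dE.
  by [].
have [||pr prE] := @cmap_of _ _ Cyl X (fun p => ((pr1 _ _ + pr2 _ _) \o pr2 (X (p + 1)) (gm_sum (X p) (X p)))%VF).
- move=> p; exact: grhom_comp (grhomD (pr1_grhom _ _) (pr2_grhom _ _)) (pr2_grhom _ _).
- move=> p q -> z; rewrite dC !comp_lfunE !pr2E !add_lfunE !pr1E !pr2E /=.
  by rewrite lfunD addrACA subrr add0r.
have prE' p z : pr p z = z.2.1 + z.2.2 by rewrite prE comp_lfunE pr2E add_lfunE pr1E pr2E.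
have [||i0 i0E] := @cmap_of _ _ X Cyl (fun p => (in2 (X (p + 1)) (gm_sum (X p) (X p)) \o in1 _ _)%VF).
- by move=> p; exact: grhom_comp (in2_grhom _ _) (in1_grhom _ _).
- by move=> p q -> z; rewrite dC !comp_lfunE !in1E !in2E /= !lfun0 !oppr0 ?add0r ?addr0.
have [||i1 i1E] := @cmap_of _ _ X Cyl (fun p => (in2 (X (p + 1)) (gm_sum (X p) (X p)) \o in2 _ _)%VF).
- by move=> p; exact: grhom_comp (in2_grhom _ _) (in2_grhom _ _).
- by move=> p q -> z; rewrite dC !comp_lfunE !in2E /= !lfun0 !oppr0 ?add0r ?addr0.
have [||G GE] := @cmap_of _ _ Cyl Y (fun p => ((h (p + 1)%R p \o pr1 (X (p + 1)) (gm_sum (X p) (X p))) +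
   (f p \o pr1 _ _ \o pr2 (X (p + 1)) (gm_sum (X p) (X p))) + (g p \o pr2 _ _ \o pr2 (X (p + 1)) (gm_sum (X p) (X p))))%VF).
- move=> p; apply: grhomD; first apply: grhomD.
  + exact: grhom_comp (hh _ _) (pr1_grhom _ _).
  + exact: grhom_comp (grhom_comp (cm_hom f p) (pr1_grhom _ _)) (pr2_grhom _ _).
  + exact: grhom_comp (grhom_comp (cm_hom g p) (pr2_grhom _ _)) (pr2_grhom _ _).
- move=> p q -> z; rewrite dC !add_lfunE !comp_lfunE !pr2E !pr1E /=.
  rewrite !lfunD !lfunN !cmE.
  have := hE _ _ _ erefl erefl z.1.
  have zid (V : zmodType) (dh hd fx gx fa gb : V) : fx - gx = dh + hd ->
      dh + fa + gb = - hd + (fx + fa) + (- gx + gb).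
    move=> e; have -> : dh = fx - gx - hd by rewrite e addrK.
    by rewrite [LHS](ACl (3 * 1 * 4 * 2 * 5)) /= !addrA.
  exact: zid.
have GE' p z : G p z = h (p + 1) p z.1 + f p z.2.1 + g p z.2.2.
  by rewrite GE !add_lfunE !comp_lfunE !pr2E !pr1E.
have qpr : quasi_iso pr.
  apply/qisoP => p q r -> ->; split=> [z|y dy].
    rewrite dC => -[z1 z2 z3] [c]; rewrite prE' => e.
    exists (z.2.1, (0, c)); rewrite dC /= lfun0 addr0 -e addrA addNr add0r.
    case: z z1 z2 z3 {e} => x [a b] /= _ /eqP; rewrite addr_eq0 => /eqP -> _.
    by [].
  exists (0, (y, 0)), 0; rewrite prE' dC /= !lfun0 oppr0 dy !addr0; split=> //; rewrite oppr0; exact: erefl.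
have e0 : dm_eq (dm_map i0) (dm_inv (X := Cyl) (Y := X) qpr).
  apply: dm_section => p x; rewrite i0E prE' comp_lfunE in2E in1E /=.
  by rewrite addr0.
have e1 : dm_eq (dm_map i1) (dm_inv (X := Cyl) (Y := X) qpr).
  apply: dm_section => p x; rewrite i1E prE' comp_lfunE !in2E /=.
  by rewrite add0r.
transitivity (dm_map (X := X) (Y := Y) (cm_comp (Y := Cyl) G i0)).
  apply: dm_map_ext' => p x; rewrite cm_compE i0E GE' comp_lfunE in2E in1E /=.
  by rewrite !lfun0 add0r addr0.
transitivity (dm_map (X := X) (Y := Y) (cm_comp (Y := Cyl) G i1)).
  by rewrite (dm_map_comp (Y := Cyl)) e0 -e1 -dm_map_comp.
apply: dm_map_ext' => p x; rewrite cm_compE i1E GE' comp_lfunE !in2E /=.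
by rewrite !lfun0 !add0r.
Qed.

End Cylinder.
End HtpLocalized.

Section SumMaps.
Variables (k : fieldType) (A : gralg k) (X Y : cpx A).
Lemma cm_pr1E p x : cm_pr1 X Y p x = x.1. Proof. exact: pr1E. Qed.
Lemma cm_pr2E p x : cm_pr2 X Y p x = x.2. Proof. exact: pr2E. Qed.
Lemma cm_in1E p x : cm_in1 X Y p x = (x, 0). Proof. exact: in1E. Qed.
Lemma cm_in2E p x : cm_in2 X Y p x = (0, x). Proof. exact: in2E. Qed.
Lemma sumE p q x : cx_d (cx_sum X Y) p q x = (cx_d X p q x.1, cx_d Y p q x.2).
Proof. exact: sum_dE. Qed.
End SumMaps.

Section BoundedBelow.
Variables (k : fieldType) (A : gralg k).

Lemma bb_cone (X Y : cpx A) (f : cmap X Y) :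
  bounded_below X -> bounded_below Y -> bounded_below (cx_cone f).
Proof.
move=> [a h] [b h']; exists (Num.min (a - 1) b) => p; rewrite lt_min => /andP[pa pb].
by apply: gm_zero_sum; [apply: h; lia | exact: h'].
Qed.

Lemma bb_sum (X Y : cpx A) : bounded_below X -> bounded_below Y -> bounded_below (cx_sum X Y).
Proof.
move=> [a h] [b h']; exists (Num.min a b) => p; rewrite lt_min => /andP[pa pb].
by apply: gm_zero_sum; [exact: h | exact: h'].
Qed.

Lemma bb_shift (i : int) (X : cpx A) : bounded_below X -> bounded_below (cx_shift i X).
Proof. by move=> [a h]; exists (a - i) => p pa; apply: h; lia. Qed.

Lemma htp_plus (X Y : Dplus A) (f g : cmap X Y) : htp f g -> dm_eq (dm_map f) (dm_map g).
Proof. exact: (htp_dm_eq bb_cone bb_sum). Qed.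

Lemma htp_db (X Y : Db A) (f g : cmap X Y) : htp f g -> dm_eq (dm_map f) (dm_map g).
Proof. exact: (htp_dm_eq (@bounded_cone k A) (@bounded_sum k A)). Qed.

End BoundedBelow.

Section Isos.
Variables (k : fieldType) (A : gralg k) (P : cpx A -> Prop).
Implicit Types X Y Z : cpx_in P.

Lemma qiso_iso X Y (s : cmap X Y) : quasi_iso s -> dm_iso (dm_map s).
Proof. by move=> qs; exists (dm_inv qs); split; [exact: dm_invl | exact: dm_invr]. Qed.

Lemma iso_comp X Y Z (g : dmor Y Z) (f : dmor X Y) : dm_iso g -> dm_iso f -> dm_iso (dm_comp g f).
Proof.
move=> [g' [g1 g2]] [f' [f1 f2]]; exists (dm_comp f' g'); split.
  by rewrite -dm_assoc (dm_assoc g') g1 dm_idl.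
by rewrite -dm_assoc (dm_assoc f) f2 dm_idl.
Qed.

Lemma iso_eq X Y (f g : dmor X Y) : dm_eq f g -> dm_iso f -> dm_iso g.
Proof. by move=> e [f' [f1 f2]]; exists f'; rewrite -e. Qed.

Lemma iso_cancell X Y Z (f : dmor Y Z) (g h : dmor X Y) : dm_iso f ->
  dm_eq (dm_comp f g) (dm_comp f h) -> dm_eq g h.
Proof.
move=> [f' [e _]] efg; rewrite -(dm_idl g) -(dm_idl h) -e -!dm_assoc efg.
by [].
Qed.

Lemma iso_cancelr X Y Z (f : dmor X Y) (g h : dmor Y Z) : dm_iso f ->
  dm_eq (dm_comp g f) (dm_comp h f) -> dm_eq g h.
Proof.
move=> [f' [_ e]] efg; rewrite -(dm_idr g) -(dm_idr h) -e !dm_assoc efg.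
by [].
Qed.

End Isos.

(** * Morphisms into complexes of injectives *)

Section InjectiveTarget.
Variables (k : fieldType) (A : gralg k).
Variables (I : Dplus A).
Hypothesis hI : forall p, gm_injective (I p).

Lemma inj_extend (W W' : cpx A) (s : cmap W W') (u : cmap W I) : quasi_iso s ->
  exists v : cmap W' I, htp (cm_comp v s) u.
Proof. by case: (ci_in I) => a Ia qs; exact: qiso_extend qs Ia hI u. Qed.

Lemma inj_unique (W W' : cpx A) (s : cmap W W') (u v : cmap W' I) : quasi_iso s ->
  htp (cm_comp u s) (cm_comp v s) -> htp u v.
Proof. by case: (ci_in I) => a Ia qs; exact: qiso_unique qs Ia hI u v. Qed.

(* [pull f u v]: pulling the homotopy class of u : Y -> I back along the
   morphism f of the derived category gives the class of v : X -> I. *)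
Fixpoint pull (X Y : Dplus A) (f : dmor X Y) : cmap Y I -> cmap X I -> Prop :=
  match f in dmor X Y return cmap Y I -> cmap X I -> Prop with
  | dm_map X Y g => fun u v => htp v (cm_comp u g)
  | dm_inv X Y s _ => fun u v => htp (cm_comp v s) u
  | dm_comp X Y Z g f => fun u v => exists w, pull g u w /\ pull f w v
  end.

Lemma pull_total (X Y : Dplus A) (f : dmor X Y) u : exists v, pull f u v.
Proof.
elim: f u => {X Y} [X Y g|X Y s qs|X Y Z g IHg f IHf] u /=.
- by exists (cm_comp u g); exact: htp_ext.
- exact: inj_extend.
- by have [w hw] := IHg u; have [v hv] := IHf w; exists v, w.
Qed.

Lemma htp_refl (X Y : cpx A) (f : cmap X Y) : htp f f. Proof. exact: htp_ext. Qed.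

Lemma pull_resp (X Y : Dplus A) (f : dmor X Y) u u' v v' :
  pull f u v -> htp u u' -> htp v v' -> pull f u' v'.
Proof.
elim: f u u' v v' => {X Y} [X Y g|X Y s qs|X Y Z g IHg f IHf] u u' v v' /=.
- move=> h e e'; apply: htp_trans (htp_sym e') _; apply: htp_trans h _.
  by apply: htp_comp => //; exact: htp_refl.
- move=> h e e'; apply: htp_trans e; apply: htp_trans h.
  by apply: htp_comp; [exact: htp_sym | exact: htp_refl].
- move=> [w [h1 h2]] e e'; exists w; split; first by apply: IHg h1 e (htp_refl _).
  by apply: IHf h2 (htp_refl _) e'.
Qed.

Lemma cm_comp_id (X Y : cpx A) (f : cmap X Y) : htp (cm_comp f (cm_id X)) f.
Proof. by apply: htp_ext => p x; rewrite cm_compE cm_idE. Qed.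
Lemma cm_id_comp (X Y : cpx A) (f : cmap X Y) : htp (cm_comp (cm_id Y) f) f.
Proof. by apply: htp_ext => p x; rewrite cm_compE cm_idE. Qed.
Lemma cm_compA (X Y Z T : cpx A) (h : cmap Z T) (g : cmap Y Z) (f : cmap X Y) :
  htp (cm_comp h (cm_comp g f)) (cm_comp (cm_comp h g) f).
Proof. by apply: htp_ext => p x; rewrite !cm_compE. Qed.

(** Homotopy classes of maps into [I] form a functor on the localization: existence and uniqueness
    of extensions along quasi-isomorphisms settle the two relations for formal inverses. This is how
    an equality of formal composites yields a homotopy. *)
Lemma pull_eq (X Y : Dplus A) (f g : dmor X Y) : dm_eq f g ->
  forall u v, pull f u v <-> pull g u v.
Proof.
elim=> {X Y f g} /=.
- by [].
- by move=> X Y f g _ IH u v; split=> h; apply/IH.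
- by move=> X Y f g h _ IH1 _ IH2 u v; split=> [/IH1/IH2|/IH2/IH1].
- move=> X Y Z g g' f f' _ IHg _ IHf u v.
  by split=> -[w [/IHg h1 /IHf h2]]; exists w.
- move=> X Y Z T h g f u v; split.
    by move=> [w [h1 [w' [h2 h3]]]]; exists w'; split=> //; exists w.
  by move=> [w [[w' [h1 h2]] h3]]; exists w'; split=> //; exists w.
- move=> X Y f u v; split=> [[w [h1 h2]]|h].
    apply: pull_resp h2 _ (htp_refl _); apply: htp_trans h1 _; exact: cm_comp_id.
  by exists u; split=> //; apply: htp_sym; exact: cm_comp_id.
- move=> X Y f u v; split=> [[w [h1 h2]]|h].
    apply: pull_resp h1 (htp_refl _) _; apply: htp_sym; apply: htp_trans h2 _.
    exact: cm_comp_id.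
  by exists v; split=> //; apply: htp_sym; exact: cm_comp_id.
- move=> X Y f g e u v.
  have e' : htp (cm_comp u f) (cm_comp u g).
    by apply: htp_ext => p x; rewrite !cm_compE e.
  by split=> h; [apply: htp_trans h e' | apply: htp_trans h (htp_sym e')].
- move=> X Y Z g f u v; split=> [h|[w [h1 h2]]].
    exists (cm_comp u g); split; first exact: htp_refl.
    by apply: htp_trans h _; exact: cm_compA.
  apply: htp_trans h2 _; apply: htp_trans _ (htp_sym (cm_compA _ _ _)).
  by apply: htp_comp => //; exact: htp_refl.
- move=> X Y s qs u v; split=> [[w [h1 h2]]|h].
    apply: htp_trans h2 _; apply: htp_trans h1 _; apply: htp_sym; exact: cm_comp_id.
  have [w hw] := inj_extend u qs; exists w; split=> //.
  apply: htp_trans h _; apply: htp_trans (cm_comp_id _) _; exact: htp_sym.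
- move=> X Y s qs u v; split=> [[w [h1 h2]]|h].
    apply: htp_trans _ (htp_sym (cm_comp_id _)); apply: (inj_unique qs).
    by apply: htp_trans h2 h1.
  exists (cm_comp u s); split; first exact: htp_refl.
  apply: htp_comp; last exact: htp_refl.
  by apply: htp_trans h (cm_comp_id _).
Qed.

Lemma pull_dm (X Y : Dplus A) (f : dmor X Y) u v : pull f u v ->
  dm_eq (dm_comp (dm_map u) f) (dm_map v).
Proof.
elim: f u v => {X Y} [X Y g|X Y s qs|X Y Z g IHg f IHf] u v /=.
- by move/htp_plus => ->; rewrite dm_map_comp.
- by move/htp_plus => <-; rewrite dm_map_comp -dm_assoc dm_invr dm_idr.
- by move=> [w [/IHg e /IHf <-]]; rewrite dm_assoc e.
Qed.

Lemma dm_map_htp (X : Dplus A) (u v : cmap X I) :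
  dm_eq (dm_map u) (dm_map v) -> htp u v.
Proof.
move=> e; have h : pull (dm_map u) (cm_id I) u.
  by apply: htp_sym; exact: cm_id_comp.
have h' : pull (dm_map v) (cm_id I) u by apply/(pull_eq e).
by apply: htp_trans h' _; exact: cm_id_comp.
Qed.

Lemma represent (X : Dplus A) (f : dmor X I) : exists u, dm_eq f (dm_map u).
Proof.
have [v h] := pull_total f (cm_id I); exists v.
by rewrite -(pull_dm h) [dm_map _](_ : dm_map (cm_id I) = dm_id I) // dm_idl.
Qed.

Lemma pull_dmP (X Y : Dplus A) (f : dmor X Y) u v :
  pull f u v <-> dm_eq (dm_comp (dm_map u) f) (dm_map v).
Proof.
split; first exact: pull_dm.
move=> e; have [w h] := pull_total f u; apply: (pull_resp h (htp_refl _)).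
by apply: dm_map_htp; rewrite -e -(pull_dm h).
Qed.

Lemma pull_add (X Y : Dplus A) (f : dmor X Y) u u' v v' :
  pull f u v -> pull f u' v' -> pull f (cm_add u u') (cm_add v v').
Proof.
elim: f u u' v v' => {X Y} [X Y g|X Y s qs|X Y Z g IHg f IHf] u u' v v' /=.
- move=> h h'; apply: htp_trans (htp_add h h') _.
  by apply: htp_ext => p x; rewrite cm_addE !cm_compE cm_addE.
- move=> h h'; apply: htp_trans (htp_add h h').
  by apply: htp_ext => p x; rewrite cm_addE !cm_compE cm_addE.
- move=> [w [h1 h2]] [w' [h1' h2']]; exists (cm_add w w'); split; [exact: IHg|exact: IHf].
Qed.

Lemma add_comp (X Y : Dplus A) (f : dmor X Y) (u u' : cmap Y I) (v v' : cmap X I) :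
  dm_eq (dm_comp (dm_map u) f) (dm_map v) -> dm_eq (dm_comp (dm_map u') f) (dm_map v') ->
  dm_eq (dm_comp (dm_map (cm_add u u')) f) (dm_map (cm_add v v')).
Proof. by move=> /pull_dmP h /pull_dmP h'; apply/pull_dmP; exact: pull_add. Qed.

Section Sum.
Variables (Z Z' : Dplus A) (hS : bounded_below (cx_sum Z Z')).
Let S : Dplus A := CpxIn hS.
Definition sp1 : dmor S Z := dm_map (X := S) (cm_pr1 Z Z').
Definition sp2 : dmor S Z' := dm_map (X := S) (cm_pr2 Z Z').
Definition si1 : dmor Z S := dm_map (Y := S) (cm_in1 Z Z').
Definition si2 : dmor Z' S := dm_map (Y := S) (cm_in2 Z Z').

(** The localization is not given an addition; it is read off from chain maps into the injective
    [I]. Once [G] is a chain map, it is the sum of its restrictions along the two summands. *)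
Lemma sum_add (W : Dplus A) (F : dmor W S) (G : dmor S I) (a b : cmap W I) :
  dm_eq (dm_comp (dm_comp G si1) (dm_comp sp1 F)) (dm_map a) ->
  dm_eq (dm_comp (dm_comp G si2) (dm_comp sp2 F)) (dm_map b) ->
  dm_eq (dm_comp G F) (dm_map (cm_add a b)).
Proof.
move=> ea eb; have [u eu] := represent G.
pose u1 : cmap S I := cm_comp u (cm_comp (cm_in1 Z Z') (cm_pr1 Z Z')).
pose u2 : cmap S I := cm_comp u (cm_comp (cm_in2 Z Z') (cm_pr2 Z Z')).
have e1 : dm_eq (dm_map u1) (dm_comp (dm_comp G si1) sp1).
  by rewrite eu -dm_assoc /u1 dm_map_comp (dm_map_comp (Y := Z)).
have e2 : dm_eq (dm_map u2) (dm_comp (dm_comp G si2) sp2).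
  by rewrite eu -dm_assoc /u2 dm_map_comp (dm_map_comp (Y := Z')).
have -> : dm_eq G (dm_map (cm_add u1 u2)).
  rewrite eu; apply: dm_map_ext' => p x.
  rewrite cm_addE !cm_compE -lfunD; congr (u p _).
  rewrite /= pr1E pr2E in1E in2E; case: x => x y.
  by congr pair; rewrite /= ?addr0 ?add0r.
by apply: add_comp; rewrite ?e1 ?e2 -dm_assoc.
Qed.
End Sum.
End InjectiveTarget.

(** * Smart truncation and the embedding of Db into Dplus *)

Section SmartTruncation.
Variables (k : fieldType) (A : gralg k) (I : cpx A) (n : int).

Definition stV p : {vspace I p} :=
  if p < n then fullv else if p == n then lker (cx_d I p (p + 1)) else 0%VS.

Lemma stV_stable p : stable (stV p).
Proof.
rewrite /stV; case: ifP => _; first exact: stable_full.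
by case: ifP => _; [exact: stable_ker (cx_d_hom _ _ _) | exact: stable0].
Qed.

Lemma stV_d p q x : x \in stV p -> cx_d I p q x \in stV q.
Proof.
have [->|ne] := eqVneq q (p + 1); last by rewrite cx_d_deg // zero_lfunE mem0v.
rewrite /stV; case: ltrgtP => [lt _|gt|e].
- case: ltrgtP => [_|gt|_]; first exact: memvf.
    by exfalso; lia.
  by rewrite memv_ker ddE.
- by rewrite memv0 => /eqP ->; rewrite lfun0 mem0v.
- by rewrite memv_ker => /eqP ->; rewrite mem0v.
Qed.

Lemma stV_lt p x : p < n -> x \in stV p.
Proof. by move=> h; rewrite /stV h memvf. Qed.

Let inc p := sub_inc (stV_stable p).

Lemma sub_inc_injE (M : grmod A) (W : {vspace M}) (sW : stable W) x y :
  sub_inc sW x = sub_inc sW y -> x = y.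
Proof. by rewrite !sub_incE => /val_inj. Qed.

Let td p q := sub_lift (stV_stable q) (cx_d I p q \o inc p)%VF.

Let tdE p q x : inc q (td p q x) = cx_d I p q (inc p x).
Proof.
rewrite /td /inc sub_liftE ?comp_lfunE //; apply: stV_d; exact: sub_inc_mem.
Qed.

Definition strunc : cpx A.
Proof.
apply: (@Cpx _ _ (fun p => gm_sub (stV_stable p)) td) => [p q|p q ne|p q r].
- apply: sub_lift_hom => [|x].
    by apply: grhom_comp; [exact: cx_d_hom | exact: sub_inc_hom].
  by rewrite comp_lfunE; apply: stV_d; exact: sub_inc_mem.
- apply/lfunP => x; apply: (@sub_inc_injE _ _ (stV_stable q)).
  by rewrite -/(inc q) tdE cx_d_deg // !zero_lfunE lfun0.
- apply/lfunP => x; apply: (@sub_inc_injE _ _ (stV_stable r)).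
  by rewrite -/(inc r) comp_lfunE !tdE ddE zero_lfunE lfun0.
Defined.

Definition st_inc : cmap strunc I.
Proof.
apply: (@CMap _ _ strunc I inc) => [p|p q]; first exact: sub_inc_hom.
by apply/lfunP => x; rewrite comp_lfunE -(@tdE p q x) comp_lfunE.
Defined.

Lemma st_inc_inj p x y : st_inc p x = st_inc p y -> x = y.
Proof. exact: sub_inc_injE. Qed.

Lemma st_inc_mem p (x : strunc p) : st_inc p x \in stV p.
Proof. exact: sub_inc_mem. Qed.

Lemma st_inc_lift p y : y \in stV p -> exists x, st_inc p x = y.
Proof.
by move=> yV; exists (vsproj (stV p) y); rewrite /= /inc sub_incE vsprojK.
Qed.

Lemma strunc_above p : n < p -> gm_zero (strunc p).
Proof.
move=> np; apply: gm_zeroI => x; apply: st_inc_inj; rewrite lfun0.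
have := st_inc_mem x; rewrite /stV; case: ltrgtP np => // _ _.
by rewrite memv0 => /eqP.
Qed.

Lemma strunc_bounded : bounded_below I -> bounded strunc.
Proof.
move=> [a h]; exists a, n => p /orP[pa|]; last exact: strunc_above.
by apply: gm_zeroI => x; apply: st_inc_inj; rewrite (gm_zeroE (h _ pa) (st_inc p x)) lfun0.
Qed.

Lemma st_factor (X : cpx A) (f : cmap X I) : (forall p, n < p -> gm_zero (X p)) ->
  exists g : cmap X strunc, forall p x, st_inc p (g p x) = f p x.
Proof.
move=> Xn; have fV p x : f p x \in stV p.
  rewrite /stV; case: ltrgtP => [_|gt|e]; first exact: memvf.
    by rewrite (gm_zeroE (Xn _ gt) x) lfun0 mem0v.
  rewrite memv_ker cmE; have X0 : gm_zero (X (p + 1)) by apply: Xn; rewrite e; lia.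
  by rewrite (gm_zeroE X0 (cx_d X p (p + 1) x)) lfun0.
have [||g gE] := @cmap_of _ _ X strunc (fun p => sub_lift (stV_stable p) (f p)).
- by move=> p; apply: sub_lift_hom => //; exact: cm_hom.
- move=> p q _ x; apply: st_inc_inj.
  by rewrite -cmE /= /inc !sub_liftE // cmE.
by exists g => p x; rewrite gE /= /inc sub_liftE.
Qed.

(** As X vanishes above [n], the components of a homotopy that matter land in degrees < n, where the
    truncation is all of I. *)
Lemma st_htp (X : cpx A) (f g : cmap X strunc) : (forall p, n < p -> gm_zero (X p)) ->
  htp (cm_comp st_inc f) (cm_comp st_inc g) -> htp f g.
Proof.
move=> Xn [h [hh hE]].
exists (fun p q => if p == q + 1 then sub_lift (stV_stable q) (h p q) else 0).
have hV p q x : p = q + 1 -> h p q x \in stV q.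
  move=> e; have [np|pn] := ltrP n p; first by rewrite (gm_zeroE (Xn _ np) x) lfun0 mem0v.
  by apply: stV_lt; lia.
have hom p q : p = q + 1 -> is_grhom (sub_lift (stV_stable q) (h p q)).
  by move=> e; apply: sub_lift_hom => // x; exact: hV.
split=> [p q|p q r e1 e2 x].
  by case: eqP => [e|_]; [exact: hom | exact: grhom0].
apply: st_inc_inj; have := hE p q r e1 e2 x; rewrite !cm_compE lfunB => ->.
rewrite lfunD -cmE; move/eqP: (e1) => ->; move/eqP: (e2) => ->.
by rewrite /= /inc !sub_liftE // hV.
Qed.

Lemma st_qiso (Y : cpx A) (i : cmap Y I) (i' : cmap Y strunc) :
  (forall p, n < p -> gm_zero (Y p)) -> (forall p x, st_inc p (i' p x) = i p x) ->
  quasi_iso i -> quasi_iso i'.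
Proof.
move=> Yn e qi p; have [inj sur] := qi p; split=> [x dx [y iy]|y dy].
  by apply: inj => //; exists (st_inc (p - 1) y); rewrite -e iy cmE.
have [np|pn] := ltrP n p.
  by exists 0, 0; rewrite !lfun0; split=> //; exact: gm_zero_eq (strunc_above np) _ _.
have [|x [w [dx ew]]] := sur (st_inc p y); first by rewrite cmE dy lfun0.
have [w' w'E] : exists w', st_inc (p - 1) w' = w by apply: st_inc_lift; apply: stV_lt; lia.
exists x, w'; split=> //; apply: st_inc_inj.
by rewrite lfunD e -cmE w'E.
Qed.

End SmartTruncation.

Section BoundedDerived.
Variables (k : fieldType) (A : gralg k) (A0 Aneg Apos : grsub A).
Hypothesis hA : semi_infinite_data A0 Aneg Apos.

Lemma dm_incl_eq (X Y : Db A) (f g : dmor X Y) : dm_eq f g -> dm_eq (dm_incl f) (dm_incl g).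
Proof.
elim=> {X Y f g} /=.
- by [].
- by move=> X Y f g _ IH; apply: dm_sym.
- by move=> X Y f g h _ IH1 _ IH2; exact: dm_trans IH1 IH2.
- by move=> X Y Z g g' f f' _ IHg _ IHf; exact: dm_congr.
- by move=> *; exact: dm_assoc.
- by move=> *; exact: dm_idl.
- by move=> *; exact: dm_idr.
- by move=> X Y f g e; exact: dm_map_ext.
- by move=> *; exact: (dm_map_comp (X := db_incl _) (Y := db_incl _) (Z := db_incl _)).
- by move=> X Y s qs; exact: (dm_invl (X := db_incl X) (Y := db_incl Y)).
- by move=> X Y s qs; exact: (dm_invr (X := db_incl X) (Y := db_incl Y)).
Qed.

Lemma dplus_resolution (Y : Dplus A) : exists (I : Dplus A) (i : cmap Y I),
  quasi_iso i /\ inj_cpx Aneg Apos I.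
Proof.
have [a Ya] := ci_in Y; have [I [i [qi Ia iI]]] := injective_resolution hA Ya.
have hb : bounded_below I by exists a.
by exists (CpxIn hb), i.
Qed.

Definition above (X : cpx A) (n : int) := forall p, n < p -> gm_zero (X p).

Lemma db_above (X : Db A) : exists N, forall n, N <= n -> above X n.
Proof.
have [a [b h]] := ci_in X; exists b => n bn p np; apply: h.
by rewrite (le_lt_trans bn np) orbT.
Qed.

(** A formal composite passes through finitely many bounded complexes. Once [n] exceeds the bounds
    of those involved, extensions along quasi-isomorphisms take place inside the truncation, hence
    in Db. The bound depends on [f] alone, so it is fixed before [I] and [u]. *)
Lemma db_represent (X Y : Db A) (f : dmor X Y) : exists N, forall n, N <= n ->
  forall (I : Dplus A) (hI : forall p, gm_injective (I p))
    (hT : bounded (strunc I n)) (u : cmap Y (strunc I n)),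
  exists v : cmap X (strunc I n),
    dm_eq (dm_comp (dm_map (Y := CpxIn hT) u) f) (dm_map (Y := CpxIn hT) v).
Proof.
elim: f => {X Y} [X Y g|X Y s qs|X Y Z g [N1 H1] f [N2 H2]].
- exists 0 => n _ I hI hT u; exists (cm_comp u g).
  by rewrite (dm_map_comp (Z := CpxIn hT)).
- have [N1 h1] := db_above X; have [N2 h2] := db_above Y.
  exists (Num.max N1 N2) => n; rewrite ge_max => /andP[n1 n2] I hI hT u.
  have [w hw] := inj_extend hI (cm_comp (st_inc I n) u) qs.
  have [v vE] := st_factor w (h2 _ n2).
  exists v; have e : htp (cm_comp v s) u.
    apply: (st_htp (h1 _ n1)); apply: htp_trans hw.
    by apply: htp_ext => p x; rewrite !cm_compE vE.
  have <- := htp_db (X := X) (Y := CpxIn hT) e.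
  by rewrite (dm_map_comp (Z := CpxIn hT)) -dm_assoc dm_invr dm_idr.
- exists (Num.max N1 N2) => n; rewrite ge_max => /andP[n1 n2] I hI hT u.
  have [w hw] := H1 _ n1 _ hI hT u; have [v hv] := H2 _ n2 _ hI hT w.
  by exists v; rewrite dm_assoc hw.
Qed.

Lemma trunc_resolution (Y : Db A) (n : int) : above Y n ->
  exists (I : Dplus A) (hT : bounded (strunc I n)) (i : cmap Y I) (i' : cmap Y (strunc I n)),
  [/\ forall p, gm_injective (I p), quasi_iso i, quasi_iso i'
    & forall p x, st_inc I n p (i' p x) = i p x].
Proof.
move=> Yn; have [I [i [qi iI]]] := dplus_resolution (db_incl Y).
have [i' i'E] := st_factor i Yn.
exists I, (strunc_bounded n (ci_in I)), i, i'; split=> //; first by move=> p; case: (iI p).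
exact: st_qiso i'E qi.
Qed.

(** A morphism to Y in Dplus becomes a chain map X -> I into an injective resolution of Y. As X is
    bounded, it factors through a smart truncation of I that is bounded and still quasi-isomorphic
    to Y. *)
Lemma db_full (X Y : Db A) (f : dmor (db_incl X) (db_incl Y)) :
  exists g : dmor X Y, dm_eq (dm_incl g) f.
Proof.
have [N1 h1] := db_above X; have [N2 h2] := db_above Y.
pose n := Num.max N1 N2.
have Xn : above X n by apply: h1; rewrite le_max lexx.
have Yn : above Y n by apply: h2; rewrite le_max lexx orbT.
have [I [hT [i [i' [hI qi qi' i'E]]]]] := trunc_resolution Yn.
have [u eu] := represent hI (dm_comp (dm_map (X := db_incl Y) i) f).
have [u' u'E] := st_factor u Xn.
exists (dm_comp (dm_inv (X := Y) (Y := CpxIn hT) qi') (dm_map (X := X) (Y := CpxIn hT) u')) => /=.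
apply: (iso_cancell (qiso_iso (X := db_incl Y) (Y := I) qi)); rewrite eu.
pose T : Dplus A := db_incl (CpxIn hT); pose j : cmap T I := st_inc I n.
transitivity (dm_comp (dm_map j) (dm_map (X := db_incl X) (Y := T) u')).
  have -> : dm_eq (dm_map (X := db_incl Y) i) (dm_comp (dm_map j) (dm_map (X := db_incl Y) (Y := T) i')).
    by rewrite -dm_map_comp; apply: dm_map_ext' => p x; rewrite cm_compE i'E.
  rewrite dm_assoc -(dm_assoc (dm_map j)) (dm_invr (X := db_incl Y) (Y := T)) dm_idr.
  by [].
by rewrite -dm_map_comp; apply: dm_map_ext' => p x; rewrite cm_compE u'E.
Qed.

(** Both morphisms become, already in Db, chain maps into a truncated resolution of Y. Equality in
    Dplus makes them homotopic in I, and [st_htp] brings the homotopy back into the truncation. *)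
Lemma db_faithful (X Y : Db A) (f g : dmor X Y) :
  dm_eq (dm_incl f) (dm_incl g) -> dm_eq f g.
Proof.
move=> e; have [N1 h1] := db_above X; have [N2 h2] := db_above Y.
have [N3 h3] := db_represent f; have [N4 h4] := db_represent g.
pose n := Num.max (Num.max N1 N2) (Num.max N3 N4).
have Xn : above X n by apply: h1; rewrite /n !le_max lexx.
have Yn : above Y n by apply: h2; rewrite /n !le_max lexx orbT.
have [I [hT [i [i' [hI qi qi' i'E]]]]] := trunc_resolution Yn.
have [|u eu] := h3 n _ _ hI hT i'; first by rewrite /n !le_max lexx !orbT.
have [|v ev] := h4 n _ _ hI hT i'; first by rewrite /n !le_max lexx !orbT.
apply: (iso_cancell (qiso_iso (X := Y) (Y := CpxIn hT) qi')); rewrite eu ev.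
apply: htp_db; apply: (st_htp Xn); apply: (dm_map_htp hI (X := db_incl X)).
pose T : Dplus A := db_incl (CpxIn hT); pose j : cmap T I := st_inc I n.
rewrite !(dm_map_comp (X := db_incl X) (Y := T) (Z := I)).
have := dm_incl_eq eu; have := dm_incl_eq ev; rewrite /= => <- <-.
by rewrite e.
Qed.

(** After Z and Z' are replaced by truncated injective resolutions, [f] and [f'] are chain maps, and
    chain maps can be paired. *)
Lemma db_pair (X Z Z' : Db A) (f : dmor X Z) (f' : dmor X Z') :
  exists F : dmor X (db_sum Z Z'),
    dm_eq (dm_comp (db_pr1 Z Z') F) f /\ dm_eq (dm_comp (db_pr2 Z Z') F) f'.
Proof.
have [N h] := db_represent f; have [N' h'] := db_represent f'.
have [N2 h2] := db_above Z; have [N2' h2'] := db_above Z'.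
pose n := Num.max (Num.max N N') (Num.max N2 N2').
have Zn : above Z n by apply: h2; rewrite /n !le_max lexx !orbT.
have Zn' : above Z' n by apply: h2'; rewrite /n !le_max lexx !orbT.
have [I [hT [i [i' [hI _ qi _]]]]] := trunc_resolution Zn.
have [J [hU [j [j' [hJ _ qj _]]]]] := trunc_resolution Zn'.
have [|u eu] := h n _ _ hI hT i'; first by rewrite /n !le_max lexx.
have [|v ev] := h' n _ _ hJ hU j'; first by rewrite /n !le_max lexx orbT.
pose T : Db A := CpxIn hT; pose U : Db A := CpxIn hU.
pose F p : 'Hom(X p, db_sum T U p) := ((in1 (T p) (U p) \o u p) + (in2 (T p) (U p) \o v p))%VF.
have FE p x : F p x = (u p x, v p x).
  by rewrite add_lfunE !comp_lfunE in1E in2E; congr pair; rewrite /= ?addr0 ?add0r.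
have [||w wE] := @cmap_of _ _ X (db_sum T U) F.
- by move=> p; apply: grhomD; [exact: grhom_comp (in1_grhom _ _) (cm_hom u p)|exact: grhom_comp (in2_grhom _ _) (cm_hom v p)].
- by move=> p q _ x; rewrite sumE !FE; congr pair; exact: cmE.
have wE' p x : w p x = (u p x, v p x) by rewrite wE.
pose F2 p : 'Hom(db_sum Z Z' p, db_sum T U p) :=
  ((in1 (T p) (U p) \o i' p \o pr1 _ _) + (in2 (T p) (U p) \o j' p \o pr2 _ _))%VF.
have F2E p x : F2 p x = (i' p x.1, j' p x.2).
  by rewrite add_lfunE !comp_lfunE pr1E pr2E in1E in2E; congr pair; rewrite /= ?addr0 ?add0r.
have [||s sE] := @cmap_of _ _ (db_sum Z Z') (db_sum T U) F2.
- move=> p; apply: grhomD.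
    exact: grhom_comp (grhom_comp (in1_grhom _ _) (cm_hom i' p)) (pr1_grhom _ _).
  exact: grhom_comp (grhom_comp (in2_grhom _ _) (cm_hom j' p)) (pr2_grhom _ _).
- by move=> p q _ x; rewrite !sumE !F2E; congr pair; exact: cmE.
have sE' p x : s p x = (i' p x.1, j' p x.2) by rewrite sE.
have qs : quasi_iso s.
  move=> p; have [inj1 sur1] := qi p; have [inj2 sur2] := qj p; split=> [x|y].
    rewrite sumE => -[d1 d2] [y]; rewrite sE' sumE => -[e1 e2].
    have [|y1 y1E] := inj1 _ d1; first by exists y.1.
    have [|y2 y2E] := inj2 _ d2; first by exists y.2.
    by exists (y1, y2); rewrite sumE /= -y1E -y2E; case: x {d1 d2 e1 e2 y1E y2E}.
  rewrite sumE => -[d1 d2]; have [x1 [w1 [dx1 e1]]] := sur1 _ d1.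
  have [x2 [w2 [dx2 e2]]] := sur2 _ d2.
  exists (x1, x2), (w1, w2); rewrite !sumE sE' /= dx1 dx2; split=> //.
  by case: y e1 e2 {d1 d2} => y1 y2 /= -> ->.
exists (dm_comp (dm_inv (X := db_sum Z Z') (Y := db_sum T U) qs) (dm_map (X := X) (Y := db_sum T U) w)).
split.
- apply: (iso_cancell (qiso_iso (X := Z) (Y := T) qi)); rewrite eu !dm_assoc.
  have -> : dm_eq (dm_comp (dm_map (Y := T) i') (db_pr1 Z Z'))
     (dm_comp (db_pr1 T U) (dm_map (X := db_sum Z Z') (Y := db_sum T U) s)).
    rewrite -!dm_map_comp; apply: dm_map_ext' => p x.
    by rewrite !cm_compE sE' !cm_pr1E.
  rewrite -(dm_assoc (db_pr1 T U)) dm_invr dm_idr -dm_map_comp.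
  by apply: dm_map_ext' => p x; rewrite cm_compE wE' cm_pr1E.
- apply: (iso_cancell (qiso_iso (X := Z') (Y := U) qj)); rewrite ev !dm_assoc.
  have -> : dm_eq (dm_comp (dm_map (Y := U) j') (db_pr2 Z Z'))
     (dm_comp (db_pr2 T U) (dm_map (X := db_sum Z Z') (Y := db_sum T U) s)).
    rewrite -!dm_map_comp; apply: dm_map_ext' => p x.
    by rewrite !cm_compE sE' !cm_pr2E.
  rewrite -(dm_assoc (db_pr2 T U)) dm_invr dm_idr -dm_map_comp.
  by apply: dm_map_ext' => p x; rewrite cm_compE wE' cm_pr2E.
Qed.

Lemma db_copair (Z Z' Y : Db A) (g : dmor Z Y) (g' : dmor Z' Y) :
  exists G : dmor (db_sum Z Z') Y,
    dm_eq (dm_comp G (db_in1 Z Z')) g /\ dm_eq (dm_comp G (db_in2 Z Z')) g'.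
Proof.
have [N h] := db_represent g; have [N' h'] := db_represent g'.
have [N2 h2] := db_above Y.
pose n := Num.max (Num.max N N') N2.
have Yn : above Y n by apply: h2; rewrite /n !le_max lexx !orbT.
have [I [hT [i [i' [hI _ qi _]]]]] := trunc_resolution Yn.
have [|u eu] := h n _ _ hI hT i'; first by rewrite /n !le_max lexx.
have [|v ev] := h' n _ _ hI hT i'; first by rewrite /n !le_max lexx orbT.
pose T : Db A := CpxIn hT.
pose w : cmap (db_sum Z Z') T := cm_add (cm_comp u (cm_pr1 Z Z')) (cm_comp v (cm_pr2 Z Z')).
exists (dm_comp (dm_inv (X := Y) (Y := T) qi) (dm_map (X := db_sum Z Z') w)).
split; apply: (iso_cancell (qiso_iso (X := Y) (Y := T) qi));
  rewrite ?eu ?ev !dm_assoc dm_invr dm_idl -dm_map_comp; apply: dm_map_ext' => p x;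
  rewrite cm_compE cm_addE !cm_compE cm_pr1E cm_pr2E ?cm_in1E ?cm_in2E.
- by rewrite lfun0 addr0.
- by rewrite lfun0 add0r.
Qed.

End BoundedDerived.

(** * Brutal truncation *)

Section BrutalTruncation.
Variables (k : fieldType) (A : gralg k) (J : cpx A) (S : pred int).

Definition btob p : grmod A := if S p then J p else gm0 A.

Definition bt_prj p : 'Hom(J p, btob p) :=
  if S p as b return 'Hom(J p, if b then J p else gm0 A) then \1%VF else 0.

Definition bt_inj p : 'Hom(btob p, J p) :=
  if S p as b return 'Hom(if b then J p else gm0 A, J p) then \1%VF else 0.

Lemma bt_prj_hom p : is_grhom (bt_prj p).
Proof. by rewrite /bt_prj /btob; case: (S p); [exact: grhom1 | exact: grhom0]. Qed.
Lemma bt_inj_hom p : is_grhom (bt_inj p).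
Proof. by rewrite /bt_inj /btob; case: (S p); [exact: grhom1 | exact: grhom0]. Qed.

Lemma btob_out p : ~~ S p -> gm_zero (btob p).
Proof. by rewrite /btob => /negbTE ->; exact: gm0_zero. Qed.

Lemma btob_zero p : gm_zero (J p) -> gm_zero (btob p).
Proof. by rewrite /btob; case: (S p) => // _; exact: gm0_zero. Qed.

Lemma bt_injK p x : bt_prj p (bt_inj p x) = x.
Proof.
case: (boolP (S p)) => [Sp|/btob_out h]; last exact: gm_zero_eq h _ _.
move: x; rewrite /bt_prj /bt_inj /btob; case: (S p) Sp => // _ x.
by rewrite !id_lfunE.
Qed.

Lemma bt_prjK p x : S p -> bt_inj p (bt_prj p x) = x.
Proof. by move: x; rewrite /bt_prj /bt_inj /btob; case: (S p) => // x _; rewrite !id_lfunE. Qed.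

Lemma bt_inj_inj p x y : bt_inj p x = bt_inj p y -> x = y.
Proof. by move/(congr1 (bt_prj p)); rewrite !bt_injK. Qed.

Definition btd p q : 'Hom(btob p, btob q) := (bt_prj q \o cx_d J p q \o bt_inj p)%VF.

Lemma btdE p q x : btd p q x = bt_prj q (cx_d J p q (bt_inj p x)).
Proof. by rewrite /btd !comp_lfunE. Qed.

(** Any set [S] of degrees gives a complex: a composite of two differentials passes through one
    intermediate degree, which is either kept whole or zero. The projection from J is a chain map
    when [S] is closed downwards. *)
Definition btr : cpx A.
Proof.
apply: (@Cpx _ _ btob btd) => [p q|p q ne|p q r].
- exact: grhom_comp (grhom_comp (bt_prj_hom q) (cx_d_hom _ _ _)) (bt_inj_hom p).
- by apply/lfunP => x; rewrite btdE cx_d_deg // !zero_lfunE lfun0.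
- apply/lfunP => x; rewrite comp_lfunE !btdE zero_lfunE.
  case: (boolP (S q)) => [Sq|/btob_out h]; first by rewrite bt_prjK // ddE lfun0.
  by rewrite (gm_zeroE h (bt_prj q _)) !lfun0.
Defined.

Lemma btrE p q x : cx_d btr p q x = bt_prj q (cx_d J p q (bt_inj p x)).
Proof. exact: btdE. Qed.

Lemma btr_injective_over (U : grsub A) p : injective_over U (J p) -> injective_over U (btr p).
Proof. by rewrite /= /btob; case: (S p) => // _; apply: gm_zero_res; exact: gm0_zero. Qed.

Lemma btr_prj_cm : (forall p, S (p + 1) -> S p) ->
  exists f : cmap J btr, forall p x, f p x = bt_prj p x.
Proof.
move=> Sd; have [||f fE] := @cmap_of _ _ J btr bt_prj; first exact: bt_prj_hom.
  move=> p q -> x; rewrite btrE.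
  case: (boolP (S (p + 1))) => [/Sd Sp|/btob_out h]; first by rewrite bt_prjK.
  exact: gm_zero_eq h _ _.
by exists f => p x; rewrite fE.
Qed.

End BrutalTruncation.

Section BijQiso.
Variables (k : fieldType) (A : gralg k).

Lemma bij_qiso (X Y : cpx A) (f : cmap X Y) (g : forall p, Y p -> X p) :
  (forall p x, g p (f p x) = x) -> (forall p y, f p (g p y) = y) -> quasi_iso f.
Proof.
move=> gf fg p; have finj q x y : f q x = f q y -> x = y by move/(congr1 (g q)); rewrite !gf.
split=> [x dx [y fy]|y dy].
  by exists (g _ y); apply: finj; rewrite fy -cmE fg.
exists (g p y), 0; split; last by rewrite fg lfun0 addr0.
by apply: finj; rewrite -cmE fg dy lfun0.
Qed.

Lemma recastK (X : int -> grmod A) p q x : p = q -> recast X q p (recast X p q x) = x.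
Proof. by move=> e; subst q; rewrite !recastE. Qed.

Lemma recast_d (X : cpx A) p q p' q' x : p = p' -> q = q' ->
  cx_d X p' q' (recast X p p' x) = recast X q q' (cx_d X p q x).
Proof. by move=> e e'; subst p' q'; rewrite !recastE. Qed.

Variable (U : grsub A).

Lemma dsemi_map (X Y : Db A) (f : cmap X Y) : quasi_iso f -> Dsemi U X -> Dsemi U Y.
Proof. by move=> qf; apply: (Dsemi_iso (f := dm_map f)); exact: qiso_iso. Qed.

(** Q is Q[i][-i] up to the transport from degree p - i + i to p. *)
Lemma dsemi_shift_back (i : int) (Q : Db A) : Dsemi U (db_shift i Q) -> Dsemi U Q.
Proof.
move=> h; have e p : p + - i + i = p by rewrite subrK.
have u : (-1) ^ (- i) * (-1) ^ i = 1 :> k.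
  by rewrite -expfzDr ?addNr ?expr0z // oppr_eq0 oner_eq0.
have [||f fE] := @cmap_of _ _ (db_shift (- i) (db_shift i Q)) Q (fun p => recast Q (p + - i + i) p).
- by move=> p; exact: (@recast_hom _ _ Q (p + - i + i) p).
- move=> p q _ x; rewrite (recast_d _ (e p) (e q)); congr (recast _ _ _ _).
  by rewrite /= !scale_lfunE scalerA u scale1r.
apply: (@dsemi_map (db_shift (- i) (db_shift i Q)) Q f _ (Dsemi_shift _ h)).
apply: (@bij_qiso (db_shift (- i) (db_shift i Q)) Q f (fun p => recast Q p (p + - i + i))) => p x.
  by rewrite fE recastK.
by rewrite fE; apply: recastK.
Qed.

(** The cone of the zero map Z -> Z'[1] is (Z (+) Z')[1], with the same modules in every degree. *)
Lemma dsemi_sum (Z Z' : Db A) : Dsemi U Z -> Dsemi U Z' -> Dsemi U (db_sum Z Z').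
Proof.
move=> hZ hZ'; apply: (@dsemi_shift_back 1).
have [||o oE] := @cmap_of _ _ Z (db_shift 1 Z') (fun p => 0).
- by move=> p; exact: grhom0.
- by move=> p q _ x; rewrite !zero_lfunE lfun0.
have [||f fE] := @cmap_of _ _ (db_cone (Y := db_shift 1 Z') o) (db_shift 1 (db_sum Z Z')) (fun p => \1%VF).
- move=> p; split=> [a v|n v]; first by rewrite !id_lfunE.
  by rewrite id_lfunE.
- move=> p q -> x; rewrite !id_lfunE coneE oE zero_lfunE add0r.
  rewrite /= expr1z !scale_lfunE sum_dE !scaleN1r.
  by [].
apply: (@dsemi_map _ (db_shift 1 (db_sum Z Z')) f _ (Dsemi_cone _ hZ (Dsemi_shift 1 hZ'))).
by apply: (@bij_qiso (db_cone (Y := db_shift 1 Z') o) (db_shift 1 (db_sum Z Z')) f (fun p => id)) => p x;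
  rewrite fE id_lfunE.
Qed.

Lemma bounded_btr (Q : Db A) (S : pred int) : bounded (btr Q S).
Proof. by have [a [b h]] := ci_in Q; exists a, b => p /h; exact: btob_zero. Qed.

Lemma dsemi_one (b : int) (Q : Db A) : injective_over U (Q b) ->
  (forall p, p != b -> gm_zero (Q p)) -> Dsemi U Q.
Proof.
move=> ib Q0; apply: (@dsemi_shift_back b); apply: Dsemi_module => [p p0|] /=.
  by apply: Q0; apply: contra_neq p0 => e; lia.
by rewrite add0r.
Qed.

(** The top term is split off: if [b] is the top degree, Q[1] is isomorphic to the cone of the map
    Q_(<b) -> Q_b[1] given by the differential. The induction is on the length of an interval
    outside which Q vanishes. *)
Lemma dsemi_bounded (Q : Db A) : (forall p, injective_over U (Q p)) -> Dsemi U Q.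
Proof.
suff H (N : nat) : forall (a : int) (Q : Db A), (forall p, injective_over U (Q p)) ->
    (forall p, (p < a) || (a + N%:Z <= p) -> gm_zero (Q p)) -> Dsemi U Q.
  move=> iQ; have [a [b h]] := ci_in Q; apply: (H (absz (b - a + 1)) a) => // p hp.
  by apply: h; move: hp; lia.
elim: N => {Q} [|N IH] a Q iQ Q0.
  by apply: (@dsemi_one a) => // p _; apply: Q0; lia.
pose b := a + N%:Z.
pose S1 : pred int := fun p => p < b; pose S2 : pred int := fun p => p == b.
pose Q1 : Db A := CpxIn (bounded_btr Q S1); pose Q2 : Db A := CpxIn (bounded_btr Q S2).
have h1 : Dsemi U Q1.
  apply: (IH a) => [p|p]; first exact: btr_injective_over.
  have [pb hp|bp _] := ltrP p b; last by apply: btob_out; rewrite /S1 -leNgt.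
  by apply: btob_zero; apply: Q0; lia.
have h2 : Dsemi U Q2.
  apply: (@dsemi_one b) => [|p pb]; first exact: btr_injective_over.
  exact: btob_out.
have dQ1 p q x : cx_d Q1 p q x = bt_prj Q S1 q (cx_d Q p q (bt_inj Q S1 p x)) by exact: btrE.
have [||g gE] := @cmap_of _ _ Q1 (db_shift 1 Q2) (fun p => (bt_prj Q S2 (p + 1) \o cx_d Q p (p + 1) \o bt_inj Q S1 p)%VF).
- move=> p; exact: grhom_comp (grhom_comp (bt_prj_hom _ _ _) (cx_d_hom _ _ _)) (bt_inj_hom _ _ _).
- move=> p q -> x; rewrite dQ1 !comp_lfunE.
  case: (boolP (S2 (p + 1 + 1))) => [/eqP e|/(@btob_out _ _ Q) h]; last exact: gm_zero_eq h _ _.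
  have np : ~~ S2 (p + 1) by rewrite /S2; lia.
  have -> : bt_prj Q S2 (p + 1) (cx_d Q p (p + 1) (bt_inj Q S1 p x)) = 0.
    exact: gm_zeroE (btob_out Q np) _.
  rewrite lfun0 bt_prjK ?ddE ?lfun0 //.
  by rewrite /S1; lia.
apply: (@dsemi_shift_back 1).
pose C := db_cone (Y := db_shift 1 Q2) g.
(* The differential of Q[1] is - d, while the cone maps its first summand by - d to itself and by +
   g to the second; the sign on the second summand reconciles them. *)
pose F p : 'Hom(C p, db_shift 1 Q p) :=
    ((bt_inj Q S1 (p + 1) \o pr1 (Q1 (p + 1)) (Q2 (p + 1))) + (bt_inj Q S2 (p + 1) \o - pr2 (Q1 (p + 1)) (Q2 (p + 1))))%VF.
have FE p z : F p z = bt_inj Q S1 (p + 1) z.1 - bt_inj Q S2 (p + 1) z.2.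
  by rewrite add_lfunE !comp_lfunE opp_lfunE pr1E pr2E lfunN.
have gE' p x : g p x = bt_prj Q S2 (p + 1) (cx_d Q p (p + 1) (bt_inj Q S1 p x)).
  by rewrite gE !comp_lfunE.
have [||f fE] := @cmap_of _ _ C (db_shift 1 Q) F.
- move=> p; apply: grhomD; first exact: grhom_comp (bt_inj_hom _ _ _) (pr1_grhom _ _).
  exact: grhom_comp (bt_inj_hom _ _ _) (grhomN (pr2_grhom _ _)).
- move=> p q -> x.
  have dQ (y : Q (p + 1)) : cx_d (db_shift 1 Q) p (p + 1) y = - cx_d Q (p + 1) (p + 1 + 1) y.
    by rewrite /= expr1z scale_lfunE scaleN1r.
  have dQ2 (y : Q2 (p + 1)) : cx_d (db_shift 1 Q2) p (p + 1) y = 0.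
    apply: (@bt_inj_inj _ _ Q S2); rewrite lfun0.
    have [e|ne] := eqVneq (p + 1) b; last first.
      by rewrite (gm_zeroE (btob_out Q (ne : ~~ S2 _)) y) !lfun0.
    have ne : ~~ S2 (p + 1 + 1) by rewrite /S2; lia.
    by rewrite (gm_zeroE (btob_out Q ne) (cx_d (db_shift 1 Q2) _ _ y)) lfun0.
  rewrite coneE dQ dQ2 addr0 !FE [in RHS]/= gE' dQ1 !lfunN -opprD; congr (- _).
  rewrite lfunB.
  have -> : cx_d Q (p + 1) (p + 1 + 1) (bt_inj Q S2 (p + 1) x.2) = 0.
    have [e|ne] := eqVneq (p + 1) b; last first.
      by rewrite (gm_zeroE (btob_out Q (ne : ~~ S2 _)) x.2) !lfun0.
    have Qz : gm_zero (Q (p + 1 + 1)) by apply: Q0; lia.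
    exact: gm_zeroE Qz _.
  rewrite subr0; set y := cx_d Q (p + 1) (p + 1 + 1) _.
  have [lt|gt|e] := ltrgtP (p + 1 + 1) b.
  - have -> : bt_prj Q S2 (p + 1 + 1) y = 0.
      by apply: gm_zeroE; apply: btob_out; rewrite /S2; lia.
    by rewrite lfun0 addr0 bt_prjK.
  - have Qz : gm_zero (Q (p + 1 + 1)) by apply: Q0; lia.
    exact: gm_zero_eq Qz _ _.
  - have -> : bt_prj Q S1 (p + 1 + 1) y = 0.
      by apply: gm_zeroE; apply: btob_out; rewrite /S1; lia.
    by rewrite lfun0 add0r bt_prjK // /S2 e.
apply: (@dsemi_map C (db_shift 1 Q) f _ (Dsemi_cone _ h1 (Dsemi_shift 1 h2))).
apply: (@bij_qiso C (db_shift 1 Q) f (fun p (y : Q (p + 1)) => (bt_prj Q S1 (p + 1) y, - bt_prj Q S2 (p + 1) y) : C p)) => p x.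
  rewrite fE FE !lfunB !bt_injK.
  have -> : bt_prj Q S1 (p + 1) (bt_inj Q S2 (p + 1) x.2) = 0.
    have [e|ne] := eqVneq (p + 1) b; last by rewrite (gm_zeroE (btob_out Q (ne : ~~ S2 _)) x.2) !lfun0.
    by apply: gm_zeroE; apply: btob_out; rewrite /S1 e ltxx.
  have -> : bt_prj Q S2 (p + 1) (bt_inj Q S1 (p + 1) x.1) = 0.
    case: (boolP (S1 (p + 1))) => h; last by rewrite (gm_zeroE (btob_out Q h) x.1) !lfun0.
    by apply: gm_zeroE; apply: btob_out; move: h; rewrite /S1 /S2; lia.
  by rewrite subr0 sub0r opprK; case: x.
rewrite fE FE /= lfunN opprK.
have [lt|gt|e] := ltrgtP (p + 1) b.
- have -> : bt_prj Q S2 (p + 1) x = 0.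
    by apply: gm_zeroE; apply: btob_out; rewrite /S2; lia.
  by rewrite lfun0 addr0 bt_prjK.
- have Qz : gm_zero (Q (p + 1)) by apply: Q0; lia.
  exact: gm_zero_eq Qz _ _.
- have -> : bt_prj Q S1 (p + 1) x = 0.
    by apply: gm_zeroE; apply: btob_out; rewrite /S1; lia.
  by rewrite lfun0 add0r bt_prjK // /S2 e.
Qed.

End BijQiso.

(** * The semi-infinite subcategory *)

Section Cutfree.
Variables (k : fieldType) (A : gralg k) (A0 Aneg Apos : grsub A).
Hypothesis hA : semi_infinite_data A0 Aneg Apos.

(** An isomorphism between complexes of injectives is a homotopy equivalence. So [u] is compared
    with a map [v] from an injective resolution of Y, and no cohomology functor on the localization
    has to be set up. *)
Lemma iso_qiso (Y I : Dplus A) (u : cmap Y I) : (forall p, gm_injective (I p)) ->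
  dm_iso (dm_map u) -> quasi_iso u.
Proof.
move=> hI isou; have [I' [j [qj iI']]] := dplus_resolution hA Y.
have hI' p : gm_injective (I' p) by case: (iI' p).
have [v hv] := inj_extend hI u qj.
have isov : dm_iso (dm_map v).
  have [g [g1 g2]] := isou; exists (dm_comp (dm_map j) g).
  have e : dm_eq (dm_comp (dm_map v) (dm_map j)) (dm_map u).
    by rewrite -dm_map_comp; exact: htp_plus.
  split; last by rewrite dm_assoc e.
  by apply: (iso_cancelr (qiso_iso qj)); rewrite -dm_assoc e -dm_assoc g1 dm_idl dm_idr.
have [g [g1 g2]] := isov; have [w ew] := represent hI' g.
rewrite ew -dm_map_comp in g1; rewrite ew -dm_map_comp in g2.
apply: (qiso_htp hv); apply: qiso_comp => //.
by apply: (qiso_hequiv (g := w)); 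
  [exact: (dm_map_htp hI' (X := I') (v := cm_id I')) | exact: (dm_map_htp hI (X := I) (v := cm_id I))].
Qed.

(** The five lemma for cones. The square commutes only up to the homotopy [h], which enters the map
    (x, y) |-> (i x, j y - h x). *)
Lemma cone_map_qiso (X Y I K : cpx A) (f : cmap X Y) (F : cmap I K) (i : cmap X I) (j : cmap Y K) :
  quasi_iso i -> quasi_iso j -> htp (cm_comp F i) (cm_comp j f) ->
  exists c : cmap (cx_cone f) (cx_cone F), quasi_iso c.
Proof.
move=> /qisoP qi /qisoP qj [h [hh hE]].
have hE' p x : F (p + 1) (i (p + 1) x) = j (p + 1) (f (p + 1) x) +
    (cx_d K p (p + 1) (h (p + 1) p x) + h (p + 1 + 1) (p + 1) (cx_d X (p + 1) (p + 1 + 1) x)).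
  have zid (V : zmodType) (a b c : V) : a - b = c -> a = b + c by move=> <-; rewrite addrC subrK.
  by apply: zid; rewrite -(hE _ _ _ erefl erefl) !cm_compE.
pose c p : 'Hom(cx_cone f p, cx_cone F p) :=
  ((in1 _ _ \o i (p + 1)%R \o pr1 (X (p + 1)) (Y p)) + (in2 (I (p + 1)) (K p) \o
    ((j p \o pr2 _ _) - (h (p + 1)%R p \o pr1 _ _))))%VF.
have cE p z : c p z = (i (p + 1) z.1, j p z.2 - h (p + 1) p z.1).
  rewrite !add_lfunE !comp_lfunE in1E in2E add_lfunE opp_lfunE !comp_lfunE pr1E pr2E.
  by congr pair; rewrite /= ?addr0 ?add0r.
have [||C CE] := @cmap_of _ _ (cx_cone f) (cx_cone F) c.
- move=> p; apply: grhomD.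
    exact: grhom_comp (grhom_comp (in1_grhom _ _) (cm_hom i _)) (pr1_grhom _ _).
  apply: grhom_comp (in2_grhom _ _) _; apply: grhomB.
    exact: grhom_comp (cm_hom j p) (pr2_grhom _ _).
  exact: grhom_comp (hh _ _) (pr1_grhom _ _).
- move=> p q -> x; rewrite !coneE !cE /=; congr pair; first by rewrite lfunN cmE.
  rewrite lfunB lfunD lfunN opprK hE' !cmE.
  have zid (V : zmodType) (a b c' d : V) : a + (b + c') + (d - b) = a + d + c'.
    by rewrite !addrA [LHS](ACl (1 * 4 * 3 * (2 * 5))) /= subrr addr0.
  exact: zid.
exists C; apply/qisoP => p q r -> ->; split.
  case=> x y; rewrite coneE /= => -[/eqP dx dy] [[a b]].
  rewrite CE cE coneE /= => -[e1 e2].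
  have {}dx : cx_d X (p + 1 + 1) (p + 1 + 1 + 1) x = 0 by move: dx; rewrite oppr_eq0 => /eqP.
  have [|x' ex] := (qi (p + 1) _ _ erefl erefl).1 x dx.
    by exists (- a); rewrite e1 lfunN.
  pose y' := y + f (p + 1) x'.
  have dy' : cx_d Y (p + 1) (p + 1 + 1) y' = 0.
    by rewrite /y' lfunD cmE -ex; exact: etrans (addrC _ _) dy.
  have da : cx_d I (p + 1) (p + 1 + 1) (a + i (p + 1) x') = 0.
    by rewrite lfunD cmE -ex e1 subrr.
  have [x'' [a' [dx'' ea]]] := (qi p _ _ erefl erefl).2 _ da.
  have ej : j (p + 1) (y' - f (p + 1) x'') = cx_d K p (p + 1)
      (b + F p a' - h (p + 1) p x' + h (p + 1) p x'').
    have e3 : j (p + 1) y = F (p + 1) a + cx_d K p (p + 1) b + h (p + 1 + 1) (p + 1) x.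
      by rewrite -e2 subrK.
    have e4 := hE' p x'; have e5 := hE' p x''.
    have e6 : F (p + 1) (a + i (p + 1) x') = F (p + 1) (i (p + 1) x'' + cx_d I p (p + 1) a') by rewrite ea.
    rewrite !lfunD -cmE e4 e5 dx'' lfun0 addr0 -ex in e6.
    rewrite /y' !lfunD !lfunN e3.
    have zid (V : zmodType) (Fa jfx dhx hx jfx2 dhx2 db dFa : V) :
      Fa + (jfx + (dhx + hx)) = jfx2 + dhx2 + dFa ->
      Fa + db + hx + jfx - jfx2 = db + dFa - dhx + dhx2.
      move=> e; apply/eqP; rewrite subr_eq; apply/eqP.
      have -> : dFa = Fa + (jfx + (dhx + hx)) - (jfx2 + dhx2) by rewrite e [X in X - _]addrC addrK.
      rewrite opprD !addrA.
      rewrite [RHS](ACl (2 * 1 * 5 * 3 * (4 * 8) * (6 * 10) * (7 * 9))) /= subrr !addNr !addr0.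
      by [].
    exact: zid e6.
  have dy'' : cx_d Y (p + 1) (p + 1 + 1) (y' - f (p + 1) x'') = 0.
    by rewrite lfunB dy' cmE dx'' lfun0 subrr.
  have [|y'' ey] := (qj p _ _ erefl erefl).1 _ dy''; first by exists (b + F p a' - h (p + 1) p x' + h (p + 1) p x'').
  exists (x'' - x', y''); rewrite coneE /= lfunB dx'' sub0r opprK -ex -ey /y' lfunB.
  have zid (V : zmodType) (t d e : V) : d = e - t + (d + t - e).
    by rewrite !addrA [RHS](ACl (3 * (4 * 2) * (1 * 5))) /= !subrr !addr0.
  by congr pair; exact: zid.
case=> a b; rewrite coneE /= => -[/eqP da db].
have {}da : cx_d I (p + 1 + 1) (p + 1 + 1 + 1) a = 0 by move: da; rewrite oppr_eq0 => /eqP.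
have [x [a' [dx ea]]] := (qi _ _ _ erefl erefl).2 a da.
have e0 := hE' (p + 1) x; rewrite dx lfun0 addr0 in e0.
have dfx : cx_d Y (p + 1 + 1) (p + 1 + 1 + 1) (f (p + 1 + 1) x) = 0 by rewrite cmE dx lfun0.
have [|y0 ey0] := (qj (p + 1) _ _ erefl erefl).1 _ dfx.
  exists (- (b + F (p + 1) a' + h (p + 1 + 1) (p + 1) x)).
  rewrite lfunN !lfunD; rewrite ea lfunD e0 -cmE in db.
  have zid (V : zmodType) (t s d u : V) : t + d + s + u = 0 -> t = - (u + s + d).
    by move=> e; apply/eqP; rewrite -addr_eq0 -[X in _ == X]e !addrA [X in _ == X](ACl (1 * 4 * 3 * 2)).
  exact: zid db.
have db' : cx_d K (p + 1) (p + 1 + 1) (b + F (p + 1) a' + j (p + 1) y0 + h (p + 1 + 1) (p + 1) x) = 0.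
  rewrite !lfunD (cmE j) -ey0 cmE -[X in _ = X]db ea lfunD e0.
  have zid (V : zmodType) (t s d u : V) : t + u + s + d = s + d + u + t.
    by rewrite [LHS](ACl (3 * 4 * 2 * 1)).
  exact: zid.
have [y [b'' [dy eb]]] := (qj p _ _ erefl erefl).2 _ db'.
exists (x, y - y0), (- a', b''); rewrite CE cE !coneE /= dx lfunB dy -ey0 oppr0 sub0r subrr; split=> //.
rewrite ea !lfunN opprK lfunB; congr pair; rewrite /=.
have zid (V : zmodType) (t Fa jy hx jyy u : V) : t + Fa + jy + hx = jyy + u ->
    t = jyy - jy - hx + (- Fa + u).
  move=> e; have -> : t = jyy + u - (Fa + jy + hx) by apply/eqP; rewrite eq_sym subr_eq -e !addrA.
  rewrite !opprD !addrA [LHS](ACl (1 * 4 * 5 * 3 * 2)) /=.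
  by [].
exact: zid eb.
Qed.

Definition zres (c : int) (Z : cpx A) := exists (I : Dplus A) (i : cmap Z I),
  [/\ quasi_iso i, forall p, gm_injective (I p) & forall p, cutfree Apos c (I p)].

Lemma cutfree_le c c' (M : grmod A) : c' <= c -> cutfree Apos c M -> cutfree Apos c' M.
Proof. by move=> cc' h w hw; apply: h => u n uP cn; apply: hw => //; exact: le_trans cn. Qed.

Lemma zres_le c c' Z : c' <= c -> zres c Z -> zres c' Z.
Proof.
move=> cc' [I [i [qi iI cI]]]; exists I, i; split=> // p; exact: cutfree_le cc' (cI p).
Qed.

(** The devissage. The bound [c] starts below the weights of a module and drops to a minimum at a
    cone. Along an isomorphism the resolution [I] is kept and only the map into it changes;
    [iso_qiso] shows that the new map is a quasi-isomorphism. *)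
Lemma dsemi_zres (Z : Db A) : Dsemi Apos Z -> exists c, zres c Z.
Proof.
elim=> {Z} [Z Z0 iZ|i Z _ [c [I [j [qj iI cI]]]]|X Y f _ [c hX] _ [c' hY]|X Y f isof _ [c [I [i [qi iI cI]]]]].
- have [c [b h]] := wt_bounds (gm_grading (Z 0)); exists c.
  have Za p : p < 0 -> gm_zero (Z p) by move=> p0; apply: Z0; rewrite lt_eqF.
  have [p|p|I [i [qi Ia iI cI]]] := cut_resolution hA (c := c) Za.
  + by have [->//|/Z0/gm_zero_res] := eqVneq p 0; exact.
  + have [->|/Z0/cutfree_zero] := eqVneq p 0; last exact.
    by apply: cutfree_wt => n nc; apply: h; rewrite nc.
  have hb : bounded_below I by exists 0.
  by exists (CpxIn hb), i; split=> // p; case: (iI p).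
- exists c, (CpxIn (bb_shift i (ci_in I))), (cm_shift i j).
  by split=> [|p|p]; [exact: quasi_iso_shift | exact: iI | exact: cI].
- have [I [i [qi iI cI]]] := @zres_le c (Num.min c c') _ ltac:(by rewrite ge_min lexx) hX.
  have [K [j [qj iK cK]]] := @zres_le c' (Num.min c c') _ ltac:(by rewrite ge_min lexx orbT) hY.
  have [F hF] := inj_extend iK (cm_comp j f) qi.
  have [C qC] := cone_map_qiso qi qj hF.
  exists (Num.min c c'), (CpxIn (bb_cone F (ci_in I) (ci_in K))), C; split=> // p.
    by apply: gm_injective_sum.
  by apply: cutfree_sum.
- have [g [g1 g2]] := isof; have isog : dm_iso (dm_incl g).
    exists (dm_incl f); have := dm_incl_eq g1; have := dm_incl_eq g2 => /=.
    by split.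
  have [u eu] := represent iI (dm_comp (dm_map (X := db_incl X) i) (dm_incl g)).
  exists c, I, u; split=> //; apply: (@iso_qiso (db_incl Y) I u iI).
  apply: (iso_eq eu); apply: iso_comp => //; exact: (qiso_iso (X := db_incl X)).
Qed.

End Cutfree.

(** * Brutal truncations of J and maps out of them *)

Section LowerTruncation.
Variables (k : fieldType) (A : gralg k) (J : cpx A).
Implicit Types (n m p : int).

Definition upto n : pred int := fun p => p <= n.
Definition lt_cx n := btr J (upto n).

Lemma lt_prj_ex n : exists f : cmap J (lt_cx n), forall p x, f p x = bt_prj J (upto n) p x.
Proof. by apply: btr_prj_cm => p; rewrite /upto; lia. Qed.

Definition lt_prj n : cmap J (lt_cx n) := proj1_sig (constructive_indefinite_description _ (lt_prj_ex n)).
Lemma lt_prjE n p x : lt_prj n p x = bt_prj J (upto n) p x.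
Proof. exact: proj2_sig (constructive_indefinite_description _ (lt_prj_ex n)) p x. Qed.

Lemma lt_zero n p : n < p -> gm_zero (lt_cx n p).
Proof. by move=> np; apply: btob_out; rewrite /upto -ltNge. Qed.

Lemma lt_prjK n p x : p <= n -> bt_inj J (upto n) p (lt_prj n p x) = x.
Proof. by move=> pn; rewrite lt_prjE; exact: bt_prjK. Qed.

Lemma lt_dE n p q x : cx_d (lt_cx n) p q x = lt_prj n q (cx_d J p q (bt_inj J (upto n) p x)).
Proof. by rewrite lt_prjE; exact: btrE. Qed.

Lemma lt_map n (X : cpx A) (F : forall p, 'Hom(J p, X p)) : (forall p, is_grhom (F p)) ->
  (forall p, p < n -> forall x, cx_d X p (p + 1) (F p x) = F (p + 1) (cx_d J p (p + 1) x)) ->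
  (forall x, cx_d X n (n + 1) (F n x) = 0) ->
  exists f : cmap (lt_cx n) X, forall p x, f p x = F p (bt_inj J (upto n) p x).
Proof.
move=> hF cF cn; pose G p : 'Hom(lt_cx n p, X p) := (F p \o bt_inj J (upto n) p)%VF.
have GE p x : G p x = F p (bt_inj J (upto n) p x) by rewrite comp_lfunE.
have [||f fE] := @cmap_of _ _ (lt_cx n) X G.
- by move=> p; exact: grhom_comp (hF p) (bt_inj_hom _ _ _).
- move=> p q -> x; rewrite lt_dE !GE; have [lt|gt|e] := ltrgtP p n.
  + by rewrite cF // lt_prjK //; lia.
  + by rewrite (gm_zeroE (lt_zero gt) x) !lfun0.
  + move: x; rewrite e => x; rewrite cn.
    have z : gm_zero (lt_cx n (n + 1)) by apply: lt_zero; lia.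
    by rewrite (gm_zeroE z (lt_prj n _ _)) !lfun0.
by exists f => p x; rewrite fE GE.
Qed.

Lemma lt_bounded n : bounded_below J -> bounded (lt_cx n).
Proof.
move=> [a h]; exists a, n => p /orP[pa|np]; last exact: lt_zero.
by apply: btob_zero; exact: h.
Qed.

(** The transition map exists for n <= m; for other arguments a zero map is supplied, which makes
    [lt_tr] total. *)
Lemma lt_tr_ex m n : exists f : cmap (lt_cx m) (lt_cx n), n <= m ->
  forall p x, f p x = lt_prj n p (bt_inj J (upto m) p x).
Proof.
have [nm|mn] := lerP n m; last first.
  have [||f _] := @cmap_of _ _ (lt_cx m) (lt_cx n) (fun p => 0).
  - by move=> p; exact: grhom0.
  - by move=> p q _ x; rewrite !zero_lfunE lfun0.
  by exists f => nm.
have [|||f fE] := @lt_map m (lt_cx n) (lt_prj n).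
- exact: cm_hom.
- by move=> p _ x; exact: cmE.
- by move=> x; apply: gm_zeroE; apply: lt_zero; lia.
by exists f.
Qed.

Definition lt_tr m n := proj1_sig (constructive_indefinite_description _ (lt_tr_ex m n)).
Lemma lt_trE m n p x : n <= m -> lt_tr m n p x = lt_prj n p (bt_inj J (upto m) p x).
Proof. by move=> nm; exact: (proj2_sig (constructive_indefinite_description _ (lt_tr_ex m n)) nm). Qed.

Lemma lt_tr_prj m n p x : n <= m -> lt_tr m n p (lt_prj m p x) = lt_prj n p x.
Proof.
move=> nm; rewrite lt_trE //; have [pm|mp] := lerP p m; first by rewrite lt_prjK.
by apply: gm_zero_eq; apply: lt_zero; exact: le_lt_trans mp.
Qed.

Lemma lt_factor n (X : cpx A) (u : cmap J X) : (forall p, n < p -> u p = 0) ->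
  exists v : cmap (lt_cx n) X, forall p x, v p (lt_prj n p x) = u p x.
Proof.
move=> u0; have [|||v vE] := @lt_map n X u.
- exact: cm_hom.
- by move=> p _ x; exact: cmE.
- by move=> x; rewrite cmE u0 ?zero_lfunE // ltrDl.
exists v => p x; rewrite vE; have [pn|np] := lerP p n; first by rewrite lt_prjK.
by rewrite u0 // !zero_lfunE.
Qed.

(** Restricting a homotopy to degrees <= m loses only the component h (m + 1) m, in the equation of
    degree [m]. This component is zero because there are no nonzero graded maps J (m + 1) -> X m. *)
Lemma lt_htp n n' N (X : cpx A) (u : cmap (lt_cx n) X) (v : cmap (lt_cx n') X) :
  (forall p, N <= p -> forall f : 'Hom(J (p + 1), X p), is_grhom f -> f = 0) ->
  htp (cm_comp u (lt_prj n)) (cm_comp v (lt_prj n')) ->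
  forall m, N <= m -> n <= m -> n' <= m -> htp (cm_comp u (lt_tr m n)) (cm_comp v (lt_tr m n')).
Proof.
move=> h0 [h [hh hE]] m Nm nm nm'.
exists (fun p q => (h p q \o bt_inj J (upto m) p)%VF); split=> [p q|p q r e1 e2 x].
  exact: grhom_comp (hh _ _) (bt_inj_hom _ _ _).
rewrite (cm_compE u) (cm_compE v) !lt_trE // lt_dE !comp_lfunE.
have := hE _ _ _ e1 e2 (bt_inj J (upto m) p x); rewrite !cm_compE => ->; congr (_ + _).
rewrite e2; have [lt|gt|e] := ltrgtP p m; first by rewrite lt_prjK //; lia.
  by have z := lt_zero gt; rewrite (gm_zeroE z x) !lfun0.
have -> : h (p + 1) p = 0 by apply: h0 => //; rewrite e.
by rewrite !zero_lfunE.
Qed.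

End LowerTruncation.

(** * Maps from Apos-injective to Aneg-injective complexes *)

Section Contraction.
Variables (k : fieldType) (A : gralg k) (A0 Aneg Apos : grsub A).
Hypothesis hA : semi_infinite_data A0 Aneg Apos.

(** With [s] from the degree before, e = 1 - d s vanishes on boundaries, which are all cocycles.
    Hence it extends along d to some [t] by injectivity over [U], and d t d = d e = d. *)
Lemma acyclic_contraction (U : grsub A) (C : cpx A) (a : int) :
  acyclic C -> (forall p, p < a -> gm_zero (C p)) -> (forall p, injective_over U (C p)) ->
  forall p q, q = p + 1 -> exists s : 'Hom(C q, C p), Uhom U s /\ forall x, cx_d C p q (s (cx_d C p q x)) = cx_d C p q x.
Proof.
move=> aC Ca iC; have H (n : nat) : forall p q, p < a + n%:Z -> q = p + 1 ->
    exists s : 'Hom(C q, C p), Uhom U s /\ forall x, cx_d C p q (s (cx_d C p q x)) = cx_d C p q x.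
  elim: n => [|n IH] p q pn ->.
    exists 0; split; first exact: grhom_Uhom (grhom0 _ _).
    have z : gm_zero (C p) by apply: Ca; move: pn; rewrite addr0.
    by move=> x; rewrite (gm_zeroE z x) !lfun0.
  have [s [hs sE]] : exists s : 'Hom(C p, C (p - 1)), Uhom U s /\ forall x, cx_d C (p - 1) p (s (cx_d C (p - 1) p x)) = cx_d C (p - 1) p x.
    by apply: IH; [lia | rewrite subrK].
  pose e : 'Hom(C p, C p) := \1%VF - (cx_d C (p - 1)%R p \o s)%VF.
  have eE x : e x = x - cx_d C (p - 1) p (s x).
    by rewrite add_lfunE opp_lfunE id_lfunE comp_lfunE.
  have he : Uhom U e.
    apply/resP; apply: grhomB; first exact: grhom1.
    exact: grhom_comp (grhom_res _ (cx_d_hom _ _ _)) ((resP _ _).2 hs).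
  have [|t [ht tE]] := inj_ext (iC p) (grhom_res U (cx_d_hom C p (p + 1))) ((resP U e).2 he).
    move=> x /(aC (p - 1) p (p + 1) (esym (subrK 1 p)) erefl) [y ->].
    by apply: etrans (eE _) _; rewrite sE subrr.
  exists t; split; first exact/resP.
  move=> x; have -> : t (cx_d C p (p + 1) x) = e x by rewrite -tE comp_lfunE.
  by rewrite eE lfunB ddE subr0.
by move=> p q; apply: (H (absz (p - a + 1))); lia.
Qed.

Section Lift.
Variables (Q : Db A) (K : Dplus A).
Hypotheses (iQ : forall p, injective_over Apos (Q p)) (iK : forall p, injective_over Aneg (K p)).

Lemma cone_lift (I : Dplus A) (i : cmap K I) : quasi_iso i ->
  (forall p, injective_over Aneg (I p)) ->
  forall p q' q r, q = q' + 1 -> r = q + 1 ->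
  forall u : 'Hom(Q p, cx_cone i q), is_grhom u ->
     (forall x, cx_d (cx_cone i) q r (u x) = 0) ->
     exists v : 'Hom(Q p, cx_cone i q'), is_grhom v /\ (cx_d (cx_cone i) q' q \o v)%VF = u.
Proof.
move=> qi iI p q' q r e1 e2 u hu du; have [a Ca] := bb_cone i (ci_in K) (ci_in I).
have aC := cone_acyclic qi.
have iC j : injective_over Aneg (cx_cone i j) by apply: injective_over_sum.
have [s [hs sE]] := acyclic_contraction aC Ca iC e1.
apply: (@lifting _ _ _ _ _ hA (Q p) (cx_cone i q') (cx_cone i q) (cx_d (cx_cone i) q' q) s u) => //.
- exact: cx_d_hom.
- by apply/lfunP => x; rewrite 2!comp_lfunE sE.
by move=> x; have [y ->] := aC q' q r e1 e2 _ (du x).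
Qed.

(** The morphism is first represented by a chain map into an A-injective resolution I of K and then
    lifted along K -> I. Boundedness of Q above starts the descending induction of [null_lift]. *)
Lemma rep_exists (f : dmor (db_incl Q) K) : exists v : cmap Q K,
  dm_eq f (dm_map (X := db_incl Q) v).
Proof.
have [I [i [qi iI]]] := dplus_resolution hA K.
have hI p : gm_injective (I p) by case: (iI p).
have nI p : injective_over Aneg (I p) by case: (iI p).
have [a [b Qab]] := ci_in Q; have Qb p : b < p -> gm_zero (Q p) by move=> bp; apply: Qab; rewrite bp orbT.
have [u eu] := represent hI (dm_comp (dm_map i) f).
have [v hv] := qiso_lift Qb (cone_lift qi nI) u.
exists v; apply: (iso_cancell (qiso_iso qi)); rewrite eu -dm_map_comp.
apply: dm_sym; exact: (htp_plus (X := db_incl Q)).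
Qed.

Lemma rep_unique (u v : cmap Q K) :
  dm_eq (dm_map (X := db_incl Q) u) (dm_map (X := db_incl Q) v) -> htp u v.
Proof.
move=> e; have [I [i [qi iI]]] := dplus_resolution hA K.
have hI p : gm_injective (I p) by case: (iI p).
have nI p : injective_over Aneg (I p) by case: (iI p).
have [a [b Qab]] := ci_in Q; have Qb p : b < p -> gm_zero (Q p) by move=> bp; apply: Qab; rewrite bp orbT.
apply: (qiso_lift_unique Qb (cone_lift qi nI)).
by apply: (dm_map_htp hI (X := db_incl Q)); rewrite !(dm_map_comp (X := db_incl Q)) e.
Qed.

End Lift.
End Contraction.

Section ShiftPlus.
Variables (k : fieldType) (A : gralg k) (i : int).

Definition dp_shift (X : Dplus A) : Dplus A := CpxIn (bb_shift i (ci_in X)).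

Fixpoint dm_pshift (X Y : Dplus A) (f : dmor X Y) : dmor (dp_shift X) (dp_shift Y) :=
  match f with
  | dm_map X Y f => @dm_map _ _ _ (dp_shift X) (dp_shift Y) (cm_shift i f)
  | dm_inv X Y s qs => @dm_inv _ _ _ (dp_shift X) (dp_shift Y) _ (quasi_iso_shift i qs)
  | dm_comp X Y Z g f => dm_comp (dm_pshift g) (dm_pshift f)
  end.

Lemma cm_shiftE (X Y : cpx A) (f : cmap X Y) p x : cm_shift i f p x = f (p + i) x.
Proof. by []. Qed.

Lemma dm_pshift_eq (X Y : Dplus A) (f g : dmor X Y) : dm_eq f g ->
  dm_eq (dm_pshift f) (dm_pshift g).
Proof.
elim=> {X Y f g} /=.
- by [].
- by move=> X Y f g _ ->.
- by move=> X Y f g h _ -> _ ->.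
- by move=> X Y Z g g' f f' _ -> _ ->.
- by move=> X Y Z T h g f; exact: dm_assoc.
- move=> X Y f; rewrite -[X in dm_eq _ X]dm_idl; apply: dm_congr => //.
  by apply: dm_map_ext' => p x; rewrite cm_shiftE !cm_idE.
- move=> X Y f; rewrite -[X in dm_eq _ X]dm_idr; apply: dm_congr => //.
  by apply: dm_map_ext' => p x; rewrite cm_shiftE !cm_idE.
- by move=> X Y f g e; apply: dm_map_ext => p; exact: e.
- move=> X Y Z g f; rewrite -dm_map_comp.
  by apply: dm_map_ext' => p x; rewrite cm_shiftE !cm_compE.
- move=> X Y s qs; rewrite dm_invl; apply: dm_map_ext' => p x.
  by rewrite cm_shiftE !cm_idE.
- move=> X Y s qs; rewrite dm_invr; apply: dm_map_ext' => p x.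
  by rewrite cm_shiftE !cm_idE.
Qed.

Lemma dm_pshift_iso (X Y : Dplus A) (f : dmor X Y) : dm_iso f -> dm_iso (dm_pshift f).
Proof.
have idE (Z : Dplus A) : dm_eq (dm_pshift (dm_id Z)) (dm_id (dp_shift Z)).
  by apply: dm_map_ext' => p x; rewrite cm_shiftE !cm_idE.
move=> [g [/dm_pshift_eq g1 /dm_pshift_eq g2]]; exists (dm_pshift g).
by split; rewrite -idE; [exact: g1 | exact: g2].
Qed.

(* Source and target differ only in the proof of boundedness. *)
Definition incl_shift (Y : Db A) : dmor (dp_shift (db_incl Y)) (db_incl (db_shift i Y)) :=
  dm_map (X := dp_shift (db_incl Y)) (Y := db_incl (db_shift i Y)) (cm_id (cx_shift i Y)).

Lemma incl_shift_iso (Y : Db A) : dm_iso (incl_shift Y).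
Proof. by apply: qiso_iso; exact: qiso_id. Qed.

Lemma incl_shift_nat (Y Y' : Db A) (g : dmor Y Y') :
  dm_eq (dm_comp (incl_shift Y') (dm_pshift (dm_incl g)))
        (dm_comp (dm_incl (dm_shift i g)) (incl_shift Y)).
Proof.
elim: g => {Y Y'} [X Y f|X Y s qs|X Y Z g IHg f IHf] /=.
- rewrite -!dm_map_comp; apply: dm_map_ext' => p x; rewrite !cm_compE !cm_idE.
  by [].
- have e : dm_eq (dm_comp (incl_shift Y) (dm_map (X := dp_shift (db_incl X)) (Y := dp_shift (db_incl Y)) (cm_shift i s)))
     (dm_comp (dm_map (X := db_incl (db_shift i X)) (Y := db_incl (db_shift i Y)) (cm_shift i s)) (incl_shift X)).
    rewrite -!dm_map_comp; apply: dm_map_ext' => p x; rewrite !cm_compE !cm_idE.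
    by [].
  apply: (iso_cancell (qiso_iso (X := db_incl (db_shift i X)) (Y := db_incl (db_shift i Y)) (quasi_iso_shift i qs))).
  rewrite [X in dm_eq _ X]dm_assoc dm_invr dm_idl dm_assoc -e -dm_assoc.
  by rewrite (dm_invr (X := dp_shift (db_incl X)) (Y := dp_shift (db_incl Y))) dm_idr.
- by rewrite dm_assoc IHg -dm_assoc IHf dm_assoc.
Qed.

End ShiftPlus.

(** * Morphisms through the semi-infinite subcategory *)

Section WeightBounds.
Variables (k : fieldType) (A : gralg k).

Lemma seq_int_bound (s : seq int) : exists N, forall n, n \in s -> n < N.
Proof.
elim: s => [|n s [N h]]; first by exists 0.
exists (Num.max N (n + 1)) => p; rewrite inE lt_max => /orP[/eqP ->|/h ->] //.
by rewrite ltrDl ltr01 orbT.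
Qed.

Lemma convex_bound (J : cpx A) c : convex J ->
  exists N, forall p m, N <= p -> c <= m -> gm_wt (J p) m = 0%VS.
Proof.
move=> /(_ (c - 1))[s h]; have [N hN] := seq_int_bound s; exists N => p m Np cm; apply: h; last lia.
by apply/negP => /hN; rewrite ltNge Np.
Qed.

Lemma concave_bound (J : cpx A) c : concave J ->
  exists N, forall p m, N <= p -> m < c -> gm_wt (J p) m = 0%VS.
Proof.
move=> /(_ c)[s h]; have [N hN] := seq_int_bound s; exists N => p m Np; apply: h.
by apply/negP => /hN; rewrite ltNge Np.
Qed.

Lemma grhom_disjoint (M N : grmod A) (f : 'Hom(M, N)) : is_grhom f ->
  (forall m, gm_wt M m = 0%VS \/ gm_wt N m = 0%VS) -> f = 0.
Proof.
move=> [_ fw] h; apply: (homog_ext (gm_grading M)) => n v vn; rewrite zero_lfunE.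
have [M0|N0] := h n.
  by move: vn; rewrite M0 memv0 => /eqP ->; rewrite lfun0.
by have := fw n v vn; rewrite N0 memv0 => /eqP.
Qed.

(* In high degrees the weights of J are negative and those of L are not. *)
Lemma hom_vanish (J L : cpx A) : convex J -> concave L ->
  exists N, forall p q, N <= p -> N <= q -> forall f : 'Hom(J p, L q), is_grhom f -> f = 0.
Proof.
move=> /(convex_bound 0)[N h] /(concave_bound 0)[N' h'].
exists (Num.max N N') => p q; rewrite !ge_max => /andP[Np _] /andP[_ Nq] f hf.
apply: (grhom_disjoint hf) => m; have [m0|m0] := lerP 0 m; [left; exact: h | right; exact: h'].
Qed.

End WeightBounds.

Section Truncations.
Variables (k : fieldType) (A : gralg k) (J : Dplus A).
Implicit Types n m : int.

Definition lt_db n : Db A := CpxIn (lt_bounded n (ci_in J)).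
Definition pj n : dmor J (db_incl (lt_db n)) := dm_map (X := J) (Y := db_incl (lt_db n)) (lt_prj J n).
Definition tr m n : dmor (db_incl (lt_db m)) (db_incl (lt_db n)) :=
  dm_map (X := db_incl (lt_db m)) (Y := db_incl (lt_db n)) (lt_tr J m n).

Lemma tr_pj m n : n <= m -> dm_eq (dm_comp (tr m n) (pj m)) (pj n).
Proof.
by move=> nm; rewrite -dm_map_comp; apply: dm_map_ext' => p x; rewrite cm_compE lt_tr_prj.
Qed.

Variables (A0 Aneg Apos : grsub A).
Hypothesis hA : semi_infinite_data A0 Aneg Apos.
Hypothesis cJ : convex J.
Variable Z : Db A.
Hypothesis hZ : Dsemi Apos Z.

Lemma dsemi_factor (f : dmor J (db_incl Z)) : exists n (g : dmor (db_incl (lt_db n)) (db_incl Z)),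
  dm_eq (dm_comp g (pj n)) f.
Proof.
have [c [I [i [qi iI cI]]]] := dsemi_zres hA hZ; have [n hn] := convex_bound c cJ.
have [u eu] := represent iI (dm_comp (dm_map (X := db_incl Z) i) f).
have [|v vE] := lt_factor (n := n) (u := u).
  by move=> p np; apply: (cutfree_hom (cI p)) (cm_hom u p) => m cm; apply: hn => //; exact: ltW.
exists n, (dm_comp (dm_inv (X := db_incl Z) (Y := I) qi) (dm_map (X := db_incl (lt_db n)) v)).
apply: (iso_cancell (qiso_iso (X := db_incl Z) (Y := I) qi)).
rewrite eu !dm_assoc dm_invr dm_idl -dm_map_comp.
by apply: dm_map_ext' => p x; rewrite cm_compE vE.
Qed.

(** With [dsemi_factor] this says that Hom(J, Z) is the colimit of the Hom(J_n, Z). Convexity of J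
    enters through [lt_htp]: in high degrees there are no nonzero graded maps from J to the cut-free
    resolution of Z. *)
Lemma dsemi_factor_unique n n' (f : dmor (db_incl (lt_db n)) (db_incl Z))
    (g : dmor (db_incl (lt_db n')) (db_incl Z)) :
  dm_eq (dm_comp f (pj n)) (dm_comp g (pj n')) ->
  exists m, [/\ n <= m, n' <= m & dm_eq (dm_comp f (tr m n)) (dm_comp g (tr m n'))].
Proof.
move=> e; have [c [I [i [qi iI cI]]]] := dsemi_zres hA hZ; have [N hN] := convex_bound c cJ.
pose j : dmor (db_incl Z) I := dm_map (X := db_incl Z) i.
have [u eu] := represent iI (dm_comp j f); have [v ev] := represent iI (dm_comp j g).
pose m := Num.max N (Num.max n n').
have Nm : N <= m by rewrite le_max lexx.
have nm : n <= m by rewrite !le_max lexx orbT.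
have nm' : n' <= m by rewrite !le_max lexx !orbT.
exists m; split=> //; apply: (iso_cancell (qiso_iso (X := db_incl Z) (Y := I) qi)).
rewrite -/j !dm_assoc eu ev -!dm_map_comp.
apply: (htp_plus (X := db_incl (lt_db m))); apply: (lt_htp (N := N)) => //.
  move=> p Np h hh; apply: (cutfree_hom (cI p)) hh => w cw; apply: hN => //.
  by rewrite (le_trans Np) // lerDl.
apply: (dm_map_htp iI); rewrite !(dm_map_comp (Y := db_incl (lt_db _))) -eu -ev.
by rewrite -!dm_assoc -/(pj n) -/(pj n') e.
Qed.

End Truncations.

Section Realizes.
Variables (k : fieldType) (A : gralg k) (A0 Aneg Apos : grsub A).
Hypothesis hA : semi_infinite_data A0 Aneg Apos.

Definition lmap (J L : Dplus A) n (a : cmap (lt_cx J n) L) : dmor (db_incl (lt_db J n)) L :=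
  dm_map (X := db_incl (lt_db J n)) a.

(** A relation, because the degree [n], the factorization [f] through the truncation and the chain
    map [a] are choices; [c] is the resulting chain map J -> L, meant up to homotopy. *)
Definition realizes (X W : Db A) (J L : Dplus A) (rho : dmor J (db_incl X))
    (sig : dmor L (db_incl W)) (t : thru (Dsemi Apos) X W) (c : cmap J L) : Prop :=
  exists n (f : dmor (db_incl (lt_db J n)) (db_incl (th_mid t))) (a : cmap (lt_cx J n) L),
  [/\ dm_eq (dm_comp f (pj J n)) (dm_comp (dm_incl (th_src t)) rho),
      dm_eq (dm_comp sig (lmap a)) (dm_comp (dm_incl (th_tgt t)) f)
    & htp c (cm_comp a (lt_prj J n))].

Lemma lmap_tr (J L : Dplus A) m n (a : cmap (lt_cx J n) L) :
  dm_eq (dm_comp (lmap a) (tr J m n)) (lmap (cm_comp a (lt_tr J m n))).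
Proof. by apply: dm_sym; exact: (dm_map_comp (X := db_incl (lt_db J m)) (Y := db_incl (lt_db J n))). Qed.

Section Fixed.
Variables (X W : Db A) (J L : Dplus A).
Variables (rho : dmor J (db_incl X)) (sig : dmor L (db_incl W)).
Hypotheses (cJ : convex J) (iJ : forall p, injective_over Apos (J p)) (irho : dm_iso rho).
Hypotheses (cL : concave L) (iL : forall p, injective_over Aneg (L p)) (isig : dm_iso sig).
Implicit Types (t : thru (Dsemi Apos) X W) (c : cmap J L).
Local Notation realizes := (realizes rho sig).

Lemma lt_inj n p : injective_over Apos (lt_db J n p).
Proof. exact: btr_injective_over. Qed.

Lemma realizes_htp t c c' : htp c c' -> realizes t c -> realizes t c'.
Proof.
move=> h [n [f [a [e1 e2 e3]]]]; exists n, f, a; split=> //; exact: htp_trans (htp_sym h) e3.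
Qed.

Lemma lift_sig n (f : dmor (db_incl (lt_db J n)) (db_incl W)) :
  exists a : cmap (lt_cx J n) L, dm_eq (dm_comp sig (lmap a)) f.
Proof.
have [g [g1 g2]] := isig.
have [a ea] := rep_exists hA (@lt_inj n) iL (dm_comp g f); exists a.
by rewrite /lmap -ea dm_assoc g2 dm_idl.
Qed.

Lemma realizes_exists t : exists c, realizes t c.
Proof.
have [n [f ef]] := dsemi_factor hA cJ (th_in t) (dm_comp (dm_incl (th_src t)) rho).
have [a ea] := lift_sig (dm_comp (dm_incl (th_tgt t)) f).
by exists (cm_comp a (lt_prj J n)), n, f, a; split=> //; exact: htp_refl.
Qed.

Lemma sig_htp n (a b : cmap (lt_cx J n) L) :
  dm_eq (dm_comp sig (lmap a)) (dm_comp sig (lmap b)) -> htp a b.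
Proof. move=> e; apply: (rep_unique hA (@lt_inj n) iL); exact: iso_cancell isig e. Qed.

Lemma realizes_unique t c c' : realizes t c -> realizes t c' -> htp c c'.
Proof.
move=> [n [f [a [e1 e2 e3]]]] [n' [f' [a' [e1' e2' e3']]]].
have [|m [nm nm' em]] := dsemi_factor_unique hA cJ (th_in t) (f := f) (g := f').
  by rewrite e1 e1'.
have h : htp (cm_comp a (lt_tr J m n)) (cm_comp a' (lt_tr J m n')).
  apply: sig_htp; rewrite -!lmap_tr !dm_assoc e2 e2' -!dm_assoc em.
  by [].
apply: htp_trans e3 _; apply: htp_trans (htp_sym e3').
have trE l (b : cmap (lt_cx J l) L) : l <= m ->
    htp (cm_comp b (lt_prj J l)) (cm_comp (cm_comp b (lt_tr J m l)) (lt_prj J m)).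
  by move=> lm; apply: htp_ext => p x; rewrite !cm_compE lt_tr_prj.
apply: htp_trans (trE _ _ nm) _; apply: htp_trans _ (htp_sym (trE _ _ nm')).
by apply: htp_comp => //; exact: htp_refl.
Qed.

Lemma realizes_step t t' c : thru_step t t' -> realizes t c -> realizes t' c.
Proof.
move=> [h [h1 h2]] [n [f [a [e1 e2 e3]]]].
exists n, (dm_comp (dm_incl h) f), a; split=> //.
- rewrite -dm_assoc e1 dm_assoc; apply: dm_congr => //; exact: (dm_incl_eq h1).
- rewrite e2 dm_assoc; apply: dm_congr => //; apply: dm_sym; exact: (dm_incl_eq h2).
Qed.

(** Steps are directed and [realizes_step] transports along them. Backwards, some chain map realized
    by [t] is also realized by [t'], hence homotopic to [c] by uniqueness. *)
Lemma realizes_thru_eq t t' : thru_eq t t' -> forall c, realizes t c <-> realizes t' c.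
Proof.
elim=> {t t'} [t t' st c|//|t t' _ IH c|t t' t'' _ IH _ IH' c].
- split; first exact: realizes_step.
  move=> h'; have [c0 h0] := realizes_exists t.
  exact: (realizes_htp (realizes_unique (realizes_step st h0) h') h0).
- by split=> /IH.
- by split=> [/IH/IH'|/IH'/IH].
Qed.

Lemma thru_to_trunc n : exists s : dmor X (lt_db J n), dm_eq (dm_comp (dm_incl s) rho) (pj J n).
Proof.
have [g [g1 g2]] := irho; have [s es] := db_full hA (dm_comp (pj J n) g).
by exists s; rewrite es -dm_assoc g1 dm_idr.
Qed.

Lemma realizes_onto c : exists t, realizes t c.
Proof.
have [n hn] := hom_vanish cJ cL.
have [|a aE] := lt_factor (n := n) (u := c).
  by move=> p np; apply: (hn p p) (cm_hom c p); exact: ltW.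
have [s es] := thru_to_trunc n; have [g eg] := db_full hA (dm_comp sig (lmap a)).
exists (Thru (dsemi_bounded (@lt_inj n)) s g), n, (dm_id _), a; split=> /=.
- by rewrite dm_idl es.
- by rewrite dm_idr eg.
- by apply: htp_ext => p x; rewrite cm_compE aE.
Qed.

Lemma thru_step_trunc t n m (f : dmor (db_incl (lt_db J n)) (db_incl (th_mid t)))
    (a : cmap (lt_cx J n) L) (s : dmor X (lt_db J m)) (g : dmor (lt_db J m) W) B : n <= m ->
  dm_eq (dm_comp f (pj J n)) (dm_comp (dm_incl (th_src t)) rho) ->
  dm_eq (dm_comp sig (lmap a)) (dm_comp (dm_incl (th_tgt t)) f) ->
  dm_eq (dm_comp (dm_incl s) rho) (pj J m) ->
  dm_eq (dm_incl g) (dm_comp sig (lmap (cm_comp a (lt_tr J m n)))) ->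
  thru_step (@Thru _ _ (Dsemi Apos) X W (lt_db J m) B s g) t.
Proof.
move=> nm e1 e2 es eg; have [h eh] := db_full hA (dm_comp f (tr J m n)).
exists h; split; apply: (db_faithful hA) => /=.
- by apply: (iso_cancelr irho); rewrite eh -dm_assoc es -dm_assoc tr_pj.
- by rewrite eh dm_assoc -e2 -dm_assoc lmap_tr eg.
Qed.

(** The two middle objects are not compared directly: both diagrams receive a step from one diagram
    through a truncation J_m. Here [m] is so large that the homotopy between the two chain maps on J
    descends to J_m, by [hom_vanish]. *)
Lemma realizes_inj t t' c : realizes t c -> realizes t' c -> thru_eq t t'.
Proof.
move=> [n [f [a [e1 e2 e3]]]] [n' [f' [a' [e1' e2' e3']]]].
have [N hN] := hom_vanish cJ cL.
pose m := Num.max N (Num.max n n').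
have Nm : N <= m by rewrite le_max lexx.
have nm : n <= m by rewrite !le_max lexx orbT.
have nm' : n' <= m by rewrite !le_max lexx !orbT.
have h : htp (cm_comp a (lt_tr J m n)) (cm_comp a' (lt_tr J m n')).
  apply: (lt_htp (N := N)) => // [p Np v hv|]; last exact: htp_trans (htp_sym e3) e3'.
  by apply: hN hv => //; rewrite (le_trans Np) // lerDl.
have [s es] := thru_to_trunc m; have [g eg] := db_full hA (dm_comp sig (lmap (cm_comp a (lt_tr J m n)))).
have eg' : dm_eq (dm_incl g) (dm_comp sig (lmap (cm_comp a' (lt_tr J m n')))).
  by rewrite eg; apply: dm_congr => //; exact: (htp_plus (X := db_incl (lt_db J m))).
have B := dsemi_bounded (@lt_inj m).
apply: (rst_trans _ _ _ (Thru B s g)).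
- by apply: rst_sym; apply: rst_step; exact: thru_step_trunc nm e1 e2 es eg.
- by apply: rst_step; exact: thru_step_trunc nm' e1' e2' es eg'.
Qed.

(** The two projections of the factorization [f] realize [t] and [t'] through chain maps [a1] and
    [a2], so the claim is that [a] is homotopic to their sum. This is checked after mapping to an
    A-injective resolution of W, where [sum_add] applies. *)
Lemma realizes_sum t t' t'' c c' : thru_sum t t' t'' -> realizes t c -> realizes t' c' ->
  realizes t'' (cm_add c c').
Proof.
move=> [F [G [B [[F1 F2] [G1 G2] ->]]]] hc hc'.
have [c'' hc''] := realizes_exists (Thru B F G).
suff hs : htp c'' (cm_add c c') by exact: (realizes_htp hs hc'').
case: (hc'') => n [f [a [/= e1 e2 e3]]].
pose S := db_sum (th_mid t) (th_mid t').
pose P1 := dm_incl (db_pr1 (th_mid t) (th_mid t')); pose P2 := dm_incl (db_pr2 (th_mid t) (th_mid t')).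
have [a1 ea1] := lift_sig (dm_comp (dm_incl (th_tgt t)) (dm_comp P1 f)).
have [a2 ea2] := lift_sig (dm_comp (dm_incl (th_tgt t')) (dm_comp P2 f)).
have h1 : htp c (cm_comp a1 (lt_prj J n)).
  apply: (realizes_unique hc); exists n, (dm_comp P1 f), a1; split=> //; last exact: htp_refl.
  by rewrite -dm_assoc e1 dm_assoc; apply: dm_congr => //; exact: (dm_incl_eq F1).
have h2 : htp c' (cm_comp a2 (lt_prj J n)).
  apply: (realizes_unique hc'); exists n, (dm_comp P2 f), a2; split=> //; last exact: htp_refl.
  by rewrite -dm_assoc e1 dm_assoc; apply: dm_congr => //; exact: (dm_incl_eq F2).
have h : htp a (cm_add a1 a2).
  apply: sig_htp; rewrite e2.
  have [I [j [qj iI]]] := dplus_resolution hA (db_incl W).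
  have hI p : gm_injective (I p) by case: (iI p).
  apply: (iso_cancell (qiso_iso (X := db_incl W) (Y := I) qj)).
  set dj := dm_map _; have [w ew] := represent hI (dm_comp dj sig).
  have lw (b : cmap (lt_cx J n) L) : dm_eq (dm_comp (dm_comp dj sig) (lmap b)) (lmap (cm_comp w b)).
    by rewrite ew; apply: dm_sym; exact: (dm_map_comp (X := db_incl (lt_db J n))).
  rewrite [X in dm_eq _ X]dm_assoc lw.
  have -> : dm_eq (lmap (cm_comp w (cm_add a1 a2))) (lmap (cm_add (cm_comp w a1) (cm_comp w a2))).
    by apply: dm_map_ext' => p x; rewrite cm_compE !cm_addE !cm_compE lfunD.
  rewrite dm_assoc.
  apply: (sum_add hI (hS := bounded_bb (ci_in S)) (Z := db_incl (th_mid t)) (Z' := db_incl (th_mid t')) (W := db_incl (lt_db J n))).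
  - rewrite -[dm_map _]/(lmap (cm_comp w a1)) -lw -(dm_assoc dj sig) ea1 -!dm_assoc; apply: dm_congr => //.
    rewrite dm_assoc; apply: dm_congr => //; exact: (dm_incl_eq G1).
  - rewrite -[dm_map _]/(lmap (cm_comp w a2)) -lw -(dm_assoc dj sig) ea2 -!dm_assoc; apply: dm_congr => //.
    rewrite dm_assoc; apply: dm_congr => //; exact: (dm_incl_eq G2).
apply: htp_trans e3 _; apply: htp_trans (htp_comp h (htp_refl _)) _.
apply: htp_trans (htp_sym (htp_add h1 h2)).
by apply: htp_ext => p x; rewrite cm_compE !cm_addE !cm_compE.
Qed.

End Fixed.

Lemma thru_sum_exists (X W : Db A) (t t' : thru (Dsemi Apos) X W) : exists t'', thru_sum t t' t''.
Proof.
have [F [F1 F2]] := db_pair hA (th_src t) (th_src t').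
have [G [G1 G2]] := db_copair hA (th_tgt t) (th_tgt t').
by exists (Thru (dsemi_sum (th_in t) (th_in t')) F G), F, G, (dsemi_sum (th_in t) (th_in t')).
Qed.

(** [u] induces maps between the truncations at the same [n], along which the data realizing [t]
    pull back. *)
Lemma realizes_pre (X X' W : Db A) (J J' L : Dplus A) (rho : dmor J (db_incl X))
    (rho' : dmor J' (db_incl X')) (sig : dmor L (db_incl W)) (f : dmor X' X) (u : cmap J' J) t c :
  dm_eq (dm_comp rho (dm_map u)) (dm_comp (dm_incl f) rho') ->
  realizes rho sig t c -> realizes rho' sig (thru_pre f t) (cm_comp c u).
Proof.
move=> eu [n [g [a [e1 e2 e3]]]].
pose F p : 'Hom(J' p, lt_cx J n p) := (lt_prj J n p \o u p)%VF.
have FE p x : F p x = lt_prj J n p (u p x) by rewrite comp_lfunE.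
have [|||v vE] := @lt_map _ _ J' n (lt_cx J n) F.
- by move=> p; exact: grhom_comp (cm_hom _ _) (cm_hom _ _).
- by move=> p _ x; rewrite !FE !cmE.
- by move=> x; apply: gm_zeroE; apply: lt_zero; rewrite ltrDl.
have vp p x : v p (lt_prj J' n p x) = lt_prj J n p (u p x).
  rewrite vE FE; have [pn|np] := lerP p n; first by rewrite lt_prjK.
  exact: gm_zero_eq (lt_zero J np) _ _.
pose V := dm_map (X := db_incl (lt_db J' n)) (Y := db_incl (lt_db J n)) v.
have eV : dm_eq (dm_comp V (pj J' n)) (dm_comp (pj J n) (dm_map u)).
  by rewrite -!dm_map_comp; apply: dm_map_ext' => p x; rewrite !cm_compE vp.
exists n, (dm_comp g V), (cm_comp a v); split.
- by rewrite -dm_assoc eV dm_assoc e1 -dm_assoc eu /= dm_assoc.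
- rewrite /= dm_assoc -e2 -dm_assoc; apply: dm_congr => //.
  exact: (dm_map_comp (X := db_incl (lt_db J' n)) (Y := db_incl (lt_db J n))).
- apply: htp_trans (htp_comp e3 (htp_refl _)) _.
  by apply: htp_ext => p x; rewrite !cm_compE vp.
Qed.

Lemma realizes_post (X W W' : Db A) (J L L' : Dplus A) (rho : dmor J (db_incl X))
    (sig : dmor L (db_incl W)) (sig' : dmor L' (db_incl W')) (g : dmor W W') (v : cmap L L') t c :
  dm_eq (dm_comp sig' (dm_map v)) (dm_comp (dm_incl g) sig) ->
  realizes rho sig t c -> realizes rho sig' (thru_post g t) (cm_comp v c).
Proof.
move=> ev [n [f [a [e1 e2 e3]]]]; exists n, f, (cm_comp v a); split=> //=.
- rewrite -dm_assoc -e2 dm_assoc -ev -dm_assoc; apply: dm_congr => //.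
  exact: (dm_map_comp (X := db_incl (lt_db J n))).
- apply: htp_trans (htp_comp (htp_refl v) e3) _; exact: cm_compA.
Qed.

End Realizes.

(** * The isomorphism *)

Section Families.
Variables (k : fieldType) (A : gralg k) (J K : cpx A) (i : int).

Lemma sign_sq : (-1) ^ i * (-1) ^ i = 1 :> k.
Proof. by rewrite -exprzMl ?unitrN1 // mulrNN mulr1 exp1rz. Qed.

Lemma sign_pred : (-1) ^ (i - 1) = - (-1) ^ i :> k.
Proof. by rewrite expfzDr ?oppr_eq0 ?oner_eq0 // exprN1 invrN invr1 mulrN1. Qed.

Definition fam (c : cmap J (cx_shift i K)) : hom_fam J K :=
  fun p q => (recast K (p + i) q \o c p)%VF.

Lemma famE (c : cmap J (cx_shift i K)) p x : fam c p (p + i) x = c p x.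
Proof. by rewrite comp_lfunE recastE. Qed.

Lemma recast_neq (M : int -> grmod A) p q : p != q -> recast M p q = 0.
Proof. by rewrite /recast; case: (p =P q). Qed.

Lemma fam_neq (c : cmap J (cx_shift i K)) p q : q != p + i -> fam c p q = 0.
Proof. by move=> ne; rewrite /fam recast_neq ?comp_lfun0l // eq_sym. Qed.

Lemma fam_hom (c : cmap J (cx_shift i K)) p q : is_grhom (fam c p q).
Proof. by apply: (@grhom_comp _ _ (J p) (K (p + i)) (K q)); [exact: recast_hom | exact: cm_hom c p]. Qed.

Lemma hom_dE n (f : hom_fam J K) p q q' x : q = q' + 1 ->
  hom_d n f p q x = cx_d K q' q (f p q' x) - (-1) ^ n *: f (p + 1) q (cx_d J p (p + 1) x).
Proof.
move=> e; have -> : q' = q - 1 by rewrite e addrK.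
by rewrite add_lfunE opp_lfunE scale_lfunE !comp_lfunE.
Qed.

Lemma shift_dE p q x : cx_d (cx_shift i K) p q x = (-1) ^ i *: cx_d K (p + i) (q + i) x.
Proof. exact: scale_lfunE. Qed.

Lemma hom_d_deg n (f : hom_fam J K) p q : hom_cochain n f -> q != p + n + 1 -> hom_d n f p q = 0.
Proof.
move=> [_ f0] ne; rewrite /hom_d !f0 ?comp_lfun0l ?comp_lfun0r ?scaler0 ?subr0 //.
- by apply: contra_neq ne => ->; ring.
- by apply: contra_neq ne => e; rewrite -e subrK.
Qed.

Lemma fam_cochain c : hom_cochain i (fam c).
Proof. by split=> [p q|p q]; [exact: fam_hom | exact: fam_neq]. Qed.

(** The sign (-1)^i in the differential of K[i] matches the sign in [hom_d]. *)
Lemma fam_cocycle c : hom_cocycle i (fam c).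
Proof.
split=> [|p q]; first exact: fam_cochain.
have [->|ne] := eqVneq q (p + i + 1); last exact: hom_d_deg (fam_cochain c) ne.
apply/lfunP => x; rewrite (hom_dE _ _ _ (erefl (p + i + 1))) zero_lfunE famE.
have -> : p + i + 1 = p + 1 + i by ring.
rewrite famE; have := @cmE _ _ _ _ c p (p + 1) x; rewrite shift_dE => <-.
by rewrite scalerA sign_sq scale1r subrr.
Qed.

Lemma fam_onto (f : hom_fam J K) : hom_cocycle i f ->
  exists c : cmap J (cx_shift i K), forall p q, fam c p q = f p q.
Proof.
move=> [[hf f0] df].
have [||c cE] := @cmap_of _ _ J (cx_shift i K) (fun p => f p (p + i)).
- by move=> p; exact: hf.
- move=> p q -> x; rewrite shift_dE.
  have e : p + 1 + i = p + i + 1 by ring.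
  have := congr1 (fun h : 'Hom(J p, K (p + 1 + i)) => h x) (df p (p + 1 + i)).
  rewrite (hom_dE _ _ _ e) zero_lfunE => /eqP; rewrite subr_eq0 => /eqP ->.
  by rewrite scalerA sign_sq scale1r.
exists c => p q; have [->|ne] := eqVneq q (p + i); last by rewrite fam_neq // f0.
by apply/lfunP => x; rewrite famE cE.
Qed.

Lemma cohomologous_ext n (f f' g g' : hom_fam J K) : (forall p q, f p q = f' p q) ->
  (forall p q, g p q = g' p q) -> hom_cohomologous n f g -> hom_cohomologous n f' g'.
Proof. by move=> e e' [h [hh hE]]; exists h; split=> // p q; rewrite -e -e'. Qed.

(** A homotopy h corresponds to the cochain (-1)^i h of degree i - 1: the factor absorbs the sign of
    the differential of K[i] in one term of [hom_d], and (-1)^(i - 1) in the other. *)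
Lemma fam_htp (c c' : cmap J (cx_shift i K)) :
  htp c c' <-> hom_cohomologous i (fam c) (fam c').
Proof.
split=> [[h [hh hE]]|[h [[hh h0] hE]]].
- pose H : hom_fam J K := fun p q => (-1) ^ i *: (recast K (p - 1 + i) q \o h p (p - 1)%R)%VF.
  have HE p q x : p = q + 1 -> H p (q + i) x = (-1) ^ i *: h p q x.
    move=> e; rewrite scale_lfunE comp_lfunE; have -> : q = p - 1 by rewrite e addrK.
    by rewrite recastE.
  have Hc : hom_cochain (i - 1) H.
    split=> [p q|p q ne].
      apply: grhomZ; apply: (@grhom_comp _ _ (J p) (K (p - 1 + i)) (K q)); first exact: recast_hom.
      exact: hh.
    by rewrite /H recast_neq ?comp_lfun0l ?scaler0 // eq_sym; apply: contra_neq ne => ->; ring.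
  exists H; split=> // p q; have [->|ne] := eqVneq q (p + i); last first.
    rewrite !fam_neq // subr0 hom_d_deg //; apply: contra_neq ne => ->.
    by ring.
  apply/lfunP => x; rewrite add_lfunE opp_lfunE !famE.
  have e1 : p = p - 1 + 1 by rewrite subrK.
  have e2 : p + i = p - 1 + i + 1 by ring.
  rewrite (hE _ _ _ e1 erefl) (hom_dE _ _ _ e2) (HE p (p - 1)) // (HE (p + 1) p) //.
  by rewrite shift_dE lfunZ sign_pred scaleNr opprK scalerA sign_sq scale1r.
- exists (fun p q => (-1) ^ i *: h p (q + i)); split=> [p q|p q r e -> x].
    exact: grhomZ (hh _ _).
  have := congr1 (fun l : 'Hom(J p, K (p + i)) => l x) (hE p (p + i)).
  have e2 : p + i = q + i + 1 by rewrite e; ring.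
  rewrite /= add_lfunE opp_lfunE !famE (hom_dE _ _ _ e2) => ->.
  by rewrite shift_dE !scale_lfunE lfunZ sign_pred scaleNr opprK scalerA sign_sq scale1r.
Qed.

Lemma fam_add (c c' : cmap J (cx_shift i K)) p q :
  fam (cm_add c c') p q = hom_add (fam c) (fam c') p q.
Proof.
have [->|ne] := eqVneq q (p + i); last by rewrite /hom_add !fam_neq // addr0.
by apply/lfunP => x; rewrite /hom_add add_lfunE !famE cm_addE.
Qed.

End Families.

Lemma fam_pre (k : fieldType) (A : gralg k) (J' J K : cpx A) i (c : cmap J (cx_shift i K))
  (u : cmap J' J) p q : fam (cm_comp c u) p q = hom_pre u (fam c) p q.
Proof. by rewrite /fam /hom_pre comp_lfunA. Qed.

Lemma fam_post (k : fieldType) (A : gralg k) (J K K' : cpx A) i (c : cmap J (cx_shift i K))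
  (v : cmap K K') p q : fam (cm_comp (cm_shift i v) c) p q = hom_post v (fam c) p q.
Proof.
have [->|ne] := eqVneq q (p + i); last by rewrite /hom_post !fam_neq // comp_lfun0r.
by apply/lfunP => x; rewrite /hom_post [RHS]comp_lfunE !famE cm_compE.
Qed.

Section Main.
Variables (k : fieldType) (A : gralg k) (A0 Aneg Apos : grsub A).
Hypothesis hA : semi_infinite_data A0 Aneg Apos.

Section Phi.
Variables (X Y : Db A) (i : int) (J : down_res Apos X) (K : up_res Aneg Y).

Definition shift_map : dmor (dp_shift i K) (db_incl (db_shift i Y)) :=
  dm_comp (incl_shift i Y) (dm_pshift i (rs_map K)).

Lemma shift_map_iso : dm_iso shift_map.
Proof. by apply: iso_comp; [exact: incl_shift_iso | apply: dm_pshift_iso; exact: rs_iso]. Qed.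

Lemma shift_inj p : injective_over Aneg (dp_shift i K p).
Proof. exact: (rs_good K).2. Qed.

Lemma shift_concave : concave (dp_shift i K).
Proof.
move=> n; have [s h] := (rs_good K).1 n; exists [seq p - i | p <- s] => p m ps mn.
apply: h => //; apply: contra ps => ps; apply/mapP; exists (p + i) => //.
by rewrite addrK.
Qed.

Definition represents t (c : cmap J (dp_shift i K)) := realizes (Apos := Apos) (rs_map J) shift_map t c.

Lemma represents_exists t : exists c, represents t c.
Proof.
exact (realizes_exists hA (rs_map J) (rs_good J).1 (rs_good J).2 shift_inj shift_map_iso t).
Qed.

Definition phi t : cmap J (dp_shift i K) :=
  proj1_sig (constructive_indefinite_description _ (represents_exists t)).

Lemma phiP t : represents t (phi t).
Proof. exact: proj2_sig (constructive_indefinite_description _ (represents_exists t)). Qed.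

Lemma phi_unique t c : represents t c -> htp (phi t) c.
Proof.
exact: (realizes_unique hA (rs_good J).1 (rs_good J).2 shift_inj shift_map_iso (phiP t)).
Qed.

Lemma phi_eq t t' : thru_eq t t' <-> htp (phi t) (phi t').
Proof.
have cJ := (rs_good J).1; have iJ := (rs_good J).2; split=> [e|h].
  apply: phi_unique.
  by apply/(realizes_thru_eq hA (rs_map J) cJ iJ shift_inj shift_map_iso e); exact: phiP.
apply: (realizes_inj hA cJ iJ (rs_iso J) shift_concave (phiP t)).
exact: realizes_htp (htp_sym h) (phiP t').
Qed.

Lemma phi_onto c : exists t, htp (phi t) c.
Proof.
have [t ht] := realizes_onto hA shift_map (rs_good J).1 (rs_good J).2 (rs_iso J) shift_concave c.
by exists t; exact: phi_unique.
Qed.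

Lemma phi_sum t t' t'' : thru_sum t t' t'' -> htp (phi t'') (cm_add (phi t) (phi t')).
Proof.
move=> h; apply: phi_unique; apply: (realizes_sum hA (rs_good J).1 (rs_good J).2 shift_inj shift_map_iso h);
  exact: phiP.
Qed.

End Phi.

Lemma phi_pre (X X' Y : Db A) i (J : down_res Apos X) (J' : down_res Apos X') (K : up_res Aneg Y)
  (f : dmor X' X) (u : cmap J' J) : res_over u f -> forall t : thru (Dsemi Apos) X (db_shift i Y),
  htp (phi J' K (thru_pre f t)) (cm_comp (phi J K t) u).
Proof. by move=> h t; apply: phi_unique; apply: (realizes_pre h); exact: phiP. Qed.

Lemma phi_post (X Y Y' : Db A) i (J : down_res Apos X) (K : up_res Aneg Y) (K' : up_res Aneg Y')
  (g : dmor Y Y') (v : cmap K K') : res_over v g -> forall t : thru (Dsemi Apos) X (db_shift i Y),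
  htp (phi J K' (thru_post (dm_shift i g) t)) (cm_comp (cm_shift i v) (phi J K t)).
Proof.
move=> h t; apply: phi_unique; apply: (realizes_post (L := dp_shift i K) (L' := dp_shift i K') (sig := shift_map i K)); last exact: phiP.
have := dm_pshift_eq i h => /= e.
by rewrite /shift_map -dm_assoc e !dm_assoc incl_shift_nat.
Qed.

End Main.

Theorem theorem1 (k : fieldType) (A : gralg k) (A0 Aneg Apos : grsub A)
  (hA : semi_infinite_data A0 Aneg Apos) :
  exists Phi : forall (X Y : Db A) (i : int)
                 (J : down_res Apos X) (K : up_res Aneg Y),
                 thru (Dsemi Apos) X (db_shift i Y) -> hom_fam J K,
  [/\ (forall X Y i (J : down_res Apos X) (K : up_res Aneg Y) t,
         hom_cocycle i (Phi X Y i J K t)),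
      (forall X Y i (J : down_res Apos X) (K : up_res Aneg Y),
         [/\ (forall t t', thru_eq t t' <->
                hom_cohomologous i (Phi X Y i J K t) (Phi X Y i J K t')),
             (forall c : hom_fam J K, hom_cocycle i c ->
                exists t, hom_cohomologous i (Phi X Y i J K t) c)
           & (forall t t', (exists t'', thru_sum t t' t'') /\
                forall t'', thru_sum t t' t'' ->
                  hom_cohomologous i (Phi X Y i J K t'')
                    (hom_add (Phi X Y i J K t) (Phi X Y i J K t')))]),
      (forall X X' Y i (J : down_res Apos X) (J' : down_res Apos X')
          (K : up_res Aneg Y) (f : dmor X' X) (u : cmap J' J),
         res_over u f -> forall t,
           hom_cohomologous i (Phi X' Y i J' K (thru_pre f t))
             (hom_pre u (Phi X Y i J K t)))
    & (forall X Y Y' i (J : down_res Apos X) (K : up_res Aneg Y)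
          (K' : up_res Aneg Y') (g : dmor Y Y') (v : cmap K K'),
         res_over v g -> forall t,
           hom_cohomologous i (Phi X Y' i J K' (thru_post (dm_shift i g) t))
             (hom_post v (Phi X Y i J K t)))].
Proof.
exists (fun X Y i J K t => fam (phi hA J K t)); split.
- by move=> X Y i J K t; exact: fam_cocycle.
- move=> X Y i J K; split.
  + by move=> t t'; rewrite phi_eq; exact: fam_htp.
  + move=> f /fam_onto[c cE]; have [t ht] := phi_onto hA c; exists t.
    by apply: (cohomologous_ext _ cE) ((fam_htp _ _).1 ht).
  + move=> t t'; split; first exact (thru_sum_exists hA t t').
    move=> t'' /(phi_sum hA J K) h.
    exact: (cohomologous_ext _ (fam_add _ _)) ((fam_htp _ _).1 h).
- move=> X X' Y i J J' K f u hu t.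
  exact: (cohomologous_ext _ (fam_pre _ _)) ((fam_htp _ _).1 (phi_pre hA K hu t)).
- move=> X Y Y' i J K K' g v hv t.
  exact: (cohomologous_ext _ (fam_post _ _)) ((fam_htp _ _).1 (phi_post hA J hv t)).
Qed.
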